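(* Let $S,T\subset\mathbb{R}^n$ be disjoint measurable sets and suppose the boundary of $S$ is piecewise linear. Then $H_S\cap H_T=\{0\}$.
   Context: Fix $n\ge 1$ and $m>0$, and let $E(\vec p)=\sqrt{|\vec p|^2+m^2}$ for $\vec p\in\mathbb{R}^n$. Let $L^2_r(\mathbb{R}^n)=L^2(\mathbb{R}^n,d\vec p/E(\vec p))$, with norm $\|\phi\|_r=\left(\int|\phi(\vec p)|^2\,\frac{d\vec p}{E(\vec p)}\right)^{1/2}$; note $L^2(\mathbb{R}^n)\subset L^2_r(\mathbb{R}^n)$. The Fourier transform is normalized to be unitary on $L^2(\mathbb{R}^n)$, $\hat\psi(\vec p)=(2\pi)^{-n/2}\int e^{-\mathrm{i}\vec p\cdot\vec x}\psi(\vec x)\,d\vec x$. For measurable $S\subset\mathbb{R}^n$, $L^2(S)$ is the set of functions in $L^2(\mathbb{R}^n)$ vanishing almost everywhere off $S$, and $H_S\subset L^2_r(\mathbb{R}^n)$ is the closure, with respect to $\|\cdot\|_r$, of $\{\hat\psi:\psi\in L^2(S)\}$. The boundary of $S$ is piecewise linear if it is a locally finite union of closed convex polyhedra, each contained in an affine hyperplane of $\mathbb{R}^n$. *)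

(* Defs.v *)
From HB Require Import structures.
From mathcomp Require Import all_boot all_order all_algebra.
From mathcomp Require Import all_classical all_reals all_analysis.
From mathcomp Require Import complex.

Set Implicit Arguments.
Unset Strict Implicit.
Unset Printing Implicit Defensive.

Import Order.TTheory GRing.Theory Num.Theory.
Import numFieldNormedType.Exports.
Import complex.ComplexField.Normc.

Local Open Scope classical_set_scope.
Local Open Scope ring_scope.
Local Open Scope complex_scope.

(* The product of n copies of the Borel sigma-algebra of R, which is the Borel
   sigma-algebra of ['rV[R]_n]. *)
Definition measure_rV_display : measure_display.
Proof. exact: default_measure_display. Qed.

Section measurable_rV.
Context {R : realType} {n : nat}.

Let coord (i : 'I_n) (x : 'rV[R]_n) : measurableTypeR R := x ord0 i.

Let rV_set0 : g_sigma_preimage coord set0.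
Proof. exact: sigma_algebra0. Qed.

Let rV_setC A : g_sigma_preimage coord A -> g_sigma_preimage coord (~` A).
Proof. exact: sigma_algebraC. Qed.

Let rV_bigcup (F : (set 'rV[R]_n)^nat) :
  (forall i, g_sigma_preimage coord (F i)) ->
  g_sigma_preimage coord (\bigcup_i (F i)).
Proof. exact: sigma_algebra_bigcup. Qed.

HB.instance Definition _ := @isMeasurable.Build measure_rV_display
  'rV[R]_n (g_sigma_preimage coord) rV_set0 rV_setC rV_bigcup.

Lemma measurable_coord (i : 'I_n) :
  measurable_fun setT (fun x : 'rV[R]_n => x ord0 i : measurableTypeR R).
Proof.
move=> _ Y mY; rewrite setTI; apply: sub_sigma_algebra => /=.
rewrite -bigcup_seq/=; exists i => /=; first by rewrite mem_index_enum.
by exists Y => //; rewrite setTI.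
Qed.

Lemma measurable_fun_rV d (X : measurableType d) (f : X -> 'rV[R]_n) :
  (forall i, measurable_fun setT (fun x => f x ord0 i : measurableTypeR R)) ->
  measurable_fun setT f.
Proof.
move=> mf _ A mA; rewrite setTI.
have : <<s \big[setU/set0]_(i < n)
    preimage_set_system setT (coord i) measurable >> A by exact: mA.
pose F : set (set 'rV[R]_n) := [set B | measurable (f @^-1` B)].
suff: <<s \big[setU/set0]_(i < n)
    preimage_set_system setT (coord i) measurable >> `<=` F by apply.
apply: smallest_sub.
  split => /=.
  - by rewrite /F /= preimage_set0.
  - by move=> B FB; rewrite /F /= setTD preimage_setC; exact: measurableC.
  - move=> B mB; rewrite /F /= preimage_bigcup.
    exact: bigcupT_measurable.
rewrite -bigcup_seq; apply: bigcup_sub => i _ B [C mC <-].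
by rewrite /F /= setTI -[X in measurable X]setTI; exact: mf.
Qed.

End measurable_rV.

Definition cons_rV {R : realType} {n : nat} (z : measurableTypeR R * 'rV[R]_n) :
  'rV[R]_n.+1 := row_mx (z.1%:M : 'rV[R]_1) z.2.

Lemma cons_rV0 (R : realType) n (z : measurableTypeR R * 'rV[R]_n) :
  cons_rV z ord0 ord0 = z.1.
Proof.
have <- : row_mx (z.1%:M : 'rV[R]_1) z.2 ord0 (lshift n ord0) = z.1.
  by rewrite row_mxEl mxE eqxx mulr1n.
by congr (_ _ _); apply: val_inj.
Qed.

Lemma cons_rVS (R : realType) n (z : measurableTypeR R * 'rV[R]_n) i :
  cons_rV z ord0 (lift ord0 i) = z.2 ord0 i.
Proof.
have <- : row_mx (z.1%:M : 'rV[R]_1) z.2 ord0 (rshift 1 i) = z.2 ord0 i.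
  by rewrite row_mxEr.
by congr (_ _ _); apply: val_inj.
Qed.

Lemma measurable_cons_rV (R : realType) n :
  measurable_fun setT (@cons_rV R n).
Proof.
apply: measurable_fun_rV => i; case: (unliftP ord0 i) => [j|] ->.
- under eq_fun do rewrite cons_rVS.
  by apply: (measurableT_comp (measurable_coord j)); exact: measurable_snd.
- under eq_fun do rewrite cons_rV0.
  exact: measurable_fst.
Qed.

Definition uncons_rV {R : realType} {n : nat} (x : 'rV[R]_n.+1) :
  measurableTypeR R * 'rV[R]_n :=
  (x ord0 ord0, \row_j x ord0 (lift ord0 j)).

Lemma cons_rVK (R : realType) n : cancel (@cons_rV R n) uncons_rV.
Proof.
move=> [a v]; rewrite /uncons_rV cons_rV0; congr pair.
by apply/rowP => j; rewrite mxE cons_rVS.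
Qed.

Lemma measurable_uncons_rV (R : realType) n :
  measurable_fun setT (@uncons_rV R n).
Proof.
apply: measurable_fun_pair => /=; first exact: measurable_coord.
apply: measurable_fun_rV => i; under eq_fun do rewrite mxE.
exact: measurable_coord.
Qed.

Section lebesgue_step.
Local Open Scope ereal_scope.
Context {R : realType} {n : nat}.
Variable mu : {sigma_finite_measure set 'rV[R]_n -> \bar R}.

Definition lebesgue_step : set 'rV[R]_n.+1 -> \bar R :=
  pushforward (@lebesgue_measure R \x mu) (@cons_rV R n).

Let mcons (A : set 'rV[R]_n.+1) :
  measurable A -> measurable (@cons_rV R n @^-1` A).
Proof. by move=> mA; rewrite -[X in measurable X]setTI; exact: measurable_cons_rV. Qed.

Let step0 : lebesgue_step set0 = 0.
Proof. by rewrite /lebesgue_step /pushforward preimage_set0 measure0. Qed.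

Let step_ge0 A : 0 <= lebesgue_step A.
Proof. by rewrite /lebesgue_step /pushforward; exact: measure_ge0. Qed.

Let step_sigma_additive : semi_sigma_additive lebesgue_step.
Proof.
move=> F mF tF mUF; rewrite /lebesgue_step /pushforward preimage_bigcup.
apply: measure_semi_sigma_additive.
- by move=> i; exact: mcons.
- apply/trivIsetP => /= i j _ _ ij; rewrite -preimage_setI.
  by move/trivIsetP : tF => /(_ _ _ _ _ ij) ->//; rewrite preimage_set0.
- by rewrite -preimage_bigcup; exact: mcons.
Qed.

HB.instance Definition _ := isMeasure.Build _ _ _ lebesgue_step
  step0 step_ge0 step_sigma_additive.

Let step_sigma_finite : sigma_finite setT lebesgue_step.
Proof.
have /sigma_finiteP[F [FT ndF Foo]] := sigma_finiteT (@lebesgue_measure R).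
have /sigma_finiteP[G [GT ndG Goo]] := sigma_finiteT mu.
have FGT : \bigcup_i (F i `*` G i) = setT.
  rewrite -subTset => -[x y] _.
  have [i _ Fix] : (\bigcup_i F i) x by rewrite -FT.
  have [j _ Gjy] : (\bigcup_i G i) y by rewrite -GT.
  exists (maxn i j) => //; split => /=.
  - by move: x Fix; exact/subsetPset/ndF/leq_maxl.
  - by move: y Gjy; exact/subsetPset/ndG/leq_maxr.
exists (fun i => uncons_rV @^-1` (F i `*` G i)).
  by rewrite -preimage_bigcup FGT preimage_setT.
move=> i; have [mFi Fi] := Foo i; have [mGi Gi] := Goo i; split.
  rewrite -[X in measurable X]setTI; apply: measurable_uncons_rV => //.
  exact: measurableX.
rewrite /lebesgue_step /pushforward -comp_preimage.
rewrite (_ : uncons_rV \o _ = id); last first.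
  by apply/funext => z /=; rewrite cons_rVK.
by rewrite preimage_id product_measure1E// lte_mul_pinfty// ge0_fin_numE.
Qed.

HB.instance Definition _ := Measure_isSigmaFinite.Build _ _ _ lebesgue_step
  step_sigma_finite.
End lebesgue_step.

(* n-dimensional Lebesgue measure on Borel sets, as the iterated product of the
   one-dimensional one transported to row vectors. *)
Fixpoint lebesgue_rV (R : realType) (n : nat) :
    {sigma_finite_measure set 'rV[R]_n -> \bar R} :=
  match n with
  | 0%N => dirac (0 : 'rV[R]_0)
  | n'.+1 => lebesgue_step (lebesgue_rV R n')
  end.

Lemma lebesgue_rV_box (R : realType) n (A : 'I_n -> set (measurableTypeR R)) :
  (forall i, measurable (A i)) ->
  lebesgue_rV R n [set x : 'rV[R]_n | forall i, A i (x ord0 i)] =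
  (\prod_(i < n) lebesgue_measure (A i))%E.
Proof.
elim: n A => [|n IHn] A mA.
  have -> : [set x : 'rV[R]_0 | forall i, A i (x ord0 i)] = setT.
    by rewrite -subTset => x _ [].
  by rewrite big_ord0; exact: diracT.
have mbox : measurable [set x : 'rV[R]_n | forall i, A (lift ord0 i) (x ord0 i)].
  suff -> : [set x : 'rV[R]_n | forall i, A (lift ord0 i) (x ord0 i)] =
      \bigcap_i [set x | A (lift ord0 i) (x ord0 i)].
    apply: fin_bigcap_measurable => // i _.
    rewrite -[X in measurable X]setTI.
    exact: (measurable_coord i measurableT (mA (lift ord0 i))).
  by apply/seteqP; split => [x Ax i _|x Ax i]; [exact: Ax|exact: (Ax i)].
rewrite big_ord_recl -IHn// -product_measure1E//.
congr (product_measure1 _ _ _); apply/seteqP; split => z /=.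
  move=> Az; split => [|i]; first by have := Az ord0; rewrite cons_rV0.
  by have := Az (lift ord0 i); rewrite cons_rVS.
move=> [A0 AS] i; case: (unliftP ord0 i) => [j|] ->; last by rewrite cons_rV0.
by rewrite cons_rVS; exact: AS.
Qed.

(* Measurability of subsets of R^n is in the sense of Lebesgue: [mu^*] is the
   Lebesgue outer measure. *)
Definition lebesgue_measurable (R : realType) n (S : set 'rV[R]_n) : Prop :=
  ((lebesgue_rV R n)^*)%mu.-caratheodory S.

(* Elements of L^2 spaces are represented by Borel-measurable functions, and
   sets of elements by sets of functions closed under a.e. equality; every
   Lebesgue-measurable function is a.e. equal to a Borel one. *)

Section spaces.
Context {R : realType} {n : nat}.
Local Notation V := 'rV[R]_n.
Local Notation leb := (lebesgue_rV R n).
Implicit Types (f psi phi : V -> R[i]) (S : set V) (m : R).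

Definition dot (x y : V) : R := \sum_(i < n) x ord0 i * y ord0 i.

Definition cmeasurable f : Prop :=
  measurable_fun setT (fun x => complex.Re (f x)) /\
  measurable_fun setT (fun x => complex.Im (f x)).

Definition cintegrable f : Prop :=
  leb.-integrable setT (fun x => (complex.Re (f x))%:E) /\
  leb.-integrable setT (fun x => (complex.Im (f x))%:E).

Definition cintegral f : R[i] :=
  (\int[leb]_x complex.Re (f x)) +i* (\int[leb]_x complex.Im (f x)).

Definition L2norm f : \bar R := ('N[leb]_2%:E [EFin \o (@normc R \o f)])%E.

Definition L2 : set (V -> R[i]) :=
  [set f | cmeasurable f /\ (L2norm f < +oo)%E].

Definition L2_on S : set (V -> R[i]) :=
  [set f | L2 f /\ {ae leb, forall x, ~ S x -> f x = 0}].

Definition energy m (p : V) : R := Num.sqrt (dot p p + m ^+ 2).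

Definition rnorm m f : \bar R :=
  ((\int[leb]_p (normc (f p) ^+ 2 / energy m p)%:E) `^ 2^-1)%E.

Definition L2r m : set (V -> R[i]) :=
  [set f | cmeasurable f /\ (rnorm m f < +oo)%E].

(* The kernel cos - i sin is exp (- i p.x). *)
Definition fourier_L1 psi (p : V) : R[i] :=
  ((2 * pi) `^ (- (n%:R / 2)))%:C *
  cintegral (fun x => (cos (dot p x) -i* sin (dot p x)) * psi x).

(* [fourier psi phi]: phi is the Fourier transform of psi in L^2, i.e. its image
   under the continuous extension to L^2 of [fourier_L1] on L^1 `&` L^2. *)
Definition fourier psi phi : Prop :=
  [/\ L2 psi, L2 phi &
    exists u : nat -> V -> R[i],
      [/\ (forall k, L2 (u k) /\ cintegrable (u k)),
          L2norm (u k \- psi) @[k --> \oo] --> 0%E &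
          L2norm (fourier_L1 (u k) \- phi) @[k --> \oo] --> 0%E]].

(* Closure in L^2_r, not in L^2: rnorm m is weaker than L2norm. *)
Definition Hspace m S : set (V -> R[i]) :=
  [set phi | L2r m phi /\
    forall e : R, 0 < e ->
      exists psi chi, [/\ L2_on S psi, fourier psi chi &
        (rnorm m (phi \- chi)%R < e%:E)%E]].

(* The zero subspace, i.e. the a.e. class of the function 0. *)
Definition null_space : set (V -> R[i]) :=
  [set phi | cmeasurable phi /\ {ae leb, forall p, phi p = 0}].

Definition boundary S : set V := closure S `\` S°.

(* A closed convex polyhedron is a finite intersection of closed half-spaces; it
   need not be bounded. *)
Definition polyhedron (P : set V) : Prop :=
  exists (k : nat) (a : 'I_k -> V) (b : 'I_k -> R),
    P = [set x | forall i, dot (a i) x <= b i].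

Definition in_hyperplane (P : set V) : Prop :=
  exists (c : V) (d : R), c != 0 /\ P `<=` [set x | dot c x = d].

Definition locally_finite (F : set (set V)) : Prop :=
  forall x : V, exists2 U, nbhs x U & finite_set [set P | F P /\ P `&` U !=set0].

Definition piecewise_linear (B : set V) : Prop :=
  exists F : set (set V),
    [/\ locally_finite F,
        (forall P, F P -> polyhedron P /\ in_hyperplane P) &
        B = \bigcup_(P in F) P].

End spaces.

(* Main.v *)
Require Import Defs.
From mathcomp Require Import all_boot all_order all_algebra.
From mathcomp Require Import all_classical all_reals all_analysis.
From mathcomp Require Import finmap measurable_realfun complex ring lra.

(** Pair [phi] in both spaces with the transform of a real test function [g] by
    the unweighted inner product. By Parseval the transform of a function living
    on [S] is orthogonal to that of [g] as soon as [g] vanishes on [S]. The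
    closure defining [Hspace] is taken for the weaker norm with weight 1/E, whose
    dual norm has weight E, of the order of |p|: orthogonality survives when [g]
    has half a derivative in L^2, that is, lies in H^(1/2)
    ([Hspace_pairing0]).

    So [phi] is orthogonal to every [g] in H^(1/2) that vanishes on [S] and to
    every one that vanishes on [T]. The question is whether their sums are dense
    among all test functions, and the answer is that hyperplanes have capacity
    zero for H^(1/2): a cutoff that rises from 0 on a hyperplane to 1 at distance
    e has slope 1/e on a layer of volume O(e), so its energy, of the order of
    slope times volume, stays bounded ([lip_tame], [lebesgue_strip]). In a
    compact box the boundary of [S] lies in finitely many hyperplanes, because
    the family of polyhedra is locally finite ([hyperplane_cover]). A compactly
    supported Lipschitz function times such a cutoff vanishes on the boundary
    of [S]; its product with the indicator of [S] is still Lipschitz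
    ([lip_restrict]) and vanishes on [T], and the rest vanishes on [S]. As e tends
    to 0 the products tend to the test function in L^2 with bounded energy, and
    the pairing passes to such a limit ([pairing_limit]). Hence [phi] is
    orthogonal to all compactly supported Lipschitz functions
    ([pairing_compact0]).

    A further limit of the same kind allows the damped waves
    exp (- e |x_1| - ... - e |x_n|) cos (q.x), and the same with the sine
    ([pairing_wave0]). Their transforms are products of Poisson kernels centred
    at q and - q; taken together they give the integral of [phi] against each
    kernel centred at q ([pker_orthogonal]). Averaging over q in a product of
    intervals and letting e tend to 0 shows that the integral of [phi] over every
    such product vanishes, so [phi] vanishes almost everywhere
    ([pker_orthogonal_eq0]).

    The H^(1/2) energy is never defined by transforms: [gagliardo] measures it by
    squared differences against Poisson kernels. Parseval's identity holds with
    exponential damping by Fubini alone ([weighted_parseval]), and this one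
    identity yields Bessel's inequality, the bound on the energy integral of the
    spectrum ([energy_le]) and the undamped Parseval identity ([parseval]). *)

Set Implicit Arguments.
Unset Strict Implicit.
Unset Printing Implicit Defensive.

Import Order.TTheory GRing.Theory Num.Theory.
Import numFieldNormedType.Exports.

Local Open Scope classical_set_scope.
Local Open Scope ring_scope.

(** * Integrable real functions *)

Section rintegrable.
Context d (T : measurableType d) (R : realType).
Variable mu : {measure set T -> \bar R}.
Implicit Types f g h : T -> R.

Definition rintegrable f : Prop := mu.-integrable setT (EFin \o f).

Lemma rintegrable_measurable f : rintegrable f -> measurable_fun setT f.
Proof. by move=> /measurable_int /measurable_EFinP. Qed.

Lemma rintegrable_dom f g : measurable_fun setT f -> rintegrable g ->
  (forall x, `|f x| <= g x) -> rintegrable f.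
Proof.
move=> mf ig fg; apply: le_integrable ig => //; first exact/measurable_EFinP.
by move=> x _ /=; rewrite lee_fin (le_trans (fg x))// ler_norm.
Qed.

Lemma eq_rintegrable f g : f =1 g -> rintegrable f -> rintegrable g.
Proof. by move=> /funext ->. Qed.

Lemma rintegrable0 : rintegrable (fun=> 0).
Proof. exact: integrable0. Qed.

Lemma rintegrableD f g : rintegrable f -> rintegrable g ->
  rintegrable (fun x => f x + g x).
Proof. by move=> fi gi; exact: (integrableD measurableT fi gi). Qed.

Lemma rintegrableN f : rintegrable f -> rintegrable (fun x => - f x).
Proof. by move=> fi; exact: (integrableN fi). Qed.

Lemma rintegrableB f g : rintegrable f -> rintegrable g ->
  rintegrable (fun x => f x - g x).
Proof. by move=> fi gi; apply: rintegrableD => //; exact: rintegrableN. Qed.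

Lemma rintegrableZl k f : rintegrable f -> rintegrable (fun x => k * f x).
Proof. by move=> fi; exact: (integrableZl measurableT k fi). Qed.

Lemma rintegrableZr k f : rintegrable f -> rintegrable (fun x => f x * k).
Proof. by move=> /(rintegrableZl k); apply: eq_rintegrable => x; rewrite mulrC. Qed.

Lemma rintegrable_norm f : rintegrable f -> rintegrable (fun x => `|f x|).
Proof. exact: integrable_norm. Qed.

Lemma rintegrable_sum I (s : seq I) (F : I -> T -> R) :
  (forall i, rintegrable (F i)) -> rintegrable (fun x => \sum_(i <- s) F i x).
Proof.
move=> Fi; elim: s => [|i s IHs].
  by apply: eq_rintegrable rintegrable0 => x; rewrite big_nil.
apply: eq_rintegrable (rintegrableD (Fi i) IHs) => x.
by rewrite big_cons.
Qed.

Lemma rintegrable_bddM f g B : measurable_fun setT f ->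
  (forall x, `|f x| <= B) -> rintegrable g -> rintegrable (fun x => f x * g x).
Proof.
move=> mf fB gi.
apply: (rintegrable_dom _ (rintegrableZl B (rintegrable_norm gi))).
  by apply: measurable_funM => //; exact: rintegrable_measurable.
by move=> x; rewrite normrM ler_wpM2r.
Qed.

Lemma EFin_Rintegral f : rintegrable f ->
  (\int[mu]_x f x)%:E = (\int[mu]_x (f x)%:E)%E.
Proof. by move=> fi; rewrite /Rintegral fineK// integrable_fin_num. Qed.

Lemma ge0_rintegrableP f : measurable_fun setT f -> (forall x, 0 <= f x) ->
  rintegrable f <-> (\int[mu]_x (f x)%:E < +oo)%E.
Proof.
move=> mf f0; have E : (\int[mu]_x `|(EFin \o f) x| = \int[mu]_x (f x)%:E)%E.
  by apply: eq_integral => x _ /=; rewrite ger0_norm.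
split => [/integrableP[_]|fi]; first by rewrite E.
by apply/integrableP; split; [exact/measurable_EFinP|rewrite E].
Qed.

Lemma ge0_rintegrable_le f M : measurable_fun setT f -> (forall x, 0 <= f x) ->
  (\int[mu]_x (f x)%:E <= M%:E)%E -> rintegrable f /\ \int[mu]_x f x <= M.
Proof.
move=> mf f0 fM; have fi : rintegrable f.
  by apply/ge0_rintegrableP => //; rewrite (le_lt_trans fM)// ltry.
by split => //; rewrite -lee_fin EFin_Rintegral.
Qed.

Lemma RintegralN f : rintegrable f -> \int[mu]_x (- f x) = - \int[mu]_x f x.
Proof.
move=> fi; transitivity (\int[mu]_x (-1 * f x)).
  by apply: eq_Rintegral => x _; rewrite mulN1r.
by rewrite RintegralZl// mulN1r.
Qed.

Lemma Rintegral_sum I (s : seq I) (F : I -> T -> R) :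
  (forall i, rintegrable (F i)) ->
  \int[mu]_x (\sum_(i <- s) F i x) = \sum_(i <- s) \int[mu]_x F i x.
Proof.
move=> Fi; elim: s => [|i s IHs].
  rewrite big_nil -[RHS](mul0r (fine (mu setT))) -Rintegral_cst//.
  by apply: eq_Rintegral => x _; rewrite big_nil.
rewrite big_cons -IHs -(RintegralD measurableT (Fi i) (rintegrable_sum s Fi)).
by apply: eq_Rintegral => x _; rewrite big_cons.
Qed.

Lemma le_Rintegral_dom f g : measurable_fun setT f -> rintegrable g ->
  (forall x, `|f x| <= g x) -> `|\int[mu]_x f x| <= \int[mu]_x g x.
Proof.
move=> mf gi fg; have fi := rintegrable_dom mf gi fg.
apply: (le_trans (le_normr_Rintegral measurableT fi)).
by apply: le_Rintegral => //; exact: rintegrable_norm.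
Qed.

Lemma Rintegral_dominated (F : nat -> T -> R) f g :
  (forall k, measurable_fun setT (F k)) -> measurable_fun setT f ->
  rintegrable g -> {ae mu, forall x, F ^~ x @ \oo --> f x} ->
  (forall k x, `|F k x| <= g x) ->
  \int[mu]_x F k x @[k --> \oo] --> \int[mu]_x f x.
Proof.
move=> mF mf gi Ff Fg.
have Fi k : rintegrable (F k) by exact: rintegrable_dom (mF k) gi (Fg k).
have [fi _ H] := @dominated_convergence _ _ _ mu setT measurableT
  (fun k => EFin \o F k) (EFin \o f) (EFin \o g)
  (fun k => (measurable_EFinP _ _).2 (mF k)) ((measurable_EFinP _ _).2 mf)
  ltac:(apply: filterS Ff => x /= Ffx _; apply: cvg_EFin => //; exact: nearW)
  gi ltac:(apply: aeW => x k _; rewrite /= lee_fin; exact: Fg).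
have : (\int[mu]_x (F k x)%:E)%E @[k --> \oo] --> (\int[mu]_x f x)%:E.
  by rewrite EFin_Rintegral.
by move/fine_cvg.
Qed.

(** Fatou's lemma along weights tending to 1: it yields at once the integrability
    of the limit, which is not known beforehand, and the bound. *)
Lemma Rintegral_fatou_le (w : nat -> T -> R) f M :
  (forall k, measurable_fun setT (w k)) -> measurable_fun setT f ->
  (forall k x, 0 <= w k x) -> (forall x, 0 <= f x) ->
  (forall x, w ^~ x @ \oo --> (1 : R)) ->
  (forall k, rintegrable (fun x => w k x * f x)) ->
  (forall k, \int[mu]_x (w k x * f x) <= M) ->
  rintegrable f /\ \int[mu]_x f x <= M.
Proof.
move=> mw mf w0 f0 w1 wfi wfM; apply: ge0_rintegrable_le => //.
have := @fatou _ _ _ mu setT measurableT (fun k x => (w k x * f x)%:E)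
  (fun k => (measurable_EFinP _ _).2 (measurable_funM (mw k) mf))
  ltac:(move=> k x _; rewrite lee_fin; exact: mulr_ge0).
under eq_integral.
  move=> x _; rewrite (_ : limn_einf _ = (f x)%:E); last first.
    have H : (w k x * f x)%:E @[k --> \oo] --> (f x)%:E.
      apply: cvg_EFin; first exact: nearW.
      by rewrite -[X in _ --> X]mul1r; apply: cvgMr_tmp; exact: w1.
    rewrite is_cvg_limn_einfE; first exact/cvg_lim.
    by apply/cvg_ex; eexists; exact: H.
  over.
move=> /le_trans; apply.
rewrite limn_einf_lim; apply: lime_le; first exact: is_cvg_einfs.
apply: nearW => k; apply: (@le_trans _ _ (\int[mu]_x (w k x * f x)%:E)%E).
  by apply: ereal_inf_lbound; exists k => /=.
by rewrite -EFin_Rintegral// lee_fin.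
Qed.

End rintegrable.
Arguments rintegrable_measurable {d T R} mu {f}.

(** * Fubini's theorem for real functions *)

Section rfubini.
Context d1 d2 (T1 : measurableType d1) (T2 : measurableType d2) (R : realType).
Variables (m1 : {sigma_finite_measure set T1 -> \bar R}).
Variables (m2 : {sigma_finite_measure set T2 -> \bar R}).
Implicit Types f : T1 * T2 -> R.

Lemma measurable_sectionl f x : measurable_fun setT f ->
  measurable_fun setT (fun y => f (x, y)).
Proof. by move=> mf; exact: measurableT_comp. Qed.

Lemma measurable_sectionr f y : measurable_fun setT f ->
  measurable_fun setT (fun x => f (x, y)).
Proof. by move=> mf; exact: measurableT_comp. Qed.

Lemma measurable_Rintegral f : measurable_fun setT f ->
  (forall x, rintegrable m2 (fun y => f (x, y))) ->
  measurable_fun setT (fun x => \int[m2]_y f (x, y)).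
Proof.
move=> mf fi.
have ge0 (g : T1 * T2 -> R) : measurable_fun setT g -> (forall z, 0 <= g z) ->
    measurable_fun setT (fun x => fine (\int[m2]_y (g (x, y))%:E)%E).
  move=> mg g0.
  have := @measurable_fun_fubini_tonelli_F _ _ T1 T2 R m2 (EFin \o g)
    ltac:(exact/measurable_EFinP) ltac:(by move=> z; rewrite /= lee_fin).
  by move=> H; apply: measurableT_comp => //; exact: H.
rewrite (_ : (fun x => _) = fun x =>
    \int[m2]_y f^\+ (x, y) - \int[m2]_y f^\- (x, y)); last first.
  apply/funext => x; rewrite -RintegralB//.
  - apply: eq_Rintegral => y _.
    exact: (esym (congr1 (@^~ y) (funrposBneg (fun y => f (x, y))))).
  - exact: integrable_funrpos (fi x).
  - exact: integrable_funrneg (fi x).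
apply: measurable_funB; apply: ge0 => //.
- exact: measurable_funrpos.
- exact: measurable_funrneg.
Qed.

Lemma rtonelli f : measurable_fun setT f -> (forall z, 0 <= f z) ->
  (forall x, rintegrable m2 (fun y => f (x, y))) ->
  (forall y, rintegrable m1 (fun x => f (x, y))) ->
  rintegrable m1 (fun x => \int[m2]_y f (x, y)) ->
  rintegrable m2 (fun y => \int[m1]_x f (x, y)) /\
  \int[m1]_x \int[m2]_y f (x, y) = \int[m2]_y \int[m1]_x f (x, y).
Proof.
move=> mf f0 f2 f1 fi.
have E : (\int[m1]_x (\int[m2]_y f (x, y))%:E)%E =
         (\int[m2]_y \int[m1]_x (f (x, y))%:E)%E.
  have H := @fubini_tonelli _ _ _ _ _ m1 m2 (EFin \o f)
    ltac:(exact/measurable_EFinP) ltac:(by move=> z; rewrite /= lee_fin).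
  by rewrite -H; apply: eq_integral => x _; rewrite EFin_Rintegral.
have E2 : (\int[m2]_y \int[m1]_x (f (x, y))%:E)%E =
          (\int[m2]_y (\int[m1]_x f (x, y))%:E)%E.
  by apply: eq_integral => y _; rewrite EFin_Rintegral.
split; last by rewrite /Rintegral E E2.
apply/ge0_rintegrableP.
- have := @measurable_fun_fubini_tonelli_G _ _ T1 T2 R m1 (EFin \o f)
    ltac:(exact/measurable_EFinP) ltac:(by move=> z; rewrite /= lee_fin).
  by move=> H; apply: (measurableT_comp (f := fine)) => //; exact: H.
- by move=> y; exact: Rintegral_ge0.
- rewrite -E2 -E -EFin_Rintegral//; exact: ltry.
Qed.

Lemma rfubini_prod f : (m1 \x m2)%E.-integrable setT (EFin \o f) ->
  (forall x, rintegrable m2 (fun y => f (x, y))) ->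
  (forall y, rintegrable m1 (fun x => f (x, y))) ->
  [/\ rintegrable m1 (fun x => \int[m2]_y f (x, y)),
      rintegrable m2 (fun y => \int[m1]_x f (x, y)),
      \int[m1]_x \int[m2]_y f (x, y) = \int[m2]_y \int[m1]_x f (x, y) &
      Rintegral (m1 \x m2)%E setT f = \int[m1]_x \int[m2]_y f (x, y)].
Proof.
move=> fi f2 f1.
have E2 x : (\int[m2]_y f (x, y))%:E = (\int[m2]_y (f (x, y))%:E)%E.
  by rewrite EFin_Rintegral.
have E1 y : (\int[m1]_x f (x, y))%:E = (\int[m1]_x (f (x, y))%:E)%E.
  by rewrite EFin_Rintegral.
split.
- apply: eq_integrable (integrable_fubini_F fi) => // x _ /=.
  by rewrite E2.
- apply/integrableP; split.
    rewrite (_ : EFin \o _ = fubini_G m1 (EFin \o f)).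
      exact: (measurable_fubini_G (m1 := m1) (m2 := m2) fi).
    by apply/funext => y /=; rewrite E1.
  have mf : measurable_fun setT f by have /measurable_int/measurable_EFinP := fi.
  have := (integrable21ltyP m1 m2 ((measurable_EFinP _ _).2 mf)).1 fi.
  apply: le_lt_trans; apply: ge0_le_integral => //.
  + apply: measurableT_comp => //.
    rewrite (_ : EFin \o _ = fubini_G m1 (EFin \o f)).
      exact: (measurable_fubini_G (m1 := m1) (m2 := m2) fi).
    by apply/funext => y /=; rewrite E1.
  + apply: (@measurable_fun_fubini_tonelli_G _ _ T1 T2 R m1 (fun z => `|(f z)%:E|%E)) => //.
    by apply: measurableT_comp => //; exact/measurable_EFinP.
  + move=> y _; rewrite [X in (`|X| <= _)%E](E1 y); apply: le_abse_integral => //.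
    by apply/measurable_EFinP; exact: measurable_sectionr.
- rewrite /Rintegral; congr fine.
  under eq_integral do rewrite E2.
  under [RHS]eq_integral do rewrite E1.
  exact: (Fubini fi).
- rewrite /Rintegral; congr fine.
  under [RHS]eq_integral do rewrite E2.
  exact: (esym (integral12_prod_meas1 fi)).
Qed.

Lemma rintegrable_prod_dom f (a : T1 -> R) (b : T2 -> R) :
  measurable_fun setT f -> rintegrable m1 a -> rintegrable m2 b ->
  (forall x y, `|f (x, y)| <= a x * b y) ->
  (m1 \x m2)%E.-integrable setT (EFin \o f).
Proof.
move=> mf ai bi fab; apply/integrable12ltyP; first exact/measurable_EFinP.
have an := rintegrable_norm ai; have bn := rintegrable_norm bi.
have : rintegrable m1 (fun x => `|a x| * \int[m2]_y `|b y|).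
  exact: rintegrableZr.
move=> /(integrable_lty measurableT).
apply: le_lt_trans; apply: ge0_le_integral => //.
- by move=> x _; exact: integral_ge0.
- apply: (@measurable_fun_fubini_tonelli_F _ _ T1 T2 R m2 (fun z => `|(f z)%:E|%E)) => //.
  by apply: measurableT_comp => //; exact/measurable_EFinP.
- by apply/measurable_EFinP/(rintegrable_measurable m1)/rintegrableZr.
- move=> x _ /=; rewrite -RintegralZl// EFin_Rintegral; last exact: rintegrableZl.
  apply: ge0_le_integral => //.
  + have mfx : measurable_fun setT (fun y => `|f (x, y)|).
      by apply: measurableT_comp => //; exact: measurable_sectionl.
    exact/measurable_EFinP.
  + by apply/measurable_EFinP/(rintegrable_measurable m2)/rintegrableZl.
  + move=> y _; rewrite /= lee_fin (le_trans (fab x y))//.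
    by rewrite -normrM ler_norm.
Qed.

(** The form in which Fubini's theorem is applied throughout: the integrand is
    dominated by a product of integrable functions of one variable each. *)
Lemma rfubini_dom f (a : T1 -> R) (b : T2 -> R) :
  measurable_fun setT f -> rintegrable m1 a -> rintegrable m2 b ->
  (forall x y, `|f (x, y)| <= a x * b y) ->
  [/\ rintegrable m1 (fun x => \int[m2]_y f (x, y)),
      rintegrable m2 (fun y => \int[m1]_x f (x, y)),
      \int[m1]_x \int[m2]_y f (x, y) = \int[m2]_y \int[m1]_x f (x, y) &
      Rintegral (m1 \x m2)%E setT f = \int[m1]_x \int[m2]_y f (x, y)].
Proof.
move=> mf ai bi fab; apply: rfubini_prod.
- exact: rintegrable_prod_dom fab.
- move=> x; apply: (rintegrable_dom _ (rintegrableZl (a x) bi)) => //.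
  exact: measurable_sectionl.
- move=> y; apply: (rintegrable_dom _ (rintegrableZr (b y) ai)) => //.
  exact: measurable_sectionr.
Qed.

End rfubini.

(** * Poisson kernels on the line *)

Section one_dimensional_kernels.
Context {R : realType}.
Local Notation leb := (@lebesgue_measure R).
Implicit Types e x t a : R.

Let drvM (f g : R -> R) (t df dg : R) : is_derive t 1 f df -> is_derive t 1 g dg ->
  is_derive t 1 (fun s => f s * g s) (f t * dg + g t * df).
Proof. exact: is_deriveM. Qed.

Let drvB (f g : R -> R) (t df dg : R) : is_derive t 1 f df -> is_derive t 1 g dg ->
  is_derive t 1 (fun s => f s - g s) (df - dg).
Proof. exact: is_deriveB. Qed.

Let drvZ (f : R -> R) (t k df : R) : is_derive t 1 f df ->
  is_derive t 1 (fun s => k * f s) (k * df).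
Proof. exact: is_deriveZ. Qed.

Let drvZr (f : R -> R) (t k df : R) : is_derive t 1 f df ->
  is_derive t 1 (fun s => f s * k) (df * k).
Proof.
move=> H; rewrite (_ : (fun s => _) = fun s => k * f s); last first.
  by apply/funext => s; rewrite mulrC.
by rewrite mulrC; exact: drvZ.
Qed.

Let drv_cst (t k : R) : is_derive t 1 ((fun=> k) : R -> R) (0 : R).
Proof. exact: is_derive_cst. Qed.

Let drv_id (t : R) : is_derive t 1 ((fun s => s) : R -> R) (1 : R).
Proof. exact: is_derive_id. Qed.

Let drv_comp (f g : R -> R) (t df dg : R) : is_derive (g t) 1 f df ->
  is_derive t 1 g dg -> is_derive t 1 (fun s => f (g s)) (df * dg).
Proof. by move=> Hf Hg; have := is_derive1_comp Hf Hg. Qed.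

Lemma measurable_cos : measurable_fun setT (@cos R).
Proof. by apply: continuous_measurable_fun; exact: continuous_cos. Qed.

Lemma measurable_sin : measurable_fun setT (@sin R).
Proof. by apply: continuous_measurable_fun; exact: continuous_sin. Qed.

(** Up to the factor 1 / (2 pi), the Poisson kernel of the half-plane at height
    [e]; it is the Fourier transform of exp (- e |t|). *)
Definition poisson e t : R := 2 * e / (e ^+ 2 + t ^+ 2).

Lemma poisson_den_gt0 e t : 0 < e -> 0 < e ^+ 2 + t ^+ 2.
Proof. by move=> e0; rewrite ltr_pwDl ?exprn_gt0 ?sqr_ge0. Qed.

Lemma poisson_gt0 e t : 0 < e -> 0 < poisson e t.
Proof. by move=> e0; rewrite divr_gt0 ?mulr_gt0 ?poisson_den_gt0. Qed.

Lemma poissonN e t : poisson e (- t) = poisson e t.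
Proof. by rewrite /poisson sqrrN. Qed.

Lemma poisson_le e t : 0 < e -> poisson e t <= 2 / e.
Proof.
move=> e0; rewrite /poisson -mulrA ler_pM2l// ler_pdivrMr ?poisson_den_gt0//.
rewrite mulrDr expr2 mulrA mulVf ?gt_eqF// mul1r lerDl mulr_ge0 ?sqr_ge0//.
by rewrite invr_ge0 ltW.
Qed.

Lemma continuous_poisson e : 0 < e -> continuous (poisson e).
Proof.
move=> e0 t; apply: cvgM; first exact: cvg_cst.
apply: cvgV; first by rewrite gt_eqF ?poisson_den_gt0.
by apply: cvgD; [exact: cvg_cst|exact: exprn_continuous].
Qed.

Lemma measurable_poisson e : 0 < e -> measurable_fun setT (poisson e).
Proof. by move=> e0; apply: continuous_measurable_fun; exact: continuous_poisson. Qed.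

Lemma integral_oneDsqrV :
  (\int[leb]_x ((@oneDsqr R x)^-1)%:E = pi%:E)%E.
Proof.
rewrite ge0_symfun_integralT.
- rewrite (_ : [set x | 0 <= x] = `[0%R, +oo[%classic); last exact/esym/set_itvcy.
  by rewrite integral0y_oneDsqr -EFinM mulrC divfK.
- by move=> x; rewrite invr_ge0 (le_trans ler01)// oneDsqr_ge1.
- exact: continuous_oneDsqrV.
- by move=> x; rewrite /= /oneDsqr sqrrN.
Qed.

Lemma Rintegral_poisson e a : 0 < e ->
  rintegrable leb (fun t => poisson e (t - a)) /\
  \int[leb]_t poisson e (t - a) = 2 * pi.
Proof.
move=> e0.
have F' x : is_derive x 1 (fun t => (t - a) / e) e^-1.
  have := drvZr e^-1 (drvB (drv_id x) (drv_cst x a)).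
  by rewrite subr0 mul1r.
have F'E : derive1 (fun t => (t - a) / e) = cst e^-1.
  by apply/funext => x; rewrite derive1E; exact: derive_val.
have E : (\int[leb]_t (poisson e (t - a))%:E)%E = (2 * pi)%:E.
  rewrite EFinM -integral_oneDsqrV.
  rewrite [in RHS](increasing_ge0_integration_by_substitutionT (F := fun t => (t - a) / e) (G := fun x => (@oneDsqr R x)^-1)).
  - rewrite -ge0_integralZl_EFin//.
    + apply: eq_integral => t _; rewrite -EFinM F'E; congr EFin.
      rewrite /poisson /= fctE/= /oneDsqr. rewrite expr_div_n.
      by field; rewrite !gt_eqF ?poisson_den_gt0//.
    + by move=> t _; rewrite F'E lee_fin fctE mulr_ge0//= invr_ge0 ltW.
    + have mm : measurable_fun setT (fun t : R => (oneDsqr ((t - a) / e))^-1 * e^-1).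
        apply: measurable_funM => //; apply: continuous_measurable_fun => x /=.
        apply: (@continuous_comp _ _ _ (fun t => (t - a) / e) (fun y => (oneDsqr y)^-1)).
          by apply: cvgM; [apply: cvgB => //|]; exact: cvg_cst.
        exact: continuous_oneDsqrV.
      move: mm => /measurable_EFinP mm. by apply: eq_measurable_fun mm => t _; rewrite F'E.
  - by move=> x y xy; rewrite ltr_pM2r ?invr_gt0// ltrD2r.
  - by rewrite F'E; exact: cst_continuous.
  - by rewrite F'E; exact: is_cvg_cst.
  - by rewrite F'E; exact: is_cvg_cst.
  - by move=> x; exact: ex_derive.
  - apply/cvgrNyPle => A; exists (A * e + a); split; first exact: num_real.
    by move=> x /= xA; rewrite ler_pdivrMr// lerBlDr ltW.
  - apply/cvgryPge => A; exists (A * e + a); split; first exact: num_real.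
    by move=> x /= xA; rewrite ler_pdivlMr// lerBrDr ltW.
  - exact: continuous_oneDsqrV.
  - by move=> x; rewrite invr_ge0 (le_trans ler01)// oneDsqr_ge1.
split; last by rewrite /Rintegral E.
apply/ge0_rintegrableP.
- apply: continuous_measurable_fun => x.
  apply: (@continuous_comp _ _ _ (fun t => t - a) (poisson e)).
    by apply: cvgB => //; exact: cvg_cst.
  exact: continuous_poisson.
- by move=> t; rewrite ltW// poisson_gt0.
- by rewrite E ltry.
Qed.

(** The constant 1 added to the cosine makes the integrand nonnegative, so that
    the integral over the half-line is read off an antiderivative. *)
Lemma Rintegral_exp1Dcos e x : 0 < e ->
  (\int[leb]_t (expR (- (e * `|t|)) * (1 + cos (t * x)))%:E =
   (2 / e + poisson e x)%:E)%E.
Proof.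
move=> e0.
have cf : continuous (fun t : R => expR (- (e * `|t|)) * (1 + cos (t * x))).
  move=> t; apply: cvgM.
    apply: (@continuous_comp _ _ _ (fun t => - (e * `|t|)) expR).
      by apply: cvgN; apply: cvgM; [exact: cvg_cst|exact: norm_continuous].
    exact: continuous_expR.
  apply: cvgD; first exact: cvg_cst.
  apply: (@continuous_comp _ _ _ (fun t => t * x) cos).
    by apply: cvgM => //; exact: cvg_cst.
  exact: continuous_cos.
have f0 t : 0 <= expR (- (e * `|t|)) * (1 + cos (t * x)).
  by rewrite mulr_ge0 ?expR_ge0// -lerBlDl sub0r cos_geN1.
rewrite ge0_symfun_integralT//; last first.
  by move=> t /=; rewrite normrN mulNr cosN.
rewrite (_ : [set t | 0 <= t] = `[0%R, +oo[%classic); last exact/esym/set_itvcy.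
pose D := e ^+ 2 + x ^+ 2; have D0 : D != 0 by rewrite gt_eqF ?poisson_den_gt0.
pose F t := expR (- (e * t)) * ((x * sin (t * x) - e * cos (t * x)) / D - e^-1).
have F' t : is_derive t 1 F (expR (- (e * t)) * (1 + cos (t * x))).
  pose dF := expR (- (e * t)) *
      (((x * (cos (t * x) * x) - e * (- sin (t * x) * x)) * D^-1) - 0) +
    ((x * sin (t * x) - e * cos (t * x)) / D - e^-1) *
      (expR (- (e * t)) * - (e * 1)).
  have : is_derive t 1 F dF.
    have tx : is_derive t 1 (fun s => s * x) x.
      by have := drvZr x (drv_id t); rewrite mul1r.
    have E1 : is_derive t 1 (fun s => expR (- (e * s)))
        (expR (- (e * t)) * - (e * 1)).
      have et : is_derive t 1 (fun s => - (e * s)) (- (e * 1)).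
        have := drvZ (- 1) (drvZ e (drv_id t)).
        by rewrite mulN1r; under eq_fun do rewrite mulN1r.
      have := @drv_comp expR _ t _ _ (is_derive_expR _) et.
      by [].
    have E2 : is_derive t 1 (fun s => sin (s * x)) (cos (t * x) * x).
      by have := @drv_comp sin _ t _ _ (is_derive_sin _) tx.
    have E3 : is_derive t 1 (fun s => cos (s * x)) (- sin (t * x) * x).
      by have := @drv_comp cos _ t _ _ (is_derive_cos _) tx.
    have := drvM E1 (drvB (drvZr D^-1 (drvB (drvZ x E2) (drvZ e E3))) (drv_cst t e^-1)).
    by [].
  suff -> : dF = expR (- (e * t)) * (1 + cos (t * x)) by [].
  rewrite /dF /D in D0 *.
  by field; rewrite D0 gt_eqF.
rewrite (@ge0_continuous_FTC2y _ _ F 0 0)//.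
- rewrite -EFinB -EFinM /F; congr EFin.
  rewrite mulr0 oppr0 expR0 mul0r sin0 cos0 /poisson -/D.
  by field; rewrite D0 gt_eqF.
- by apply: continuous_subspaceT.
- pose M := (`|x| + e) / D + e^-1.
  have M0 t : `|(x * sin (t * x) - e * cos (t * x)) / D - e^-1| <= M.
    rewrite (le_trans (ler_normB _ _))// lerD//; last first.
      by rewrite ger0_norm// invr_ge0 ltW.
    have D1 : 0 < D by exact: poisson_den_gt0.
    rewrite normf_div (gtr0_norm D1) ler_pM2r ?invr_gt0//.
    rewrite (le_trans (ler_normB _ _))// lerD//.
      by rewrite normrM ler_piMr// ler_norml sin_geN1 sin_le1.
    by rewrite normrM gtr0_norm// ler_piMr ?(ltW e0)// ler_norml cos_geN1 cos_le1.
  have expc : (expR (- (e * t)) * M : R) @[t --> +oo] --> (0 : R).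
    rewrite -[X in _ --> X](mul0r M); apply: cvgMr_tmp.
    have ey : (e * t : R) @[t --> +oo] --> +oo%R by apply: gt0_cvgMry.
    by have := cvg_comp _ _ ey (@cvgr_expR R).
  apply/norm_cvg0P; apply: (@squeeze_cvgr _ _ _ _ (cst 0) _ _ _ _ _ expc) => //.
    near=> t; rewrite normr_ge0/= normrM ger0_norm ?expR_ge0//.
    by rewrite ler_wpM2l ?expR_ge0.
  exact: cvg_cst.
- by apply: cvg_at_right_filter; apply: differentiable_continuous; apply/derivable1_diffP.
- move=> t; rewrite in_itv/= andbT => t0; rewrite derive1E derive_val.
  by rewrite gtr0_norm.
Unshelve. all: by end_near. Qed.

Lemma Rintegral_expN e : 0 < e ->
  rintegrable leb (fun t => expR (- (e * `|t|))) /\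
  \int[leb]_t expR (- (e * `|t|)) = 2 / e.
Proof.
move=> e0.
have me : measurable_fun setT (fun t : R => expR (- (e * `|t|))).
  apply: continuous_measurable_fun => t.
  apply: (@continuous_comp _ _ _ (fun t => - (e * `|t|)) expR).
    by apply: cvgN; apply: cvgM; [exact: cvg_cst|exact: norm_continuous].
  exact: continuous_expR.
have E : (\int[leb]_t (expR (- (e * `|t|)))%:E = (2 / e)%:E)%E.
  have := Rintegral_exp1Dcos 0 e0.
  under eq_integral do rewrite mulr0 cos0 mulrC EFinM.
  rewrite ge0_integralZl_EFin//; last exact/measurable_EFinP.
  rewrite /poisson expr0n addr0 (_ : 2 / e + _ = 2 * (2 / e)); last first.
    by field; rewrite gt_eqF.
  move=> /(congr1 (fun z => (2^-1)%:E * z)%E); rewrite muleA -!EFinM mulrA.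
  by rewrite -[1 + 1]/(2 : R) mulVf// mul1e => ->; congr EFin; field; rewrite gt_eqF.
split; last by rewrite /Rintegral E.
by apply/ge0_rintegrableP => //; rewrite E ltry.
Qed.

Lemma rintegrable_exp_cos e x : 0 < e ->
  rintegrable leb (fun t => expR (- (e * `|t|)) * cos (t * x)) /\
  rintegrable leb (fun t => expR (- (e * `|t|)) * sin (t * x)).
Proof.
move=> e0; have [ei _] := Rintegral_expN e0.
have me := rintegrable_measurable _ ei.
have mx : measurable_fun setT (fun t => t * x : R) by exact: measurable_funM.
split; apply: (rintegrable_dom _ ei).
- apply: measurable_funM => //; exact: (measurableT_comp measurable_cos mx).
- move=> t; rewrite normrM ger0_norm ?expR_ge0// ler_piMr ?expR_ge0//.
  by rewrite ler_norml cos_geN1 cos_le1.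
- apply: measurable_funM => //; exact: (measurableT_comp measurable_sin mx).
- move=> t; rewrite normrM ger0_norm ?expR_ge0// ler_piMr ?expR_ge0//.
  by rewrite ler_norml sin_geN1 sin_le1.
Qed.

Lemma Rintegral_exp_cos e x : 0 < e ->
  \int[leb]_t (expR (- (e * `|t|)) * cos (t * x)) = poisson e x.
Proof.
move=> e0; have [ei eE] := Rintegral_expN e0.
have [ci _] := rintegrable_exp_cos x e0.
have := Rintegral_exp1Dcos x e0.
under eq_integral do rewrite mulrDr mulr1.
rewrite -EFin_Rintegral; last exact: rintegrableD.
by rewrite RintegralD// eE => -[/addrI].
Qed.

Lemma Rintegral_odd (f : R -> R) : rintegrable leb f ->
  (forall t, f (- t) = - f t) -> \int[leb]_t f t = 0.
Proof.
move=> fi fN; have : \int[leb]_t f t = \int[leb]_t f (- t).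
  rewrite /Rintegral; congr fine.
  rewrite (eq_measure_integral (pushforward leb (-%R : _ -> measurableTypeR R))).
    rewrite integral_pushforward//.
      by have /measurable_int := fi.
    by rewrite preimage_setT; apply: eq_integrable (rintegrableN fi) => // t _ /=; rewrite fN.
  by move=> A mA _; exact: (esym (lebesgue_measureN mA)).
under [RHS]eq_Rintegral do rewrite fN.
by rewrite RintegralN// => /eqP; rewrite -subr_eq0 opprK -mulr2n mulrn_eq0 => /eqP.
Qed.

Lemma Rintegral_exp_sin e x : 0 < e ->
  \int[leb]_t (expR (- (e * `|t|)) * sin (t * x)) = 0.
Proof.
move=> e0; have [_ si] := rintegrable_exp_cos x e0.
by apply: Rintegral_odd => // t; rewrite normrN mulNr sinN mulrN.
Qed.

End one_dimensional_kernels.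

(** * Product kernels on R^n *)

Section lebesgue_rV_slices.
Context {R : realType}.
Local Notation leb := (@lebesgue_measure R).

Lemma lebesgue_rV0 : lebesgue_rV R 0 setT = 1%E.
Proof. exact: diracT. Qed.

Lemma uncons_rVK n : cancel (@uncons_rV R n) cons_rV.
Proof.
move=> x; apply/rowP => i; case: (unliftP ord0 i) => [j|] ->.
- by rewrite cons_rVS mxE.
- by rewrite cons_rV0.
Qed.

Lemma measurable_rVS n d (T : measurableType d) (f : 'rV[R]_n.+1 -> T) :
  measurable_fun setT (f \o cons_rV) -> measurable_fun setT f.
Proof.
move=> mf; rewrite (_ : f = (f \o cons_rV) \o uncons_rV).
  by apply: measurableT_comp => //; exact: measurable_uncons_rV.
by apply/funext => x /=; rewrite uncons_rVK.
Qed.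

Lemma ge0_integral_rVS n (f : 'rV[R]_n.+1 -> \bar R) :
  measurable_fun setT f -> (forall x, 0 <= f x)%E ->
  (\int[lebesgue_rV R n.+1]_x f x =
   \int[leb \x lebesgue_rV R n]_z f (cons_rV z))%E.
Proof.
move=> mf f0.
have := ge0_integral_pushforward (@measurable_cons_rV R n)
  (leb \x lebesgue_rV R n)%E measurableT mf ltac:(by move=> y _; exact: f0).
rewrite preimage_setT => <-.
by [].
Qed.

Lemma Rintegral_rVS n (f : 'rV[R]_n.+1 -> R) :
  rintegrable (leb \x lebesgue_rV R n)%E (f \o cons_rV) ->
  rintegrable (lebesgue_rV R n.+1) f /\
  \int[lebesgue_rV R n.+1]_x f x =
  Rintegral (leb \x lebesgue_rV R n)%E setT (f \o cons_rV).
Proof.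
move=> fi.
have mf : measurable_fun setT f by apply: measurable_rVS; exact: rintegrable_measurable fi.
split.
  apply/integrableP; split; first exact/measurable_EFinP.
  rewrite ge0_integral_rVS//; last by apply: measurableT_comp => //; exact/measurable_EFinP.
  by have /integrableP[] := fi.
rewrite /Rintegral; congr fine.
have := @integral_pushforward _ _ _ _ _ _ (@measurable_cons_rV R n)
  (leb \x lebesgue_rV R n)%E setT _ ((measurable_EFinP _ _).2 mf)
  ltac:(by rewrite preimage_setT; exact: fi) measurableT.
rewrite preimage_setT => <-.
by [].
Qed.

(** Fubini for a product of a function of the first coordinate and a function
    of the others; every explicit integral over R^n comes from it by induction. *)
Lemma Rintegral_rVS_prod n (f : R -> R) (g : 'rV[R]_n -> R) :
  rintegrable leb f -> rintegrable (lebesgue_rV R n) g ->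
  let h (x : 'rV[R]_n.+1) := f (uncons_rV x).1 * g (uncons_rV x).2 in
  rintegrable (lebesgue_rV R n.+1) h /\
  \int[lebesgue_rV R n.+1]_x h x =
  (\int[leb]_t f t) * \int[lebesgue_rV R n]_y g y.
Proof.
move=> fi gi h.
have hE : h \o cons_rV = fun z => f z.1 * g z.2.
  by apply/funext => z; rewrite /h fctE cons_rVK.
have mh : measurable_fun setT (h \o cons_rV).
  rewrite hE; apply: measurable_funM; apply: measurableT_comp => //.
  - exact: rintegrable_measurable fi.
  - exact: rintegrable_measurable gi.
have hdom x y : `|(h \o cons_rV) (x, y)| <= `|f x| * `|g y| by rewrite hE normrM.
have hi := rintegrable_prod_dom mh (rintegrable_norm fi) (rintegrable_norm gi) hdom.
have [_ _ _ E] := rfubini_dom mh (rintegrable_norm fi) (rintegrable_norm gi) hdom.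
have [hi' ->] := Rintegral_rVS hi; split => //.
rewrite E hE /= -RintegralZr//.
by apply: eq_Rintegral => x _; rewrite RintegralZl.
Qed.

Lemma Rintegral_rV_prod n (F : 'I_n -> R -> R) :
  (forall i, rintegrable leb (F i)) ->
  rintegrable (lebesgue_rV R n) (fun x => \prod_(i < n) F i (x ord0 i)) /\
  \int[lebesgue_rV R n]_x \prod_(i < n) F i (x ord0 i) =
  \prod_(i < n) \int[leb]_t F i t.
Proof.
elim: n F => [|n IHn] F Fi.
  have E : (fun x : 'rV[R]_0 => \prod_(i < 0) F i (x ord0 i)) = cst 1.
    by apply/funext => x; rewrite big_ord0.
  rewrite E big_ord0; split.
    by apply: finite_measure_integrable_cst.
  by rewrite Rintegral_cst// [X in fine X]lebesgue_rV0 mul1r.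
have [gi gE] := IHn (fun i => F (lift ord0 i)) (fun i => Fi (lift ord0 i)).
have [hi hE] := Rintegral_rVS_prod (Fi ord0) gi.
have E : (fun x : 'rV[R]_n.+1 => F ord0 (uncons_rV x).1 *
    \prod_(i < n) F (lift ord0 i) ((uncons_rV x).2 ord0 i)) =
    fun x => \prod_(i < n.+1) F i (x ord0 i).
  apply/funext => x; rewrite big_ord_recl /=; congr (_ * _).
  by apply: eq_bigr => i _; rewrite mxE.
by rewrite -E big_ord_recl; split => //; rewrite hE gE.
Qed.

End lebesgue_rV_slices.

Section product_kernels.
Context {R : realType} {n : nat}.
Local Notation V := 'rV[R]_n.
Local Notation leb := (lebesgue_rV R n).

Definition l1 (x : V) : R := \sum_(i < n) `|x ord0 i|.

Definition weight e (p : V) : R := expR (- (e * l1 p)).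

Definition pker (e : 'I_n -> R) (x y : V) : R :=
  \prod_(i < n) poisson (e i) (x ord0 i - y ord0 i).

(** The constant in Parseval's identity for the unnormalized transform; it is
    also the integral of every product kernel [pker e x]. *)
Definition mass : R := (2 * pi) ^+ n.

End product_kernels.
Arguments l1 {R n}.
Arguments mass R n : clear implicits.

Section product_kernels_theory.
Context {R : realType}.
Local Notation leb n := (lebesgue_rV R n).
Implicit Types n : nat.

Lemma l1_ge0 n (x : 'rV[R]_n) : 0 <= l1 x.
Proof. exact: sumr_ge0. Qed.

Lemma measurable_l1 n : measurable_fun setT (@l1 R n).
Proof.
apply: (@measurable_sum _ _ _ _ _ (index_enum 'I_n) (fun i (x : 'rV[R]_n) => `|x ord0 i|)) => i.
by apply: measurableT_comp => //; exact: measurable_coord.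
Qed.

Lemma measurable_dot n (x : 'rV[R]_n) : measurable_fun setT (fun p => dot p x).
Proof.
apply: (@measurable_sum _ _ _ _ _ (index_enum 'I_n) (fun i (p : 'rV[R]_n) => p ord0 i * x ord0 i)) => i.
by apply: measurable_funM => //; exact: measurable_coord.
Qed.

Lemma measurable_dot2 n : measurable_fun setT (fun z : 'rV[R]_n * 'rV[R]_n => dot z.1 z.2).
Proof.
apply: (@measurable_sum _ _ _ _ _ (index_enum 'I_n)
  (fun i (z : 'rV[R]_n * 'rV[R]_n) => z.1 ord0 i * z.2 ord0 i)) => i.
apply: measurable_funM.
- by apply: (measurableT_comp (measurable_coord i)); exact: measurable_fst.
- by apply: (measurableT_comp (measurable_coord i)); exact: measurable_snd.
Qed.

Lemma dotC n (x y : 'rV[R]_n) : dot x y = dot y x.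
Proof. by apply: eq_bigr => i _; rewrite mulrC. Qed.

Lemma dotBr n (p x y : 'rV[R]_n) : dot p (x - y) = dot p x - dot p y.
Proof.
by rewrite /dot -sumrB; apply: eq_bigr => i _; rewrite !mxE mulrBr.
Qed.

Lemma weight_gt0 n e (p : 'rV[R]_n) : 0 < weight e p.
Proof. exact: expR_gt0. Qed.

Lemma weight_le1 n e (p : 'rV[R]_n) : 0 <= e -> weight e p <= 1.
Proof. by move=> e0; rewrite /weight expR_le1 oppr_le0 mulr_ge0// l1_ge0. Qed.

Lemma measurable_weight n e : measurable_fun setT (@weight R n e).
Proof.
apply: measurableT_comp => //; apply: measurableT_comp => //.
by apply: measurable_funM => //; exact: measurable_l1.
Qed.

Lemma Rintegral_weight n e : 0 < e ->
  rintegrable (leb n) (weight e) /\ \int[leb n]_p weight e p = (2 / e) ^+ n.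
Proof.
move=> e0; have [ei eE] := Rintegral_expN e0.
have [wi wE] := @Rintegral_rV_prod R n (fun _ t => expR (- (e * `|t|))) (fun=> ei).
have E : (fun p : 'rV[R]_n => \prod_(i < n) expR (- (e * `|p ord0 i|))) = weight e.
  apply/funext => p; rewrite /weight /l1 mulr_sumr -sumrN expR_sum.
  by [].
rewrite -E; split => //; rewrite wE.
under eq_bigr do rewrite eE.
by rewrite prodr_const card_ord.
Qed.

Lemma dot_uncons n (p x : 'rV[R]_n.+1) :
  dot p x = (uncons_rV p).1 * (uncons_rV x).1 + dot (uncons_rV p).2 (uncons_rV x).2.
Proof.
by rewrite /dot big_ord_recl; congr (_ + _); apply: eq_bigr => i _; rewrite !mxE.
Qed.

Lemma weight_uncons n e (p : 'rV[R]_n.+1) :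
  weight e p = expR (- (e * `|(uncons_rV p).1|)) * weight e (uncons_rV p).2.
Proof.
rewrite /weight -expRD; congr expR.
rewrite /l1 big_ord_recl mulrDr opprD; congr (- _ - _ * _).
by apply: eq_bigr => i _; rewrite mxE.
Qed.

Lemma rintegrable_weightM n e (f : 'rV[R]_n -> R) B : 0 < e ->
  measurable_fun setT f -> (forall p, `|f p| <= B) ->
  rintegrable (leb n) (fun p => weight e p * f p).
Proof.
move=> e0 mf fB; have [wi _] := Rintegral_weight n e0.
have := rintegrable_bddM mf fB wi.
by apply: eq_rintegrable => p; rewrite mulrC.
Qed.

Lemma normr_cos_le1 (t : R) : `|cos t| <= 1.
Proof. by rewrite ler_norml cos_geN1 cos_le1. Qed.

Lemma normr_sin_le1 (t : R) : `|sin t| <= 1.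
Proof. by rewrite ler_norml sin_geN1 sin_le1. Qed.

Lemma measurable_cos_dot n (x : 'rV[R]_n) : measurable_fun setT (fun p => cos (dot p x)).
Proof. exact: measurableT_comp (measurable_cos) (measurable_dot x). Qed.

Lemma measurable_sin_dot n (x : 'rV[R]_n) : measurable_fun setT (fun p => sin (dot p x)).
Proof. exact: measurableT_comp (measurable_sin) (measurable_dot x). Qed.

Lemma rintegrable_weight_cos n e (x : 'rV[R]_n) : 0 < e ->
  rintegrable (leb n) (fun p => weight e p * cos (dot p x)).
Proof.
move=> e0; apply: (rintegrable_weightM (B := 1)) => // [|p].
  exact: measurable_cos_dot.
exact: normr_cos_le1.
Qed.

Lemma rintegrable_weight_sin n e (x : 'rV[R]_n) : 0 < e ->
  rintegrable (leb n) (fun p => weight e p * sin (dot p x)).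
Proof.
move=> e0; apply: (rintegrable_weightM (B := 1)) => // [|p].
  exact: measurable_sin_dot.
exact: normr_sin_le1.
Qed.

(** The Fourier transform of the weight is the product of Poisson kernels;
    cosine and sine parts are proved together because the addition formulas
    mix them. *)
Lemma Rintegral_weight_cos_sin n e (x : 'rV[R]_n) : 0 < e ->
  \int[leb n]_p (weight e p * cos (dot p x)) = pker (fun=> e) x 0 /\
  \int[leb n]_p (weight e p * sin (dot p x)) = 0.
Proof.
move=> e0; elim: n x => [|n IHn] x.
  have E : (fun p : 'rV[R]_0 => weight e p * cos (dot p x)) = cst 1.
    by apply/funext => p; rewrite /weight /l1 /dot !big_ord0 mulr0 oppr0 expR0 cos0 mulr1.
  have E' : (fun p : 'rV[R]_0 => weight e p * sin (dot p x)) = cst 0.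
    by apply/funext => p; rewrite /dot !big_ord0 sin0 mulr0.
  by rewrite E E' /pker big_ord0 !Rintegral_cst// mul0r [X in fine X]lebesgue_rV0 mul1r.
set a := (uncons_rV x).1; set y := (uncons_rV x).2.
have [cE sE] := IHn y.
have [c1 s1] := rintegrable_exp_cos a e0.
have c2 := rintegrable_weight_cos y e0; have s2 := rintegrable_weight_sin y e0.
have [cci ccE] := Rintegral_rVS_prod c1 c2.
have [ssi ssE] := Rintegral_rVS_prod s1 s2.
have [csi csE] := Rintegral_rVS_prod c1 s2.
have [sci scE] := Rintegral_rVS_prod s1 c2.
split.
- transitivity (\int[leb n.+1]_p
    ((expR (- (e * `|(uncons_rV p).1|)) * cos ((uncons_rV p).1 * a)) *
       (weight e (uncons_rV p).2 * cos (dot (uncons_rV p).2 y)) -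
     (expR (- (e * `|(uncons_rV p).1|)) * sin ((uncons_rV p).1 * a)) *
       (weight e (uncons_rV p).2 * sin (dot (uncons_rV p).2 y)))).
    apply: eq_Rintegral => p _; rewrite weight_uncons dot_uncons -/a -/y cosD.
    by ring.
  rewrite RintegralB// ccE ssE Rintegral_exp_cos// Rintegral_exp_sin// mul0r subr0 cE.
  rewrite /pker big_ord_recl !mxE subr0; congr (_ * _).
  by apply: eq_bigr => i _; rewrite !mxE.
- transitivity (\int[leb n.+1]_p
    ((expR (- (e * `|(uncons_rV p).1|)) * sin ((uncons_rV p).1 * a)) *
       (weight e (uncons_rV p).2 * cos (dot (uncons_rV p).2 y)) +
     (expR (- (e * `|(uncons_rV p).1|)) * cos ((uncons_rV p).1 * a)) *
       (weight e (uncons_rV p).2 * sin (dot (uncons_rV p).2 y)))).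
    apply: eq_Rintegral => p _; rewrite weight_uncons dot_uncons -/a -/y sinD.
    by ring.
  by rewrite RintegralD// csE scE sE Rintegral_exp_sin// mul0r mulr0 addr0.
Qed.

Lemma pker_gt0 n (e : 'I_n -> R) x y : (forall i, 0 < e i) -> 0 < pker e x y.
Proof. by move=> e0; apply: prodr_gt0 => i _; exact: poisson_gt0. Qed.

Lemma pkerC n (e : 'I_n -> R) x y : pker e x y = pker e y x.
Proof. by apply: eq_bigr => i _; rewrite -poissonN opprB. Qed.

Lemma pker_sub n (e : 'I_n -> R) x y : pker e x y = pker e (x - y) 0.
Proof. by apply: eq_bigr => i _; rewrite !mxE subr0. Qed.

Lemma pker_le n (e : 'I_n -> R) x y : (forall i, 0 < e i) ->
  pker e x y <= \prod_(i < n) (2 / e i).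
Proof.
move=> e0; apply: ler_prod => i _.
by rewrite (ltW (poisson_gt0 _ (e0 i))) poisson_le.
Qed.

Lemma measurable_pker n (e : 'I_n -> R) : (forall i, 0 < e i) ->
  measurable_fun setT (fun z : 'rV[R]_n * 'rV[R]_n => pker e z.1 z.2).
Proof.
move=> e0; apply: (@measurable_prod _ _ _ _ _ (index_enum 'I_n)
  (fun i (z : 'rV[R]_n * 'rV[R]_n) => poisson (e i) (z.1 ord0 i - z.2 ord0 i))) => i _.
apply: (measurableT_comp (measurable_poisson (e0 i))).
apply: measurable_funB.
- by apply: (measurableT_comp (measurable_coord i)); exact: measurable_fst.
- by apply: (measurableT_comp (measurable_coord i)); exact: measurable_snd.
Qed.

Lemma Rintegral_pker n (e : 'I_n -> R) x : (forall i, 0 < e i) ->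
  rintegrable (leb n) (pker e x) /\ \int[leb n]_y pker e x y = mass R n.
Proof.
move=> e0.
have H := fun i => Rintegral_poisson (x ord0 i) (e0 i).
have [ki kE] := @Rintegral_rV_prod R n (fun i t => poisson (e i) (t - x ord0 i))
  (fun i => (H i).1).
have E : (fun y : 'rV[R]_n => \prod_(i < n) poisson (e i) (y ord0 i - x ord0 i)) = pker e x.
  by apply/funext => y; rewrite pkerC.
rewrite -E; split => //; rewrite kE.
under eq_bigr do rewrite (H _).2.
by rewrite prodr_const card_ord.
Qed.

End product_kernels_theory.

(** * Sine and cosine transforms and damped Parseval identity *)

Section trigonometric_transforms.
Context {R : realType} {n : nat}.
Local Notation V := 'rV[R]_n.
Local Notation leb := (lebesgue_rV R n).
Implicit Types (u g v : V -> R) (p x y : V) (e : R).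

(** [costr u p - i sintr u p] is the transform of a real function [u] without
    its normalizing constant. Real and imaginary parts are kept apart so that
    all integrals are integrals of real functions. *)
Definition costr u p : R := \int[leb]_x (cos (dot p x) * u x).
Definition sintr u p : R := \int[leb]_x (sin (dot p x) * u x).

(** The squared modulus of the unnormalized transform. *)
Definition spec g p : R := costr g p ^+ 2 + sintr g p ^+ 2.

(** Convolution with the kernel whose transform is [weight e]. *)
Definition smooth e g x : R := \int[leb]_y (pker (fun=> e) x y * g y).

Lemma measurable_cos_dotl p : measurable_fun setT (fun x => cos (dot p x)).
Proof.
apply: eq_measurable_fun (measurable_cos_dot p) => x _.
by rewrite dotC.
Qed.

Lemma measurable_sin_dotl p : measurable_fun setT (fun x => sin (dot p x)).
Proof.
apply: eq_measurable_fun (measurable_sin_dot p) => x _.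
by rewrite dotC.
Qed.

Lemma rintegrable_cosM u p : rintegrable leb u ->
  rintegrable leb (fun x => cos (dot p x) * u x).
Proof.
apply: rintegrable_bddM; first exact: measurable_cos_dotl.
by move=> x; exact: normr_cos_le1.
Qed.

Lemma rintegrable_sinM u p : rintegrable leb u ->
  rintegrable leb (fun x => sin (dot p x) * u x).
Proof.
apply: rintegrable_bddM; first exact: measurable_sin_dotl.
by move=> x; exact: normr_sin_le1.
Qed.

Lemma costr_le u p : rintegrable leb u -> `|costr u p| <= \int[leb]_x `|u x|.
Proof.
move=> ui; apply: le_Rintegral_dom; last 1 first.
- by move=> x; rewrite normrM ler_piMl// normr_cos_le1.
- exact: rintegrable_measurable (rintegrable_cosM p ui).
- exact: rintegrable_norm.
Qed.

Lemma sintr_le u p : rintegrable leb u -> `|sintr u p| <= \int[leb]_x `|u x|.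
Proof.
move=> ui; apply: le_Rintegral_dom; last 1 first.
- by move=> x; rewrite normrM ler_piMl// normr_sin_le1.
- exact: rintegrable_measurable (rintegrable_sinM p ui).
- exact: rintegrable_norm.
Qed.

Lemma measurable_costr u : rintegrable leb u -> measurable_fun setT (costr u).
Proof.
move=> ui; apply: (@measurable_Rintegral _ _ _ _ R leb
  (fun z : V * V => cos (dot z.1 z.2) * u z.2)).
- apply: measurable_funM.
    exact: measurableT_comp measurable_cos (@measurable_dot2 R n).
  by apply: measurableT_comp => //; exact: rintegrable_measurable ui.
- by move=> p; exact: rintegrable_cosM.
Qed.

Lemma measurable_sintr u : rintegrable leb u -> measurable_fun setT (sintr u).
Proof.
move=> ui; apply: (@measurable_Rintegral _ _ _ _ R leb
  (fun z : V * V => sin (dot z.1 z.2) * u z.2)).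
- apply: measurable_funM.
    exact: measurableT_comp measurable_sin (@measurable_dot2 R n).
  by apply: measurableT_comp => //; exact: rintegrable_measurable ui.
- by move=> p; exact: rintegrable_sinM.
Qed.

Lemma measurable_spec g : rintegrable leb g -> measurable_fun setT (spec g).
Proof.
by move=> gi; apply: measurable_funD; apply: measurable_funX;
  [exact: measurable_costr|exact: measurable_sintr].
Qed.

Lemma spec_ge0 g p : 0 <= spec g p.
Proof. by rewrite addr_ge0 ?sqr_ge0. Qed.

Lemma rintegrable_weight_spec e g : 0 < e -> rintegrable leb g ->
  rintegrable leb (fun p => weight e p * spec g p).
Proof.
move=> e0 gi; pose G := \int[leb]_x `|g x|.
apply: (rintegrable_weightM (B := G ^+ 2 + G ^+ 2)) => //.
  exact: measurable_spec.
move=> p; rewrite ger0_norm ?spec_ge0// lerD//.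
  by rewrite -[leLHS]ger0_norm ?sqr_ge0// normrX lerXn2r ?nnegrE ?costr_le//
    ?Rintegral_ge0.
by rewrite -[leLHS]ger0_norm ?sqr_ge0// normrX lerXn2r ?nnegrE ?sintr_le//
    ?Rintegral_ge0.
Qed.

Lemma trig_combination u p (a b : R) : rintegrable leb u ->
  rintegrable leb (fun x => (a * cos (dot p x) + b * sin (dot p x)) * u x) /\
  \int[leb]_x ((a * cos (dot p x) + b * sin (dot p x)) * u x) =
    a * costr u p + b * sintr u p.
Proof.
move=> ui; have ci := rintegrable_cosM p ui; have si := rintegrable_sinM p ui.
have aci := rintegrableZl a ci; have bsi := rintegrableZl b si.
have E x : a * (cos (dot p x) * u x) + b * (sin (dot p x) * u x) =
    (a * cos (dot p x) + b * sin (dot p x)) * u x by ring.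
split; first exact: eq_rintegrable E (rintegrableD aci bsi).
transitivity (\int[leb]_x (a * (cos (dot p x) * u x) + b * (sin (dot p x) * u x))).
  by apply: eq_Rintegral => x _; rewrite E.
by rewrite (RintegralD measurableT aci bsi) (RintegralZl _ measurableT ci)
  (RintegralZl _ measurableT si).
Qed.

(** Inverting a damped transform: the damping makes Fubini applicable, and the
    frequency integral is the transform of the weight at [x - y]. *)
Lemma weighted_parseval_inner e g x : 0 < e -> rintegrable leb g ->
  \int[leb]_p (weight e p * (cos (dot p x) * costr g p + sin (dot p x) * sintr g p)) =
    smooth e g x /\
  \int[leb]_p (weight e p * (sin (dot p x) * costr g p - cos (dot p x) * sintr g p)) = 0.
Proof.
move=> e0 gi.
have [wi _] := Rintegral_weight n e0; have gni := rintegrable_norm gi.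
have mw := rintegrable_measurable _ wi; have mg := rintegrable_measurable _ gi.
have md : measurable_fun setT (fun z : V * V => dot z.1 (x - z.2)).
  rewrite (_ : (fun z => _) = fun z : V * V => dot z.1 x - dot z.1 z.2).
    apply: measurable_funB; last exact: measurable_dot2.
    by apply: (measurableT_comp (measurable_dot x)); exact: measurable_fst.
  by apply/funext => z; rewrite dotBr.
split.
- have [_ _ E _] := @rfubini_dom _ _ _ _ R leb leb
    (fun z : V * V => weight e z.1 * (cos (dot z.1 (x - z.2)) * g z.2)) _ _
    ltac:(apply: measurable_funM; [exact: measurableT_comp|];
      apply: measurable_funM; [exact: measurableT_comp measurable_cos md|
        exact: measurableT_comp]) wi gni
    ltac:(by move=> p y; rewrite normrM ger0_norm ?(ltW (weight_gt0 _ _))// ler_wpM2l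
        ?(ltW (weight_gt0 _ _))//= normrM ler_piMl// normr_cos_le1).
  transitivity (\int[leb]_p \int[leb]_y (weight e p * (cos (dot p (x - y)) * g y))).
    apply: eq_Rintegral => p _.
    have [ci cE] := trig_combination p (cos (dot p x)) (sin (dot p x)) gi.
    rewrite -cE -(RintegralZl _ measurableT ci); apply: eq_Rintegral => y _.
    by rewrite dotBr cosB.
  rewrite E; apply: eq_Rintegral => y _.
  rewrite pker_sub -(Rintegral_weight_cos_sin (x - y) e0).1 -RintegralZr//.
    by apply: eq_Rintegral => p _; rewrite mulrA.
  exact: rintegrable_weight_cos.
- have [_ _ E _] := @rfubini_dom _ _ _ _ R leb leb
    (fun z : V * V => weight e z.1 * (sin (dot z.1 (x - z.2)) * g z.2)) _ _
    ltac:(apply: measurable_funM; [exact: measurableT_comp|];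
      apply: measurable_funM; [exact: measurableT_comp measurable_sin md|
        exact: measurableT_comp]) wi gni
    ltac:(by move=> p y; rewrite normrM ger0_norm ?(ltW (weight_gt0 _ _))// ler_wpM2l
        ?(ltW (weight_gt0 _ _))//= normrM ler_piMl// normr_sin_le1).
  transitivity (\int[leb]_p \int[leb]_y (weight e p * (sin (dot p (x - y)) * g y))).
    apply: eq_Rintegral => p _.
    have [ci cE] := trig_combination p (sin (dot p x)) (- cos (dot p x)) gi.
    rewrite -mulNr -cE -(RintegralZl _ measurableT ci); apply: eq_Rintegral => y _.
    by rewrite dotBr sinB mulNr.
  rewrite E -[RHS](mul0r (fine (leb setT))) -Rintegral_cst//.
  apply: eq_Rintegral => y _.
  transitivity (\int[leb]_p (weight e p * sin (dot p (x - y))) * g y).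
    rewrite -RintegralZr//; last exact: rintegrable_weight_sin.
    by apply: eq_Rintegral => p _; rewrite mulrA.
  by rewrite (Rintegral_weight_cos_sin (x - y) e0).2 mul0r.
Qed.

(** With the damping [weight e] on the frequency side, Parseval's identity needs
    nothing but Fubini; the damping becomes a convolution on the other side. *)
Lemma weighted_parseval e u g : 0 < e -> rintegrable leb u -> rintegrable leb g ->
  \int[leb]_p (weight e p * (costr u p * costr g p + sintr u p * sintr g p)) =
    \int[leb]_x (u x * smooth e g x) /\
  \int[leb]_p (weight e p * (sintr u p * costr g p - costr u p * sintr g p)) = 0.
Proof.
move=> e0 ui gi; pose G := \int[leb]_x `|g x|.
have [wi _] := Rintegral_weight n e0; have uni := rintegrable_norm ui.
have mw := rintegrable_measurable _ wi; have mu := rintegrable_measurable _ ui.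
have mC := measurable_costr gi; have mS := measurable_sintr gi.
have G0 : 0 <= G by exact: Rintegral_ge0.
have mcos : measurable_fun setT (fun z : V * V => cos (dot z.1 z.2)).
  exact: measurableT_comp measurable_cos (@measurable_dot2 R n).
have msin : measurable_fun setT (fun z : V * V => sin (dot z.1 z.2)).
  exact: measurableT_comp measurable_sin (@measurable_dot2 R n).
have mC2 : measurable_fun setT (fun z : V * V => costr g z.1) by exact: measurableT_comp.
have mS2 : measurable_fun setT (fun z : V * V => sintr g z.1) by exact: measurableT_comp.
have mw2 : measurable_fun setT (fun z : V * V => weight e z.1) by exact: measurableT_comp.
have mu2 : measurable_fun setT (fun z : V * V => u z.2) by exact: measurableT_comp.
have bnd a b p : `|a| <= 1 -> `|b| <= 1 -> `|a * costr g p + b * sintr g p| <= G + G.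
  move=> a1 b1; rewrite (le_trans (ler_normD _ _))// lerD// normrM.
    by rewrite -[leRHS]mul1r ler_pM// costr_le.
  by rewrite -[leRHS]mul1r ler_pM// sintr_le.
split.
- have [_ _ E _] := @rfubini_dom _ _ _ _ R leb leb
    (fun z : V * V => weight e z.1 * (cos (dot z.1 z.2) * costr g z.1 +
        sin (dot z.1 z.2) * sintr g z.1) * u z.2)
    (fun p => weight e p * (G + G)) (fun x => `|u x|)
    ltac:(apply: measurable_funM => //; apply: measurable_funM => //;
      apply: measurable_funD; exact: measurable_funM)
    (rintegrableZr (G + G) wi) uni
    ltac:(by move=> p x; rewrite !normrM ger0_norm ?(ltW (weight_gt0 _ _))//=
      ler_wpM2r// ler_wpM2l ?(ltW (weight_gt0 _ _))// bnd// ?normr_cos_le1 ?normr_sin_le1).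
  transitivity (\int[leb]_p \int[leb]_x (weight e p * (cos (dot p x) * costr g p +
      sin (dot p x) * sintr g p) * u x)).
    apply: eq_Rintegral => p _.
    have [ci cE] := trig_combination p (costr g p) (sintr g p) ui.
    rewrite (mulrC (costr u p)) (mulrC (sintr u p)) -cE -(RintegralZl _ measurableT ci).
    by apply: eq_Rintegral => x _; ring.
  rewrite E; apply: eq_Rintegral => x _.
  rewrite -(weighted_parseval_inner x e0 gi).1 [RHS]mulrC -RintegralZr//.
  apply: (rintegrable_weightM (B := G + G)) => //.
    apply: measurable_funD; apply: measurable_funM => //.
      exact: measurable_cos_dot.
    exact: measurable_sin_dot.
  by move=> p; rewrite bnd// ?normr_cos_le1 ?normr_sin_le1.
- have [_ _ E _] := @rfubini_dom _ _ _ _ R leb leb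
    (fun z : V * V => weight e z.1 * (sin (dot z.1 z.2) * costr g z.1 -
        cos (dot z.1 z.2) * sintr g z.1) * u z.2)
    (fun p => weight e p * (G + G)) (fun x => `|u x|)
    ltac:(apply: measurable_funM => //; apply: measurable_funM => //;
      apply: measurable_funB; exact: measurable_funM)
    (rintegrableZr (G + G) wi) uni
    ltac:(by move=> p x; rewrite !normrM ger0_norm ?(ltW (weight_gt0 _ _))//=
      ler_wpM2r// ler_wpM2l ?(ltW (weight_gt0 _ _))// -mulNr bnd// ?normrN ?normr_cos_le1 ?normr_sin_le1).
  transitivity (\int[leb]_p \int[leb]_x (weight e p * (sin (dot p x) * costr g p -
      cos (dot p x) * sintr g p) * u x)).
    apply: eq_Rintegral => p _.
    have [ci cE] := trig_combination p (- sintr g p) (costr g p) ui.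
    rewrite (mulrC (sintr u p)) addrC (mulrC (costr u p)) -mulNr -cE.
    by rewrite -(RintegralZl _ measurableT ci); apply: eq_Rintegral => x _; ring.
  rewrite E -[RHS](mul0r (fine (leb setT))) -Rintegral_cst//.
  apply: eq_Rintegral => x _; apply: esym.
  transitivity (\int[leb]_p (weight e p * (sin (dot p x) * costr g p -
      cos (dot p x) * sintr g p)) * u x).
    by rewrite (weighted_parseval_inner x e0 gi).2 mul0r.
  rewrite -RintegralZr//.
  apply: (rintegrable_weightM (B := G + G)) => //.
    apply: measurable_funB; apply: measurable_funM => //.
      exact: measurable_sin_dot.
    exact: measurable_cos_dot.
  by move=> p; rewrite -mulNr bnd// ?normrN ?normr_cos_le1 ?normr_sin_le1.
Qed.

End trigonometric_transforms.

(** * Half a derivative measured by differences *)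

Section energy.
Context {R : realType} {n : nat}.
Local Notation V := 'rV[R]_n.
Local Notation leb := (lebesgue_rV R n).
Local Notation mass := (mass R n).
Implicit Types (u g v : V -> R) (p x y : V) (e : R) (w : 'I_n -> R).

Lemma mass_gt0 : 0 < mass.
Proof. by rewrite exprn_gt0// mulr_gt0// pi_gt0. Qed.

Lemma measurable_pkerl w x : (forall i, 0 < w i) -> measurable_fun setT (pker w x).
Proof. by move=> w0; exact: measurable_sectionl (measurable_pker w0). Qed.

Lemma rintegrable_pkerM w v x : (forall i, 0 < w i) -> rintegrable leb v ->
  rintegrable leb (fun y => pker w x y * v y).
Proof.
move=> w0; apply: (rintegrable_bddM (B := \prod_(i < n) (2 / w i))).
  exact: measurable_pkerl.
by move=> y; rewrite ger0_norm ?pker_le// ltW// pker_gt0.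
Qed.

Lemma Rintegral_pker_conv w v : (forall i, 0 < w i) -> rintegrable leb v ->
  (forall x, 0 <= v x) ->
  rintegrable leb (fun x => \int[leb]_y (pker w x y * v y)) /\
  \int[leb]_x \int[leb]_y (pker w x y * v y) = mass * \int[leb]_y v y.
Proof.
move=> w0 vi v0; have mv := rintegrable_measurable _ vi.
have E y : \int[leb]_x (pker w x y * v y) = mass * v y.
  have [ki kE] := Rintegral_pker y w0.
  rewrite RintegralZr//; first by under eq_Rintegral do rewrite pkerC; rewrite kE.
  by apply: eq_rintegrable ki => x; rewrite pkerC.
have [ci cE] := @rtonelli _ _ _ _ R leb leb (fun z : V * V => pker w z.2 z.1 * v z.1)
  ltac:(apply: measurable_funM; [apply: (measurableT_comp (measurable_pker w0)
      (g := fun z : V * V => (z.2, z.1))); exact: measurable_swap|exact: measurableT_comp])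
  ltac:(by move=> z; rewrite mulr_ge0// ltW// pker_gt0)
  ltac:(by move=> y /=; apply: rintegrableZr; have [+ _] := Rintegral_pker y w0;
    apply: eq_rintegrable => x; rewrite pkerC)
  ltac:(by move=> x /=; exact: rintegrable_pkerM)
  ltac:(by apply: eq_rintegrable (rintegrableZl mass vi) => y; rewrite -E).
split => //; rewrite -cE -RintegralZl//.
by apply: eq_Rintegral => y _; exact: E.
Qed.

(** Squared differences of [g] averaged over the Poisson kernel of width [e].
    On the frequency side this is twice the integral of [1 - weight e] against
    the spectrum of [g], hence at most of the order of [e] times the square of the H^(1/2) seminorm;
    but differences, unlike transforms, can be estimated for explicit [g]. *)
Definition gagliardo e g : R :=
  \int[leb]_x \int[leb]_y (pker (fun=> e) x y * (g x - g y) ^+ 2).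

Section square_integrable.
Variables (e : R) (g : V -> R).
Hypotheses (e0 : 0 < e) (gi : rintegrable leb g).
Hypothesis g2i : rintegrable leb (fun x => g x ^+ 2).

Let ws : forall i : 'I_n, 0 < (fun=> e) i. Proof. by []. Qed.

Lemma rintegrable_gagliardo_inner x :
  rintegrable leb (fun y => pker (fun=> e) x y * (g x - g y) ^+ 2).
Proof.
have [ki _] := Rintegral_pker x ws.
have := rintegrableD (rintegrableB (rintegrableZr (g x ^+ 2) ki)
  (rintegrableZl (2 * g x) (rintegrable_pkerM x ws gi))) (rintegrable_pkerM x ws g2i).
by apply: eq_rintegrable => y; ring.
Qed.

Lemma gagliardo_innerE x :
  \int[leb]_y (pker (fun=> e) x y * (g x - g y) ^+ 2) =
  mass * g x ^+ 2 - 2 * (g x * smooth e g x) +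
  \int[leb]_y (pker (fun=> e) x y * g y ^+ 2).
Proof.
have [ki kE] := Rintegral_pker x ws.
have i1 := rintegrableZr (g x ^+ 2) ki.
have i2 := rintegrableZl (2 * g x) (rintegrable_pkerM x ws gi).
have i3 := rintegrable_pkerM x ws g2i.
transitivity (\int[leb]_y (pker (fun=> e) x y * g x ^+ 2 -
    2 * g x * (pker (fun=> e) x y * g y) + pker (fun=> e) x y * g y ^+ 2)).
  by apply: eq_Rintegral => y _; ring.
rewrite RintegralD//; last exact: rintegrableB.
rewrite RintegralB// RintegralZr// kE RintegralZl//; last exact: rintegrable_pkerM.
by rewrite mulrA.
Qed.

Lemma smooth_le x : `|smooth e g x| <= (2 / e) ^+ n * \int[leb]_y `|g y|.
Proof.
rewrite -RintegralZl//; last exact: rintegrable_norm.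
apply: le_Rintegral_dom.
- exact: rintegrable_measurable (rintegrable_pkerM x ws gi).
- by apply: rintegrableZl; exact: rintegrable_norm.
- move=> y; rewrite normrM ler_wpM2r// ger0_norm ?(ltW (pker_gt0 _ _ ws))//.
  by rewrite (le_trans (pker_le _ _ ws))// prodr_const card_ord.
Qed.

Lemma measurable_smooth : measurable_fun setT (smooth e g).
Proof.
apply: (@measurable_Rintegral _ _ _ _ R leb
  (fun z : V * V => pker (fun=> e) z.1 z.2 * g z.2)).
- apply: measurable_funM; first exact: measurable_pker.
  by apply: measurableT_comp => //; exact: rintegrable_measurable gi.
- by move=> x; exact: rintegrable_pkerM.
Qed.

Lemma rintegrable_smoothM u : rintegrable leb u ->
  rintegrable leb (fun x => u x * smooth e g x).
Proof.
move=> ui; have := rintegrable_bddM measurable_smooth smooth_le ui.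
by apply: eq_rintegrable => x; rewrite mulrC.
Qed.

Lemma rintegrable_gagliardo :
  rintegrable leb (fun x => \int[leb]_y (pker (fun=> e) x y * (g x - g y) ^+ 2)).
Proof.
have [ci _] := Rintegral_pker_conv ws g2i (fun x => sqr_ge0 (g x)).
have := rintegrableD (rintegrableB (rintegrableZl mass g2i)
  (rintegrableZl 2 (rintegrable_smoothM gi))) ci.
by apply: eq_rintegrable => x; rewrite gagliardo_innerE.
Qed.

Lemma gagliardo_ge0 : 0 <= gagliardo e g.
Proof.
apply: Rintegral_ge0 => x _; apply: Rintegral_ge0 => y _.
by rewrite mulr_ge0 ?sqr_ge0// ltW// pker_gt0.
Qed.

(** Expand the square in [gagliardo]: the two pure squares give the L^2 norm,
    because the kernel is symmetric of constant mass, and the cross term is the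
    damped Parseval identity. *)
Lemma weighted_plancherel :
  \int[leb]_p (weight e p * spec g p) =
  mass * \int[leb]_x g x ^+ 2 - gagliardo e g / 2.
Proof.
have [ci cE] := Rintegral_pker_conv ws g2i (fun x => sqr_ge0 (g x)).
have i1 := rintegrableZl mass g2i.
have i2 := rintegrableZl 2 (rintegrable_smoothM gi).
have -> : gagliardo e g = 2 * (mass * \int[leb]_x g x ^+ 2) -
    2 * \int[leb]_x (g x * smooth e g x).
  rewrite /gagliardo.
  under eq_Rintegral do rewrite gagliardo_innerE.
  rewrite RintegralD//; last exact: rintegrableB.
  rewrite RintegralB// cE RintegralZl// RintegralZl//; last exact: rintegrable_smoothM.
  by ring.
have [<- _] := weighted_parseval e0 gi gi.
transitivity (\int[leb]_p (weight e p * (costr g p * costr g p + sintr g p * sintr g p))).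
  by [].
by field.
Qed.

End square_integrable.

Lemma cvg_weight1 p : (weight (k.+1%:R^-1) p : R) @[k --> \oo] --> (1 : R).
Proof.
rewrite [X in _ --> X](_ : 1 = expR (- (0 * l1 p))); last by rewrite mul0r oppr0 expR0.
have H : continuous (fun t : R => expR (- (t * l1 p))).
  move=> t; apply: (@continuous_comp _ _ _ (fun t : R => - (t * l1 p)) (@expR R)).
    by apply: cvgN; apply: cvgM => //; exact: cvg_cst.
  exact: continuous_expR.
by have := cvg_comp _ _ (@cvg_harmonic R) (H 0).
Qed.

Lemma invSn_gt0 k : 0 < k.+1%:R^-1 :> R.
Proof. by rewrite invr_gt0. Qed.

(** Bessel's inequality: the damped spectrum has at most this integral since
    [gagliardo] is nonnegative, and Fatou's lemma removes the damping. *)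
Lemma bessel g : rintegrable leb g -> rintegrable leb (fun x => g x ^+ 2) ->
  rintegrable leb (spec g) /\
  \int[leb]_p spec g p <= mass * \int[leb]_x g x ^+ 2.
Proof.
move=> gi g2i.
apply: (Rintegral_fatou_le (w := fun k => weight (k.+1%:R^-1))).
- by move=> k; exact: measurable_weight.
- exact: measurable_spec.
- by move=> k p; rewrite ltW// weight_gt0.
- exact: spec_ge0.
- exact: cvg_weight1.
- by move=> k; apply: rintegrable_weight_spec => //; exact: invSn_gt0.
- move=> k; rewrite weighted_plancherel ?invSn_gt0//.
  by rewrite gerBl divr_ge0// gagliardo_ge0// invSn_gt0.
Qed.

(** Squared differences of order [e] control half a derivative. From
    t exp (- t) <= 1 - exp (- t) one gets l1 p * weight e p <= (1 - weight e p) / e,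
    and the integral of 1 - weight e against the spectrum is at most
    gagliardo e g / 2. *)
Lemma energy_le g A : rintegrable leb g -> rintegrable leb (fun x => g x ^+ 2) ->
  (forall e, 0 < e -> gagliardo e g <= e * A) ->
  rintegrable leb (fun p => l1 p * spec g p) /\
  \int[leb]_p (l1 p * spec g p) <= A / 2.
Proof.
move=> gi g2i gA; have [si sE] := bessel gi g2i.
have key k p : weight (k.+1%:R^-1) p * (l1 p * spec g p) <=
    k.+1%:R * (spec g p - weight (k.+1%:R^-1) p * spec g p).
  set t : R := k.+1%:R^-1 * l1 p.
  have -> : l1 p = k.+1%:R * t by rewrite /t mulrA divff ?mul1r.
  have tW : weight (k.+1%:R^-1) p * t <= 1 - weight (k.+1%:R^-1) p.
    rewrite /weight -/t lerBrDl -{1}[expR (- t)]mulr1 -mulrDr.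
    by rewrite -ler_pdivlMl ?expR_gt0// mulr1 -expRN opprK expR_ge1Dx.
  rewrite [leLHS](_ : _ = k.+1%:R * ((weight (k.+1%:R^-1) p * t) * spec g p)); last by ring.
  rewrite ler_pM2l// -{2}[spec g p]mul1r -mulrBl.
  by rewrite ler_wpM2r// spec_ge0.
have keyi k : rintegrable leb (fun p => k.+1%:R *
    (spec g p - weight (k.+1%:R^-1) p * spec g p)).
  apply: rintegrableZl; apply: rintegrableB => //.
  by apply: rintegrable_weight_spec => //; exact: invSn_gt0.
have m1 : measurable_fun setT (fun p => l1 p * spec g p).
  by apply: measurable_funM; [exact: measurable_l1|exact: measurable_spec].
have pos p : 0 <= l1 p * spec g p by rewrite mulr_ge0 ?l1_ge0 ?spec_ge0.
have wi k : rintegrable leb (fun p => weight (k.+1%:R^-1) p * (l1 p * spec g p)).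
  apply: (rintegrable_dom _ (keyi k)).
    by apply: measurable_funM => //; exact: measurable_weight.
  by move=> p; rewrite ger0_norm// mulr_ge0// ltW// weight_gt0.
apply: (Rintegral_fatou_le (w := fun k => weight (k.+1%:R^-1))) => //.
- by move=> k; exact: measurable_weight.
- by move=> k p; rewrite ltW// weight_gt0.
- exact: cvg_weight1.
- move=> k; apply: (le_trans (le_Rintegral measurableT (wi k) (keyi k) (fun p _ => key k p))).
  have wsi := rintegrable_weight_spec (invSn_gt0 k) gi.
  rewrite RintegralZl//; last exact: rintegrableB.
  rewrite RintegralB// weighted_plancherel ?invSn_gt0//.
  rewrite -ler_pdivlMl// mulrA (le_trans (y := gagliardo k.+1%:R^-1 g / 2))//.
    by rewrite lerBlDr addrCA subrr addr0.
  by rewrite ler_pM2r// gA// invSn_gt0.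
Qed.

(** min (a, b) is at most the harmonic mean 2 a b / (a + b). For a = M^2 and
    b = (L s)^2 this trades the kernel of width [e] for the kernel of width
    [M / L], whose mass does not depend on M and L, with the gain e M L. *)
Lemma poisson_min_le e M L s : 0 < e -> 0 < M -> 0 < L ->
  poisson e s * Num.min (M ^+ 2) (L ^+ 2 * s ^+ 2) <= 2 * e * M * L * poisson (M / L) s.
Proof.
move=> e0 M0 L0.
have D1 := poisson_den_gt0 s e0; have D2 := poisson_den_gt0 s (divr_gt0 M0 L0).
have Q : 0 < M ^+ 2 + L ^+ 2 * s ^+ 2 by rewrite ltr_pwDl ?exprn_gt0// mulr_ge0 ?sqr_ge0.
rewrite [leRHS](_ : _ = 2 * e * (2 * M ^+ 2 * L ^+ 2 / (M ^+ 2 + L ^+ 2 * s ^+ 2))); last first.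
  rewrite /poisson expr_div_n; field.
  by rewrite exprMn !gt_eqF.
rewrite [leLHS](_ : _ = 2 * e * (Num.min (M ^+ 2) (L ^+ 2 * s ^+ 2) /
  (e ^+ 2 + s ^+ 2))); last by rewrite /poisson; ring.
rewrite ler_pM2l ?mulr_gt0// ler_pdivrMr// [leRHS]mulrAC ler_pdivlMr//.
have a0 : 0 <= M ^+ 2 by exact: sqr_ge0.
have bc0 : 0 <= L ^+ 2 * s ^+ 2 by rewrite mulr_ge0 ?sqr_ge0.
have ML : 0 <= M ^+ 2 * (L ^+ 2 * e ^+ 2) by rewrite !mulr_ge0 ?(ltW M0) ?(ltW L0) ?(ltW e0).
rewrite (@le_trans _ _ (2 * (M ^+ 2 * (L ^+ 2 * s ^+ 2))))//; last first.
  rewrite -subr_ge0 [leRHS](_ : _ = 2 * (M ^+ 2 * (L ^+ 2 * e ^+ 2))); last by ring.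
  by rewrite mulr_ge0.
move: (M ^+ 2) (L ^+ 2 * s ^+ 2) a0 bc0 {ML Q} => a b a0 b0.
rewrite -subr_ge0; have [ab|/ltW ba] := leP a b.
- rewrite [leRHS](_ : _ = a * (b - a)); last by ring.
  by rewrite mulr_ge0// subr_ge0.
- rewrite [leRHS](_ : _ = b * (a - b)); last by ring.
  by rewrite mulr_ge0// subr_ge0.
Qed.

(** The energy of a function of height [M] and slope [L] is of the order of
    M L times a volume, here measured by [v]. The width of the kernel is changed
    by [poisson_min_le] in one coordinate at a time. *)
Lemma gagliardo_le g v M L : (0 < n)%N -> 0 < M -> 0 < L ->
  rintegrable leb g -> rintegrable leb (fun x => g x ^+ 2) ->
  rintegrable leb v -> (forall x, 0 <= v x) ->
  (forall x y, (g x - g y) ^+ 2 <= (v x + v y) *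
    \sum_(i < n) Num.min (M ^+ 2) (L ^+ 2 * (x ord0 i - y ord0 i) ^+ 2)) ->
  forall e, 0 < e -> gagliardo e g <= e * (4 * n%:R * M * L * mass * \int[leb]_x v x).
Proof.
move=> n0 M0 L0 gi g2i vi v0 gv e e0.
pose w (j i : 'I_n) : R := if i == j then M / L else e.
have w0 j i : 0 < w j i by rewrite /w; case: ifP => // _; exact: divr_gt0.
pose c := 2 * e * M * L.
have c0 : 0 <= c by rewrite /c !mulr_ge0// ltW.
have Kle x y j : pker (fun=> e) x y *
    Num.min (M ^+ 2) (L ^+ 2 * (x ord0 j - y ord0 j) ^+ 2) <= c * pker (w j) x y.
  rewrite /pker (bigD1 j)//= [in leRHS](bigD1 j)//= {1}/w eqxx.
  rewrite mulrAC [leRHS]mulrA ler_pM//.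
  - apply: mulr_ge0; first exact/ltW/poisson_gt0.
    by rewrite le_min (sqr_ge0 M)/= -exprMn sqr_ge0.
  - by apply: prodr_ge0 => i _; rewrite ltW// poisson_gt0.
  - exact: poisson_min_le.
  - by rewrite le_eqVlt; apply/orP; left; apply/eqP; apply: eq_bigr => i /negbTE ij;
      rewrite /w ij.
have ji x j : rintegrable leb (fun y => pker (w j) x y * (v x + v y)).
  have [ki _] := Rintegral_pker x (w0 j).
  have := rintegrableD (rintegrableZr (v x) ki) (rintegrable_pkerM x (w0 j) vi).
  by apply: eq_rintegrable => y; rewrite mulrDr.
have jE x j : \int[leb]_y (pker (w j) x y * (v x + v y)) =
    mass * v x + \int[leb]_y (pker (w j) x y * v y).
  have [ki kE] := Rintegral_pker x (w0 j).
  under eq_Rintegral do rewrite mulrDr.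
  rewrite RintegralD//; last exact: rintegrable_pkerM.
    by rewrite RintegralZr// kE.
  exact: rintegrableZr.
have jji j : rintegrable leb (fun x => \int[leb]_y (pker (w j) x y * (v x + v y))).
  have [ci _] := Rintegral_pker_conv (w0 j) vi v0.
  by apply: eq_rintegrable (rintegrableD (rintegrableZl mass vi) ci) => x; rewrite jE.
have jjE j : \int[leb]_x \int[leb]_y (pker (w j) x y * (v x + v y)) =
    2 * mass * \int[leb]_x v x.
  have [ci cE] := Rintegral_pker_conv (w0 j) vi v0.
  under eq_Rintegral do rewrite jE.
  rewrite RintegralD//; last exact: rintegrableZl.
  by rewrite cE RintegralZl//; ring.
have sumi x : rintegrable leb (fun y => \sum_(j < n) c * (pker (w j) x y * (v x + v y))).
  by apply: rintegrable_sum => j; exact: rintegrableZl.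
have inner x : \int[leb]_y (pker (fun=> e) x y * (g x - g y) ^+ 2) <=
    \sum_(j < n) c * \int[leb]_y (pker (w j) x y * (v x + v y)).
  rewrite [leRHS](_ : _ = \sum_(j < n) \int[leb]_y (c * (pker (w j) x y * (v x + v y))));
    last by apply: eq_bigr => j _; rewrite RintegralZl//; exact: ji.
  rewrite -Rintegral_sum; last by move=> j; exact: rintegrableZl.
  apply: le_Rintegral => //; [exact: rintegrable_gagliardo_inner|exact: sumi|].
  move=> y _; have k0 := ltW (pker_gt0 x y (fun _ : 'I_n => e0)).
  rewrite (le_trans (ler_wpM2l k0 (gv x y)))// mulrCA mulr_sumr.
  rewrite mulr_sumr; apply: ler_sum => j _.
  rewrite [leRHS](_ : _ = (v x + v y) * (c * pker (w j) x y)); last by ring.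
  by rewrite ler_wpM2l// addr_ge0.
rewrite /gagliardo (@le_trans _ _ (\sum_(j < n) c * (2 * mass * \int[leb]_x v x)))//.
  rewrite [leRHS](_ : _ = \sum_(j < n) \int[leb]_x (c *
      \int[leb]_y (pker (w j) x y * (v x + v y))));
    last by apply: eq_bigr => j _; rewrite RintegralZl ?jjE//; exact: jji.
  rewrite -Rintegral_sum; last by move=> j; exact: rintegrableZl.
  apply: le_Rintegral => //; first exact: rintegrable_gagliardo.
  by apply: rintegrable_sum => j; exact: rintegrableZl.
by rewrite sumr_const card_ord -mulr_natl /c le_eqVlt; apply/orP; left; apply/eqP; ring.
Qed.

End energy.

(** * Parseval's identity for functions of finite energy *)

Section parseval.
Context {R : realType} {n : nat}.
Local Notation V := 'rV[R]_n.
Local Notation leb := (lebesgue_rV R n).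
Local Notation mass := (mass R n).
Implicit Types (a b u g rho : V -> R) (p x y : V) (e A : R).

(** Integrable functions in H^(1/2), with an explicit bound for the energy, in
    the form in which it is checked: by differences of values rather than on the
    frequency side. *)
Definition tame A g : Prop :=
  [/\ rintegrable leb g, rintegrable leb (fun x => g x ^+ 2) &
      forall e, 0 < e -> gagliardo e g <= e * A].

Lemma rintegrableM_sqr u g : measurable_fun setT u -> measurable_fun setT g ->
  rintegrable leb (fun x => u x ^+ 2) -> rintegrable leb (fun x => g x ^+ 2) ->
  rintegrable leb (fun x => u x * g x).
Proof.
move=> mu mg u2 g2.
apply: (rintegrable_dom _ (rintegrableD u2 g2)); first exact: measurable_funM.
move=> x; rewrite -(real_normK (num_real (u x))) -(real_normK (num_real (g x))) normrM.
have := sqr_ge0 (`|u x| - `|g x|); have := normr_ge0 (u x); have := normr_ge0 (g x).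
by move: `|u x| `|g x| => s t; nra.
Qed.

Lemma young_abs (s t l : R) : 0 < l -> `|s * t| <= (l * s ^+ 2 + t ^+ 2 / l) / 2.
Proof.
move=> l0; rewrite -(real_normK (num_real s)) -(real_normK (num_real t)) normrM.
rewrite ler_pdivlMr// -subr_ge0.
move: `|s| `|t| => a b.
rewrite [leRHS](_ : _ = (l * a - b) ^+ 2 / l); last by field; rewrite gt_eqF.
by rewrite divr_ge0 ?sqr_ge0 ?ltW.
Qed.

(** Convolution with the kernel moves a tame function by O(sqrt e) in the weak
    sense: take [l] to be the square root of [e]. *)
Lemma smooth_sub_le e l u g A : 0 < e -> 0 < l -> measurable_fun setT u ->
  rintegrable leb u ->
  rintegrable leb (fun x => u x ^+ 2) -> tame A g ->
  `|\int[leb]_x (u x * smooth e g x) - mass * \int[leb]_x (u x * g x)| <=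
  (l * (mass * \int[leb]_x u x ^+ 2) + e * A / l) / 2.
Proof.
move=> e0 l0 mu ui u2i [gi g2i gA].
have mg := rintegrable_measurable _ gi.
have ugi := rintegrableM_sqr mu mg u2i g2i.
have usi := rintegrable_smoothM e0 gi ui.
have msi := rintegrableZl mass ugi.
have Gi := rintegrable_gagliardo e0 gi g2i.
rewrite -RintegralZl// -RintegralB//.
have bi : rintegrable leb (fun x => (l * (mass * u x ^+ 2) +
    \int[leb]_y (pker (fun=> e) x y * (g x - g y) ^+ 2) / l) / 2).
  apply: rintegrableZr; apply: rintegrableD; last exact: rintegrableZr.
  by apply: rintegrableZl; exact: rintegrableZl.
apply: (@le_trans _ _ (\int[leb]_x ((l * (mass * u x ^+ 2) +
    \int[leb]_y (pker (fun=> e) x y * (g x - g y) ^+ 2) / l) / 2))).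
  apply: le_Rintegral_dom => //.
    exact: rintegrable_measurable (rintegrableB usi msi).
  move=> x; have [ki kE] := Rintegral_pker x (fun _ : 'I_n => e0).
  have i1 := rintegrable_pkerM x (fun _ : 'I_n => e0) gi.
  have i2 := rintegrableZr (g x) ki.
  have Ii := rintegrable_gagliardo_inner e0 gi g2i x.
  have -> : u x * smooth e g x - mass * (u x * g x) =
      \int[leb]_y (u x * (pker (fun=> e) x y * g y - pker (fun=> e) x y * g x)).
    rewrite RintegralZl//; last exact: rintegrableB.
    by rewrite RintegralB// RintegralZr// kE /smooth; ring.
  have -> : (l * (mass * u x ^+ 2) +
      \int[leb]_y (pker (fun=> e) x y * (g x - g y) ^+ 2) / l) / 2 =
      \int[leb]_y ((l * u x ^+ 2 / 2) * pker (fun=> e) x y +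
      (2 * l)^-1 * (pker (fun=> e) x y * (g x - g y) ^+ 2)).
    rewrite RintegralD//; [|exact: rintegrableZl|exact: rintegrableZl].
    by rewrite !RintegralZl// kE; field; rewrite gt_eqF.
  apply: le_Rintegral_dom.
  - exact: rintegrable_measurable (rintegrableZl (u x) (rintegrableB i1 i2)).
  - by apply: rintegrableD; exact: rintegrableZl.
  move=> y; have k0 := pker_gt0 x y (fun _ : 'I_n => e0).
  rewrite -mulrBr mulrCA normrM (gtr0_norm k0).
  rewrite [leRHS](_ : _ = pker (fun=> e) x y * ((l * u x ^+ 2 + (g y - g x) ^+ 2 / l) / 2)).
    by rewrite ler_pM2l// young_abs.
  by field; rewrite gt_eqF.
rewrite RintegralZr//; last first.
  apply: rintegrableD; last exact: rintegrableZr.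
  by apply: rintegrableZl; exact: rintegrableZl.
rewrite RintegralD//; [|by apply: rintegrableZl; exact: rintegrableZl|exact: rintegrableZr].
rewrite RintegralZl//; last exact: rintegrableZl.
rewrite RintegralZl// RintegralZr//.
by rewrite ler_pM2r// lerD2l ler_pM2r ?invr_gt0//; exact: gA.
Qed.

Lemma cvg_sqrt_harmonic : (Num.sqrt (k.+1%:R^-1) : R) @[k --> \oo] --> (0 : R).
Proof.
rewrite -[X in _ --> X](@sqrtr0 R).
by have := cvg_comp _ _ (@cvg_harmonic R) (@sqrt_continuous R 0).
Qed.

Lemma spec_cross_le s t s' t' : `|s * t + s' * t' : R| <= (s ^+ 2 + s' ^+ 2) + (t ^+ 2 + t' ^+ 2).
Proof.
rewrite (le_trans (ler_normD _ _))//.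
have := young_abs s t (@ltr01 R); have := young_abs s' t' (@ltr01 R).
rewrite !mul1r !divr1.
have := sqr_ge0 s; have := sqr_ge0 t; have := sqr_ge0 s'; have := sqr_ge0 t'.
by move: `|s * t| `|s' * t'| (s ^+ 2) (t ^+ 2) (s' ^+ 2) (t' ^+ 2) => *; lra.
Qed.

(** Parseval's identity against a tame function: remove the damping from
    [weighted_parseval], by domination on the frequency side and by
    [smooth_sub_le] on the other. *)
Lemma parseval u g A : rintegrable leb u -> rintegrable leb (fun x => u x ^+ 2) ->
  tame A g ->
  [/\ rintegrable leb (fun p => costr u p * costr g p + sintr u p * sintr g p),
      \int[leb]_p (costr u p * costr g p + sintr u p * sintr g p) =
        mass * \int[leb]_x (u x * g x),
      rintegrable leb (fun p => sintr u p * costr g p - costr u p * sintr g p) &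
      \int[leb]_p (sintr u p * costr g p - costr u p * sintr g p) = 0].
Proof.
move=> ui u2i [gi g2i gA].
have [ui' _] := bessel ui u2i; have [gi' _] := bessel gi g2i.
have mu := rintegrable_measurable _ ui.
have mCu := measurable_costr ui; have mSu := measurable_sintr ui.
have mCg := measurable_costr gi; have mSg := measurable_sintr gi.
have Bi := rintegrableD ui' gi'.
have mF : measurable_fun setT (fun p => costr u p * costr g p + sintr u p * sintr g p).
  by apply: measurable_funD; exact: measurable_funM.
have mF' : measurable_fun setT (fun p => sintr u p * costr g p - costr u p * sintr g p).
  by apply: measurable_funB; exact: measurable_funM.
have b1 p : `|costr u p * costr g p + sintr u p * sintr g p| <= spec u p + spec g p.
  exact: spec_cross_le.
have b2 p : `|sintr u p * costr g p - costr u p * sintr g p| <= spec u p + spec g p.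
  rewrite -mulrN (le_trans (spec_cross_le _ _ _ _))// sqrrN /spec.
  by rewrite [_ ^+ 2 + costr u p ^+ 2]addrC.
have Fi := rintegrable_dom mF Bi b1; have Fi' := rintegrable_dom mF' Bi b2.
have wcvg (F : V -> R) p : (weight (k.+1%:R^-1) p * F p : R) @[k --> \oo] --> F p.
  by rewrite -[X in _ --> X]mul1r; apply: cvgMr_tmp; exact: cvg_weight1.
have wle (F : V -> R) k p : `|F p| <= spec u p + spec g p ->
    `|weight (k.+1%:R^-1) p * F p| <= spec u p + spec g p.
  move=> FB; rewrite normrM ger0_norm ?(ltW (weight_gt0 _ _))//.
  rewrite (le_trans _ FB)// ler_piMl// weight_le1// ltW// invSn_gt0.
have mw k : measurable_fun setT (@weight R n k.+1%:R^-1) by exact: measurable_weight.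
split => //.
- have L := Rintegral_dominated (fun k => measurable_funM (mw k) mF) mF Bi
    (aeW _ (wcvg _)) (fun k p => wle _ k p (b1 p)).
  have L' : \int[leb]_p (weight k.+1%:R^-1 p *
      (costr u p * costr g p + sintr u p * sintr g p)) @[k --> \oo] -->
      mass * \int[leb]_x (u x * g x).
    pose M := (mass * \int[leb]_x u x ^+ 2 + A) / 2.
    apply/cvgrPdist_le => /= d d0.
    (* smooth_sub_le with l := sqrt e balances its two terms *)
    have : (Num.sqrt (k.+1%:R^-1) * M : R) @[k --> \oo] --> (0 : R).
      by rewrite -[X in _ --> X](mul0r M); apply: cvgMr_tmp; exact: cvg_sqrt_harmonic.
    move=> /cvgrPdist_le /(_ _ d0); apply: filterS => k; rewrite sub0r normrN.
    move=> /(le_trans (ler_norm _)); apply: le_trans.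
    rewrite distrC (weighted_parseval (invSn_gt0 k) ui gi).1.
    have s0 : 0 < Num.sqrt (k.+1%:R^-1) :> R by rewrite sqrtr_gt0 invSn_gt0.
    have tg : tame A g by split.
    apply: (le_trans (smooth_sub_le (invSn_gt0 k) s0 mu ui u2i tg)).
    rewrite -[X in X * A / _]sqr_sqrtr ?(ltW (invSn_gt0 k))//.
    by rewrite le_eqVlt; apply/orP; left; apply/eqP; rewrite /M; field; rewrite gt_eqF.
  exact: (cvg_unique _ L L').
- have L := Rintegral_dominated (fun k => measurable_funM (mw k) mF') mF' Bi
    (aeW _ (wcvg _)) (fun k p => wle _ k p (b2 p)).
  have L' : \int[leb]_p (weight k.+1%:R^-1 p *
      (sintr u p * costr g p - costr u p * sintr g p)) @[k --> \oo] --> (0 : R).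
    under eq_cvg do rewrite (weighted_parseval (invSn_gt0 _) ui gi).2.
    exact: cvg_cst.
  exact: (cvg_unique _ L L').
Qed.

(** The real part of the inner product of [a + i b] with the unnormalized
    transform of the real function [g]; the imaginary part is [pairing b (- a) g]. *)
Definition pairing a b g : R := \int[leb]_p (a p * costr g p - b p * sintr g p).

(** Cauchy-Schwarz in the additive form; the freedom in [rho] accounts for all
    the uses, from plain L^2 to the dual pair of weights 1/E and E. *)
Lemma pairing_le rho a b g : measurable_fun setT a -> measurable_fun setT b ->
  rintegrable leb g -> (forall p, 0 < rho p) ->
  rintegrable leb (fun p => rho p * (a p ^+ 2 + b p ^+ 2)) ->
  rintegrable leb (fun p => spec g p / rho p) ->
  rintegrable leb (fun p => a p * costr g p - b p * sintr g p) /\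
  `|pairing a b g| <= (\int[leb]_p (rho p * (a p ^+ 2 + b p ^+ 2)) +
     \int[leb]_p (spec g p / rho p)) / 2.
Proof.
move=> ma mb gi r0 i1 i2.
have mF : measurable_fun setT (fun p => a p * costr g p - b p * sintr g p).
  by apply: measurable_funB; apply: measurable_funM => //;
    [exact: measurable_costr|exact: measurable_sintr].
have i3 := rintegrableZr 2^-1 (rintegrableD i1 i2).
have Fle p : `|a p * costr g p - b p * sintr g p| <=
    (rho p * (a p ^+ 2 + b p ^+ 2) + spec g p / rho p) / 2.
  rewrite (le_trans (ler_normB _ _))//.
  have := young_abs (a p) (costr g p) (r0 p).
  have := young_abs (b p) (sintr g p) (r0 p).
  by rewrite /spec; move: `|_ * costr g p| `|_ * sintr g p| => s t; lra.
split; first exact: (rintegrable_dom mF i3 Fle).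
rewrite -RintegralD// -RintegralZr//; last exact: rintegrableD.
exact: le_Rintegral_dom.
Qed.

End parseval.

(** * The norms of L^2 and of the weighted space *)

Section pairing_spaces.
Context {R : realType} {n : nat}.
Local Notation V := 'rV[R]_n.
Local Notation leb := (lebesgue_rV R n).
Local Notation mass := (mass R n).
Local Notation Re := (@complex.Re R).
Local Notation Im := (@complex.Im R).
Implicit Types (a b u g rho om : V -> R) (p x y : V) (e A m : R).
Implicit Types (f phi psi chi : V -> R[i]) (S : set V).

Definition msq f x : R := Re (f x) ^+ 2 + Im (f x) ^+ 2.

Lemma msq_ge0 f x : 0 <= msq f x.
Proof. by rewrite addr_ge0 ?sqr_ge0. Qed.

Lemma sqr_normc_msq f x : ComplexField.Normc.normc (f x) ^+ 2 = msq f x.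
Proof.
rewrite /msq; case: (f x) => s t /=.
by rewrite sqr_sqrtr// addr_ge0 ?sqr_ge0.
Qed.

Lemma measurable_msq f : cmeasurable f -> measurable_fun setT (msq f).
Proof. by move=> [mr mi]; apply: measurable_funD; exact: measurable_funX. Qed.

Lemma root_lt (I : \bar R) e : (0 <= I)%E -> 0 < e ->
  (I `^ 2^-1 < e%:E -> I <= (e ^+ 2)%:E)%E.
Proof.
move=> I0 e0; case: I I0 => [r| |]//=; last by rewrite gt_eqF ?invr_gt0.
rewrite !lee_fin lte_fin => r0; rewrite powR12_sqrt// => re.
by rewrite -(sqr_sqrtr r0) lerXn2r ?nnegrE ?sqrtr_ge0 ?ltW.
Qed.

Lemma L2normE f : L2norm f = ((\int[leb]_x (msq f x)%:E) `^ 2^-1)%E.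
Proof.
rewrite /L2norm unlock; congr poweR; apply: eq_integral => x _ /=.
rewrite ger0_norm; last by case: (f x) => s t; exact: sqrtr_ge0.
by rewrite powR_mulrn ?sqr_normc_msq//; case: (f x) => s t; exact: sqrtr_ge0.
Qed.

Lemma rnormE m f : rnorm m f = ((\int[leb]_p ((energy m p)^-1 * msq f p)%:E) `^ 2^-1)%E.
Proof.
rewrite /rnorm; congr poweR; apply: eq_integral => p _.
by rewrite sqr_normc_msq mulrC.
Qed.

Lemma L2norm_lt f e : cmeasurable f -> 0 < e -> (L2norm f < e%:E)%E ->
  rintegrable leb (msq f) /\ \int[leb]_x msq f x <= e ^+ 2.
Proof.
move=> mf e0; rewrite L2normE => /root_lt H.
apply: ge0_rintegrable_le; [exact: measurable_msq|exact: msq_ge0|apply: H => //].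
by apply: integral_ge0 => x _; rewrite lee_fin msq_ge0.
Qed.

Lemma L2_msq f : L2 f -> rintegrable leb (msq f).
Proof.
move=> [mf]; rewrite L2normE => /lty_poweRy H.
apply/ge0_rintegrableP; [exact: measurable_msq|exact: msq_ge0|apply: H].
by rewrite invr_eq0.
Qed.

Lemma measurable_energy m : measurable_fun setT (@energy R n m).
Proof.
apply: (measurableT_comp (f := @Num.sqrt R)).
  by apply: continuous_measurable_fun; exact: sqrt_continuous.
apply: measurable_funD => //.
apply: (@measurable_sum _ _ _ _ _ (index_enum 'I_n) (fun i (p : V) => p ord0 i * p ord0 i)) => i.
by apply: measurable_funM; exact: measurable_coord.
Qed.

Lemma dot_ge0 p : 0 <= dot p p.
Proof. by apply: sumr_ge0 => i _; rewrite -expr2 sqr_ge0. Qed.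

Lemma energy_gt0 m p : 0 < m -> 0 < energy m p.
Proof. by move=> m0; rewrite sqrtr_gt0 ltr_wpDl ?dot_ge0// exprn_gt0. Qed.

Lemma measurable_energyV m : 0 < m ->
  measurable_fun setT (fun p : V => (energy m p)^-1).
Proof.
move=> m0; rewrite (_ : (fun p => _) = fun p => expR (- ln (energy m p))).
  apply: measurableT_comp => //; apply: measurableT_comp => //.
  exact: measurableT_comp (@measurable_ln R) (@measurable_energy m).
by apply/funext => p; rewrite expRN lnK// posrE energy_gt0.
Qed.

Lemma dot_le_l1 p : dot p p <= l1 p ^+ 2.
Proof.
rewrite expr2 {1}/l1 mulr_suml; apply: ler_sum => i _.
rewrite -expr2 -(real_normK (num_real _)) expr2 ler_wpM2l//.
by rewrite /l1 (bigD1 i)//= lerDl sumr_ge0.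
Qed.

Lemma energy_le_l1 m p : 0 < m -> energy m p <= m + l1 p.
Proof.
move=> m0; have s0 : 0 <= m + l1 p by rewrite addr_ge0 ?l1_ge0 ?ltW.
rewrite -(ger0_norm s0) -sqrtr_sqr ler_sqrt ?sqr_ge0// sqrrD addrC.
by rewrite -addrA lerD2l (le_trans (dot_le_l1 p))// lerDr mulrn_wge0// mulr_ge0 ?l1_ge0 ?ltW.
Qed.

Lemma rnorm_lt m f e : 0 < m -> cmeasurable f -> 0 < e -> (rnorm m f < e%:E)%E ->
  rintegrable leb (fun p => (energy m p)^-1 * msq f p) /\
  \int[leb]_p ((energy m p)^-1 * msq f p) <= e ^+ 2.
Proof.
move=> m0 mf e0; rewrite rnormE => /root_lt H.
have pos p : 0 <= (energy m p)^-1 * msq f p.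
  by rewrite mulr_ge0 ?msq_ge0// invr_ge0 ltW ?energy_gt0.
apply: ge0_rintegrable_le => //; last first.
  by apply: H => //; apply: integral_ge0 => x _; rewrite lee_fin.
apply: measurable_funM; last exact: measurable_msq.
exact: measurable_energyV.
Qed.

Lemma L2r_msq m f : 0 < m -> L2r m f ->
  rintegrable leb (fun p => (energy m p)^-1 * msq f p).
Proof.
move=> m0 [mf]; rewrite rnormE => /lty_poweRy H.
apply/ge0_rintegrableP.
- apply: measurable_funM; last exact: measurable_msq.
  exact: measurable_energyV.
- by move=> p; rewrite mulr_ge0 ?msq_ge0// invr_ge0 ltW ?energy_gt0.
- by apply: H; rewrite invr_eq0.
Qed.

(** Tame functions have transforms in the dual of [L2r], where the weight is the
    energy instead of its inverse. *)
Lemma rintegrable_energy_spec m A g : 0 < m -> tame A g ->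
  rintegrable leb (fun p => energy m p * spec g p) /\
  \int[leb]_p (energy m p * spec g p) <=
  m * (mass * \int[leb]_x g x ^+ 2) + A / 2.
Proof.
move=> m0 [gi g2i gA].
have [si sE] := bessel gi g2i; have [li lE] := energy_le gi g2i gA.
have di := rintegrableD (rintegrableZl m si) li.
have mE := @measurable_energy m; have ms := measurable_spec gi.
have le p : energy m p * spec g p <= m * spec g p + l1 p * spec g p.
  by rewrite -mulrDl ler_wpM2r ?spec_ge0// energy_le_l1.
have Ei : rintegrable leb (fun p => energy m p * spec g p).
  apply: (rintegrable_dom _ di); first exact: measurable_funM.
  by move=> p; rewrite ger0_norm// mulr_ge0 ?spec_ge0// ltW// energy_gt0.
split => //; apply: (le_trans (le_Rintegral measurableT Ei di (fun p _ => le p))).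
by rewrite RintegralD ?RintegralZl//; [rewrite lerD// ler_pM2l|exact: rintegrableZl].
Qed.

Lemma eq0_small (P Y : R) : (forall e, 0 < e -> `|P| <= e * Y) -> P = 0.
Proof.
move=> H; apply/eqP; rewrite -normr_le0; apply/ler_addgt0Pr => d d0; rewrite add0r.
have Y1 : 0 < `|Y| + 1 by rewrite ltr_wpDl.
apply: (le_trans (H (d / (`|Y| + 1)) (divr_gt0 d0 Y1))).
rewrite mulrAC ler_pdivrMr// ler_pM2l// (le_trans (ler_norm _))// lerDl//.
Qed.

(** [pairing_le] with the weight [om / e] gives a modulus of continuity linear
    in the distance [e]. *)
Lemma pairing_close om a b a' b' g e : 0 < e ->
  measurable_fun setT a -> measurable_fun setT b ->
  measurable_fun setT a' -> measurable_fun setT b' ->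
  rintegrable leb g -> (forall p, 0 < om p) ->
  rintegrable leb (fun p => spec g p / om p) ->
  rintegrable leb (fun p => om p * (a' p ^+ 2 + b' p ^+ 2)) ->
  rintegrable leb (fun p => om p * ((a p - a' p) ^+ 2 + (b p - b' p) ^+ 2)) ->
  \int[leb]_p (om p * ((a p - a' p) ^+ 2 + (b p - b' p) ^+ 2)) <= e ^+ 2 ->
  `|pairing a b g - pairing a' b' g| <= e * ((1 + \int[leb]_p (spec g p / om p)) / 2).
Proof.
move=> e0 ma mb ma' mb' gi om0 si i' id de.
have [j' _] := pairing_le ma' mb' gi om0 i' si.
have E : (fun p => e * (spec g p / om p)) = (fun p => spec g p / (e^-1 * om p)).
  by apply/funext => p; rewrite invfM invrK mulrCA.
have E2 : (fun p => e^-1 * (om p * ((a p - a' p) ^+ 2 + (b p - b' p) ^+ 2))) =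
    (fun p => e^-1 * om p * ((a p - a' p) ^+ 2 + (b p - b' p) ^+ 2)).
  by apply/funext => p; rewrite mulrA.
have e1 : 0 < e^-1 by rewrite invr_gt0.
have [jd jE] := @pairing_le _ _ (fun p => e^-1 * om p) (fun p => a p - a' p)
  (fun p => b p - b' p) g (measurable_funB ma ma') (measurable_funB mb mb') gi
  (fun p => mulr_gt0 e1 (om0 p))
  ltac:(by rewrite -E2; exact: rintegrableZl) ltac:(by rewrite -E; exact: rintegrableZl).
have -> : pairing a b g - pairing a' b' g = pairing (fun p => a p - a' p) (fun p => b p - b' p) g.
  apply/eqP; rewrite subr_eq /pairing -RintegralD//; apply/eqP.
  by apply: eq_Rintegral => p _; ring.
apply: (le_trans jE); rewrite mulrA ler_pM2r//.
by rewrite -E -E2 !RintegralZl// mulrDr mulr1 lerD2r ler_pdivrMl// -expr2.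
Qed.

Lemma Rintegral_mul_close u u' g e : 0 < e ->
  measurable_fun setT u -> measurable_fun setT u' -> measurable_fun setT g ->
  rintegrable leb (fun x => g x ^+ 2) ->
  rintegrable leb (fun x => (u x - u' x) ^+ 2) ->
  \int[leb]_x (u x - u' x) ^+ 2 <= e ^+ 2 ->
  {ae leb, forall x, u' x * g x = 0} ->
  `|\int[leb]_x (u x * g x)| <= e * ((1 + \int[leb]_x g x ^+ 2) / 2).
Proof.
move=> e0 mu mu' mg g2 d2 de ug.
have md := measurable_funB mu mu'.
have di := rintegrableM_sqr md mg d2 g2.
have -> : \int[leb]_x (u x * g x) = \int[leb]_x ((u x - u' x) * g x).
  rewrite /Rintegral; congr fine; apply: ae_eq_integral => //.
  - by apply/measurable_EFinP; exact: measurable_funM.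
  - by apply/measurable_EFinP; exact: measurable_funM.
  - by apply: filterS ug => x /= H _; rewrite mulrBl H subr0.
have bi := rintegrableZr 2^-1 (rintegrableD (rintegrableZl e^-1 d2) (rintegrableZl e g2)).
apply: (@le_trans _ _ (\int[leb]_x ((e^-1 * (u x - u' x) ^+ 2 + e * g x ^+ 2) / 2))).
  apply: le_Rintegral_dom => //; first exact: measurable_funM.
  move=> x; have e1 : 0 < e^-1 by rewrite invr_gt0.
  by rewrite (le_trans (young_abs _ _ e1))// invrK [g x ^+ 2 * e]mulrC.
rewrite RintegralZr//; last by apply: rintegrableD; exact: rintegrableZl.
rewrite RintegralD//; [|exact: rintegrableZl|exact: rintegrableZl].
by rewrite !RintegralZl// mulrA ler_pM2r// mulrDr mulr1 lerD2r ler_pdivrMl// -expr2.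
Qed.

End pairing_spaces.

(** * Spectral subspaces are orthogonal to functions off their support *)

Section pairing_vanishes.
Context {R : realType} {n : nat}.
Local Notation V := 'rV[R]_n.
Local Notation leb := (lebesgue_rV R n).
Local Notation mass := (mass R n).
Local Notation Re := (@complex.Re R).
Local Notation Im := (@complex.Im R).
Implicit Types (a b u g : V -> R) (p x y : V) (e A m : R).
Implicit Types (f phi psi chi : V -> R[i]) (S : set V).

Definition fnorm : R := (2 * pi) `^ (- (n%:R / 2)).

Let ReB (z w : R[i]) : Re (z - w) = Re z - Re w.
Proof. by case: z; case: w. Qed.

Let ImB (z w : R[i]) : Im (z - w) = Im z - Im w.
Proof. by case: z; case: w. Qed.

Lemma Re_fourier_L1 f p : cintegrable f ->
  Re (fourier_L1 f p) = fnorm * (costr (Re \o f) p + sintr (Im \o f) p).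
Proof.
move=> [ri ii]; rewrite /fourier_L1 /cintegral /= !mul0r subr0; congr (_ * _).
rewrite -RintegralD//; [|exact: rintegrable_cosM|exact: rintegrable_sinM].
apply: eq_Rintegral => x _ /=; case: (f x) => s t /=.
by rewrite mulNr opprK.
Qed.

Lemma Im_fourier_L1 f p : cintegrable f ->
  Im (fourier_L1 f p) = fnorm * (costr (Im \o f) p - sintr (Re \o f) p).
Proof.
move=> [ri ii]; rewrite /fourier_L1 /cintegral /= !mul0r addr0; congr (_ * _).
rewrite -RintegralB//; [|exact: rintegrable_cosM|exact: rintegrable_sinM].
apply: eq_Rintegral => x _ /=; case: (f x) => s t /=.
by rewrite mulNr.
Qed.

Lemma cmeasurableB f f' : cmeasurable f -> cmeasurable f' -> cmeasurable (f \- f').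
Proof.
move=> [m1 m2] [m1' m2']; split.
- by under eq_fun do rewrite ReB; exact: measurable_funB.
- by under eq_fun do rewrite ImB; exact: measurable_funB.
Qed.

Lemma msqB f f' x : msq (f \- f') x = (Re (f x) - Re (f' x)) ^+ 2 + (Im (f x) - Im (f' x)) ^+ 2.
Proof. by rewrite /msq ReB ImB. Qed.

Lemma rintegrable_Re2 f : cmeasurable f -> rintegrable leb (msq f) ->
  rintegrable leb (fun x => Re (f x) ^+ 2) /\ rintegrable leb (fun x => Im (f x) ^+ 2).
Proof.
move=> [mr mi] fi; split; apply: (rintegrable_dom _ fi); try exact: measurable_funX.
- by move=> x; rewrite ger0_norm ?sqr_ge0// lerDl sqr_ge0.
- by move=> x; rewrite ger0_norm ?sqr_ge0// lerDr sqr_ge0.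
Qed.

Lemma cintegrable_rintegrable f : cintegrable f ->
  rintegrable leb (Re \o f) /\ rintegrable leb (Im \o f).
Proof. by []. Qed.

Lemma cmeasurable_fourier_L1 f : cintegrable f -> cmeasurable (fourier_L1 f).
Proof.
move=> fi; have [ri ii] := cintegrable_rintegrable fi; split.
- under eq_fun do rewrite Re_fourier_L1//.
  by apply: measurable_funM => //; apply: measurable_funD;
    [exact: measurable_costr|exact: measurable_sintr].
- under eq_fun do rewrite Im_fourier_L1//.
  by apply: measurable_funM => //; apply: measurable_funB;
    [exact: measurable_costr|exact: measurable_sintr].
Qed.

Lemma pairing_fourier_L1 f g A : L2 f -> cintegrable f -> tame A g ->
  pairing (Re \o fourier_L1 f) (Im \o fourier_L1 f) g =
    fnorm * mass * \int[leb]_x (Re (f x) * g x) /\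
  pairing (Im \o fourier_L1 f) (fun p => - Re (fourier_L1 f p)) g =
    fnorm * mass * \int[leb]_x (Im (f x) * g x).
Proof.
move=> f2 fi tg; have [ri ii] := cintegrable_rintegrable fi.
have [r2 i2] := rintegrable_Re2 f2.1 (L2_msq f2).
have [r1 rE r3 rE'] := parseval ri r2 tg.
have [i1 iE i3 iE'] := parseval ii i2 tg.
have RE p : (Re \o fourier_L1 f) p = _ := Re_fourier_L1 p fi.
have IE p : (Im \o fourier_L1 f) p = _ := Im_fourier_L1 p fi.
split.
- rewrite /pairing -mulrA -[in RHS]rE -RintegralZl//.
  transitivity (\int[leb]_p (fnorm * (costr (Re \o f) p * costr g p +
      sintr (Re \o f) p * sintr g p) + fnorm * (sintr (Im \o f) p * costr g p -
      costr (Im \o f) p * sintr g p))).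
    by apply: eq_Rintegral => p _; rewrite RE IE; ring.
  rewrite RintegralD//; [|exact: rintegrableZl|exact: rintegrableZl].
  by rewrite [X in _ + X]RintegralZl// iE' mulr0 addr0.
- rewrite /pairing -mulrA -[in RHS]iE -RintegralZl//.
  transitivity (\int[leb]_p (fnorm * (costr (Im \o f) p * costr g p +
      sintr (Im \o f) p * sintr g p) - fnorm * (sintr (Re \o f) p * costr g p -
      costr (Re \o f) p * sintr g p))).
    apply: eq_Rintegral => p _; rewrite IE -[Re (fourier_L1 f p)]/((Re \o fourier_L1 f) p) RE.
    by ring.
  rewrite RintegralB//; [|exact: rintegrableZl|exact: rintegrableZl].
  by rewrite [X in _ - X]RintegralZl// rE' mulr0 subr0.
Qed.

(** By Parseval the pairing is a multiple of the integral of [psi g], and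
    [psi g] vanishes a.e. Parseval's identity is applied to the integrable
    approximants of [psi]; Cauchy-Schwarz bounds the two errors. *)
Lemma pairing_fourier0 psi chi g A S : L2_on S psi -> fourier psi chi ->
  tame A g -> (forall x, S x -> g x = 0) ->
  pairing (Re \o chi) (Im \o chi) g = 0 /\
  pairing (Im \o chi) (fun p => - Re (chi p)) g = 0.
Proof.
move=> [psi2 psi0] [_ chi2 [u [u12 uc vc]]] tg gS.
have [gi g2i gA] := tg; have [si _] := bessel gi g2i.
have mg := rintegrable_measurable _ gi.
have mpsi := psi2.1; have mchi := chi2.1.
pose Y : R := ((1 + \int[leb]_p spec g p) / 2) +
  fnorm * mass * ((1 + \int[leb]_x g x ^+ 2) / 2).
have si1 : rintegrable leb (fun p => spec g p / 1).
  by apply: eq_rintegrable si => p; rewrite divr1.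
have sE : \int[leb]_p (spec g p / 1) = \int[leb]_p spec g p.
  by apply: eq_Rintegral => p _; rewrite divr1.
have fn0 : 0 <= fnorm * mass by rewrite mulr_ge0 ?powR_ge0// ltW// mass_gt0.
have main e : 0 < e ->
    `|pairing (Re \o chi) (Im \o chi) g| <= e * Y /\
    `|pairing (Im \o chi) (fun p => - Re (chi p)) g| <= e * Y.
  move=> e0.
  have e0' : (0 < e%:E)%E by rewrite lte_fin.
  have small (v : nat -> \bar R) : v @ \oo --> 0%E -> \forall k \near \oo, (v k < e%:E)%E.
    by move=> vc0; exact: (vc0 _ (open_ereal_lt' e0')).
  have [k [uk vk]] : exists k, (L2norm (u k \- psi)%R < e%:E)%E /\
      (L2norm (fourier_L1 (u k) \- chi)%R < e%:E)%E.
    have := filterI (small _ uc) (small _ vc).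
    by move=> [N _ /(_ N (leqnn N))] [? ?]; exists N.
  have [uk2 uki] := u12 k.
  have mF := cmeasurable_fourier_L1 uki.
  have [dui duE] := L2norm_lt (cmeasurableB uk2.1 mpsi) e0 uk.
  have [dvi dvE] := L2norm_lt (cmeasurableB mF mchi) e0 vk.
  have [dr ds] := rintegrable_Re2 (cmeasurableB uk2.1 mpsi) dui.
  have [P1 P2] := pairing_fourier_L1 uk2 uki tg.
  have [mR mI] := mF; have [cR cI] := mchi; have [uR uI] := uk2.1; have [pR pI] := mpsi.
  have d1 : rintegrable leb (fun p => 1 * ((Re (fourier_L1 (u k) p) - Re (chi p)) ^+ 2 +
      (Im (fourier_L1 (u k) p) - Im (chi p)) ^+ 2)).
    by apply: eq_rintegrable dvi => p; rewrite mul1r msqB.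
  have d1E : \int[leb]_p (1 * ((Re (fourier_L1 (u k) p) - Re (chi p)) ^+ 2 +
      (Im (fourier_L1 (u k) p) - Im (chi p)) ^+ 2)) <= e ^+ 2.
    by apply: le_trans dvE; under eq_Rintegral do rewrite mul1r -msqB.
  have c1 : rintegrable leb (fun p => 1 * (Re (chi p) ^+ 2 + Im (chi p) ^+ 2)).
    by apply: eq_rintegrable (L2_msq chi2) => p; rewrite mul1r.
  have bound (r s t : R) : `|s - r| <= e * ((1 + \int[leb]_p spec g p) / 2) ->
      s = fnorm * mass * t -> `|t| <= e * ((1 + \int[leb]_x g x ^+ 2) / 2) -> `|r| <= e * Y.
    move=> h1 sF h2; rewrite -[r](subrK s) (le_trans (ler_normD _ _))//.
    rewrite /Y mulrDr lerD//; first by rewrite distrC.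
    by rewrite sF normrM (ger0_norm fn0) [leRHS]mulrCA ler_wpM2l.
  have close1 := @pairing_close _ _ (fun=> 1) (Re \o fourier_L1 (u k)) (Im \o fourier_L1 (u k))
    (Re \o chi) (Im \o chi) g e e0 mR mI cR cI gi (fun=> ltr01) si1 c1 d1 d1E.
  have close2 := @pairing_close _ _ (fun=> 1) (Im \o fourier_L1 (u k))
    (fun p => - Re (fourier_L1 (u k) p))
    (Im \o chi) (fun p => - Re (chi p)) g e e0 mI ltac:(exact: measurableT_comp) cI
    ltac:(exact: measurableT_comp) gi (fun=> ltr01) si1
    ltac:(by apply: eq_rintegrable c1 => p; rewrite sqrrN [X in 1 * X]addrC)
    ltac:(by apply: eq_rintegrable d1 => p /=; congr (_ * _); ring)
    ltac:(by apply: le_trans d1E; rewrite le_eqVlt; apply/orP; left; apply/eqP;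
      apply: eq_Rintegral => p _ /=; congr (_ * _); ring).
  rewrite sE in close1 close2.
  split.
  - apply: bound close1 P1 _.
    apply: (@Rintegral_mul_close _ _ _ (Re \o psi)) => //.
    + by apply: eq_rintegrable dr => x; rewrite ReB.
    + apply: le_trans duE; apply: le_Rintegral => //.
        by apply: eq_rintegrable dr => x; rewrite ReB.
      by move=> x _; rewrite msqB lerDl sqr_ge0.
    + apply: filterS psi0 => x /= H; have [/gS ->|/H ->] := pselect (S x).
        by rewrite mulr0.
      by rewrite mul0r.
  - apply: bound close2 P2 _.
    apply: (@Rintegral_mul_close _ _ _ (Im \o psi)) => //.
    + by apply: eq_rintegrable ds => x; rewrite ImB.
    + apply: le_trans duE; apply: le_Rintegral => //.
        by apply: eq_rintegrable ds => x; rewrite ImB.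
      by move=> x _; rewrite msqB lerDr sqr_ge0.
    + apply: filterS psi0 => x /= H; have [/gS ->|/H ->] := pselect (S x).
        by rewrite mulr0.
      by rewrite mul0r.
by split; apply: (@eq0_small _ _ Y) => e /main[].
Qed.

(** Finite energy of [g] is exactly what makes the pairing continuous for the
    weak norm of [L2r], so orthogonality passes to the closure. *)
Lemma Hspace_pairing0 m S phi g A : 0 < m -> Hspace m S phi -> tame A g ->
  (forall x, S x -> g x = 0) ->
  pairing (Re \o phi) (Im \o phi) g = 0 /\
  pairing (Im \o phi) (fun p => - Re (phi p)) g = 0.
Proof.
move=> m0 [phi2 phiS] tg gS.
have [gi g2i gA] := tg; have [Ei _] := rintegrable_energy_spec m0 tg.
have om0 p : 0 < (energy m p : R)^-1 by rewrite invr_gt0 energy_gt0.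
have si : rintegrable leb (fun p => spec g p / (energy m p)^-1).
  by apply: eq_rintegrable Ei => p; rewrite invrK mulrC.
pose Y := (1 + \int[leb]_p (spec g p / (energy m p)^-1)) / 2.
have main e : 0 < e ->
    `|pairing (Re \o phi) (Im \o phi) g| <= e * Y /\
    `|pairing (Im \o phi) (fun p => - Re (phi p)) g| <= e * Y.
  move=> e0; have [psi [chi [psiS Fpc d]]] := phiS e e0.
  have [P1 P2] := pairing_fourier0 psiS Fpc tg gS.
  have [_ chi2 _] := Fpc.
  have [cR cI] := chi2.1; have [pR pI] := phi2.1.
  have [di dE] := rnorm_lt m0 (cmeasurableB phi2.1 chi2.1) e0 d.
  have ci : rintegrable leb (fun p => (energy m p)^-1 * (Re (chi p) ^+ 2 + Im (chi p) ^+ 2)).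
    apply: (rintegrable_dom (g := fun p => m^-1 * msq chi p)).
    - apply: measurable_funM; first exact: measurable_energyV.
      exact: (measurable_msq chi2.1).
    - by apply: rintegrableZl; exact: L2_msq.
    - move=> p; rewrite ger0_norm; last by rewrite mulr_ge0 ?msq_ge0// ltW.
      rewrite ler_wpM2r ?msq_ge0// lef_pV2 ?posrE ?energy_gt0//.
      rewrite -{1}(gtr0_norm m0) -sqrtr_sqr ler_sqrt ?lerDr ?dot_ge0//.
      by rewrite addr_ge0 ?dot_ge0 ?sqr_ge0.
  have d1 : rintegrable leb (fun p => (energy m p)^-1 * ((Re (phi p) - Re (chi p)) ^+ 2 +
      (Im (phi p) - Im (chi p)) ^+ 2)).
    by apply: eq_rintegrable di => p; rewrite msqB.
  have d1E : \int[leb]_p ((energy m p)^-1 * ((Re (phi p) - Re (chi p)) ^+ 2 +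
      (Im (phi p) - Im (chi p)) ^+ 2)) <= e ^+ 2.
    by apply: le_trans dE; under eq_Rintegral do rewrite -msqB.
  have close1 := @pairing_close _ _ (fun p => (energy m p)^-1) (Re \o phi) (Im \o phi)
    (Re \o chi) (Im \o chi) g e e0 pR pI cR cI gi om0 si ci d1 d1E.
  have close2 := @pairing_close _ _ (fun p => (energy m p)^-1) (Im \o phi)
    (fun p => - Re (phi p))
    (Im \o chi) (fun p => - Re (chi p)) g e e0 pI ltac:(exact: measurableT_comp) cI
    ltac:(exact: measurableT_comp) gi om0 si
    ltac:(by apply: eq_rintegrable ci => p /=; congr (_ * _); ring)
    ltac:(by apply: eq_rintegrable d1 => p /=; congr (_ * _); ring)
    ltac:(by apply: le_trans d1E; rewrite le_eqVlt; apply/orP; left; apply/eqP;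
      apply: eq_Rintegral => p _ /=; congr (_ * _); ring).
  by rewrite P1 subr0 in close1; rewrite P2 subr0 in close2.
by split; apply: (@eq0_small _ _ Y) => e /main[].
Qed.

End pairing_vanishes.

(** * Lipschitz functions *)

Section lipschitz.
Context {R : realType} {n : nat}.
Local Notation V := 'rV[R]_n.
Local Notation leb := (lebesgue_rV R n).
Local Notation mass := (mass R n).
Implicit Types (a b u f g h v : V -> R) (p q x y z : V) (e A L M m : R).

Definition lip L g : Prop := forall x y, `|g x - g y| <= L * l1 (x - y).

Lemma l1N x : l1 (- x) = l1 x.
Proof. by apply: eq_bigr => i _; rewrite mxE normrN. Qed.

Lemma l1B x y : l1 (x - y) = l1 (y - x).
Proof. by rewrite -opprB l1N. Qed.

Lemma l1_triangle x y z : l1 (x - z) <= l1 (x - y) + l1 (y - z).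
Proof.
rewrite /l1 -big_split/=; apply: ler_sum => i _; rewrite !mxE.
by rewrite (le_trans _ (ler_normD _ _))// addrA subrK.
Qed.

Lemma le_coord_l1 x i : `|x ord0 i| <= l1 x.
Proof. by rewrite /l1 (bigD1 i)//= lerDl sumr_ge0. Qed.

Lemma l1_lt e x : (0 < n)%N -> (forall i, `|x ord0 i| < e) -> l1 x < n%:R * e.
Proof.
move=> n0 xe; rewrite /l1 -[n in n%:R]card_ord -sumr_const mulr_suml.
under [ltRHS]eq_bigr do rewrite mul1r.
by apply: ltr_sum => //; apply/hasP; exists (Ordinal n0); rewrite ?mem_index_enum.
Qed.

Lemma rational_dense x e : 0 < e ->
  exists q : 'rV[rat]_n, forall i, `|x ord0 i - ratr (q ord0 i)| < e.
Proof.
move=> e0.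
have H (i : 'I_n) : exists r : rat, `|x ord0 i - ratr r| < e.
  have xe : x ord0 i - e < x ord0 i + e by rewrite ltrD2l gtrN.
  have [r] := rat_in_itvoo xe; rewrite in_itv/= => /andP[r1 r2]; exists r.
  by rewrite ltr_norml; lra.
have [r rE] := choice H.
by exists (\row_i r i) => i; rewrite mxE.
Qed.

(** A Lipschitz function is a countable infimum of cones with rational apex,
    hence Borel. *)
Lemma lip_measurable L g : (0 < n)%N -> 0 <= L -> lip L g -> measurable_fun setT g.
Proof.
move=> n0 L0 gL; apply: (measurability _ (RGenInftyO.measurableE R)).
move=> _ [_ [t ->] <-]; rewrite setTI.
pose vq (q : 'rV[rat]_n) : V := map_mx ratr q.
rewrite (_ : _ @^-1` _ = \bigcup_(q : 'rV[rat]_n) [set x | g (vq q) + L * l1 (x - vq q) < t]).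
  apply: countable_bigcupT_measurable => // q.
  have mh : measurable_fun setT (fun x => g (vq q) + L * l1 (x - vq q)).
    apply: measurable_funD => //; apply: measurable_funM => //.
    apply: (@measurable_sum _ _ _ _ _ (index_enum 'I_n)
      (fun i x => `|(x - vq q) ord0 i|)) => i.
    apply: measurableT_comp => //; under eq_fun do rewrite !mxE.
    by apply: measurable_funB => //; exact: measurable_coord.
  have := mh measurableT _ (measurable_itv `]-oo, t[%R); rewrite setTI.
  by rewrite /preimage/= (_ : [set x | _] = [set x | g (vq q) + L * l1 (x - vq q) < t]);
    last by apply/seteqP; split => x /=; rewrite in_itv.
apply/seteqP; split => x /=; rewrite in_itv/=.
  move=> gt; pose e := (t - g x) / (2 * n%:R * (L + 1)).
  have D0 : 0 < 2 * n%:R * (L + 1) by rewrite !mulr_gt0 ?ltr0n// ltr_wpDl.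
  have e0 : 0 < e by rewrite divr_gt0// subr_gt0.
  have [q qx] := rational_dense x e0; exists q => //=.
  have lq : l1 (x - vq q) < n%:R * e by apply: l1_lt => // i; rewrite !mxE.
  have := gL (vq q) x; rewrite l1B => /(le_trans (ler_norm _)); rewrite lerBlDr => gq.
  rewrite (le_lt_trans (lerD gq (lexx _)))//.
  have : 2 * (L + 1) * l1 (x - vq q) < t - g x.
    rewrite (lt_le_trans (y := 2 * (L + 1) * (n%:R * e)))//.
      by rewrite ltr_pM2l// mulr_gt0// ltr_wpDl.
    rewrite le_eqVlt /e; apply/orP; left; apply/eqP; field.
    by rewrite pnatr_eq0 -lt0n n0 gt_eqF// ltr_wpDl.
  have := l1_ge0 (x - vq q); move: (l1 _) => s s0; nra.
move=> [q _] /=; apply: le_lt_trans.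
by have := gL x (vq q) => /(le_trans (ler_norm _)); rewrite lerBlDr addrC.
Qed.

Lemma lipM L L' M M' f g : lip L f -> lip L' g ->
  (forall x, `|f x| <= M) -> (forall x, `|g x| <= M') ->
  lip (L * M' + M * L') (fun x => f x * g x).
Proof.
move=> fL gL fM gM x y.
rewrite (_ : _ - _ = (f x - f y) * g x + f y * (g x - g y)); last by ring.
rewrite (le_trans (ler_normD _ _))// !normrM mulrDl lerD//.
  rewrite mulrAC; apply: ler_pM => //.
by rewrite -mulrA; apply: ler_pM.
Qed.

Lemma l1_coord z : (0 < n)%N -> exists i, l1 z <= n%:R * `|z ord0 i|.
Proof.
move=> n0; apply: contrapT => /forallNP H.
have n1 : 0 < n%:R :> R by rewrite ltr0n.
have [|z0] := eqVneq (l1 z) 0.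
  by move=> z0; apply: (H (Ordinal n0)); rewrite z0 mulr_ge0.
have : l1 z < n%:R * (l1 z / n%:R).
  apply: l1_lt => // i; rewrite ltr_pdivlMr// mulrC ltNge.
  by apply/negP; exact: H.
by rewrite mulrCA divff ?mulr1 ?ltxx// gt_eqF.
Qed.

(** Some coordinate of [z] carries the fraction 1 / n of [l1 z]. *)
Lemma sqr_le_sum_min (D M L : R) z : (0 < n)%N -> 0 <= L -> 0 <= D ->
  D <= M -> D <= L * l1 z ->
  D ^+ 2 <= \sum_(i < n) Num.min (M ^+ 2) ((n%:R * L) ^+ 2 * z ord0 i ^+ 2).
Proof.
move=> n0 L0 D0 DM DL; have [i iz] := l1_coord z n0.
have M0 : 0 <= M by exact: le_trans DM.
rewrite (bigD1 i)//= -[leLHS]addr0 lerD//.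
  rewrite le_min lerXn2r//= -(real_normK (num_real (z ord0 i))) -exprMn lerXn2r ?nnegrE//.
    by rewrite !mulr_ge0.
  by rewrite (le_trans DL)// -mulrA mulrCA ler_wpM2l.
apply: sumr_ge0 => j _; rewrite le_min sqr_ge0/= -exprMn; exact: sqr_ge0.
Qed.

Lemma rintegrable_indic_fin (N : set V) : measurable N -> (leb N < +oo)%E ->
  rintegrable leb (\1_N : V -> R) /\ \int[leb]_x (\1_N x : R) = fine (leb N).
Proof.
move=> mN Nfin.
have E : (\int[leb]_x ((\1_N x : R))%:E = leb N)%E by rewrite integral_indic// setIT.
split; last by rewrite /Rintegral E.
apply/ge0_rintegrableP => //; by rewrite E.
Qed.

(** The energy of a bounded Lipschitz function is at most a multiple of its sup
    norm times its Lipschitz constant times the volume of its support: it stays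
    bounded for a transition layer of width d and slope 1/d. *)
Lemma lip_tame L M (N : set V) g : (0 < n)%N -> 0 < L -> 0 < M -> lip L g ->
  (forall x, `|g x| <= M) -> measurable N -> (leb N < +oo)%E ->
  (forall x, ~ N x -> g x = 0) ->
  tame (4 * n%:R * (2 * M) * (n%:R * L) * mass * fine (leb N)) g /\
  \int[leb]_x g x ^+ 2 <= M ^+ 2 * fine (leb N).
Proof.
move=> n0 L0 M0 gL gM mN Nfin gN.
have mg := lip_measurable n0 (ltW L0) gL.
have [Ni NE] := rintegrable_indic_fin mN Nfin.
have le1 x : `|g x| <= M * \1_N x.
  rewrite indicE; have [xN|xN] := pselect (N x); first by rewrite mem_set ?mulr1.
  by rewrite memNset// gN// normr0 mulr0.
have le2 x : `|g x ^+ 2| <= M ^+ 2 * \1_N x.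
  rewrite ger0_norm ?sqr_ge0// -(real_normK (num_real (g x))).
  rewrite (le_trans (y := (M * \1_N x) ^+ 2))// ?lerXn2r ?nnegrE//.
    exact: le_trans (le1 x).
  by rewrite exprMn ler_wpM2l ?sqr_ge0// indicE; case: (x \in N); rewrite ?expr1n ?expr0n.
have gi : rintegrable leb g by exact: rintegrable_dom mg (rintegrableZl M Ni) le1.
have g2i : rintegrable leb (fun x => g x ^+ 2).
  exact: rintegrable_dom (measurable_funX _ mg) (rintegrableZl (M ^+ 2) Ni) le2.
split; last first.
  rewrite -NE -RintegralZl//; apply: le_Rintegral => //; first exact: rintegrableZl.
  by move=> x _; rewrite (le_trans (ler_norm _))// le2.
split => //; rewrite -NE; apply: gagliardo_le => //.
- by rewrite mulr_gt0.
- by rewrite mulr_gt0// ltr0n.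
move=> x y; have [xN|xN] := pselect (N x); last have [yN|yN] := pselect (N y).
- rewrite -[leLHS]mul1r ler_pM//; [exact: sqr_ge0|by rewrite indicE mem_set// lerDl|].
  rewrite -(real_normK (num_real (g x - g y))).
  have := @sqr_le_sum_min `|g x - g y| (2 * M) L (x - y) n0 (ltW L0) (normr_ge0 _).
  under eq_bigr do rewrite !mxE; apply => //.
  by rewrite (le_trans (ler_normB _ _))// mulr_natl mulr2n lerD.
- rewrite -[leLHS]mul1r ler_pM//; [exact: sqr_ge0|by rewrite addrC indicE mem_set// lerDl|].
  rewrite -(real_normK (num_real (g x - g y))).
  have := @sqr_le_sum_min `|g x - g y| (2 * M) L (x - y) n0 (ltW L0) (normr_ge0 _).
  under eq_bigr do rewrite !mxE; apply => //.
  by rewrite (le_trans (ler_normB _ _))// mulr_natl mulr2n lerD.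
- rewrite gN// gN// subrr expr0n/= mulr_ge0// ?addr_ge0//.
  apply: sumr_ge0 => j _; rewrite le_min sqr_ge0/= -exprMn; exact: sqr_ge0.
Qed.

End lipschitz.

(** * Weak limits of bounded energy *)

Section pairing_limit.
Context {R : realType} {n : nat}.
Local Notation V := 'rV[R]_n.
Local Notation leb := (lebesgue_rV R n).
Local Notation mass := (mass R n).
Implicit Types (a b f g h : V -> R) (p x : V) (A m : R).

Lemma costrB f g p : rintegrable leb f -> rintegrable leb g ->
  costr (fun x => f x - g x) p = costr f p - costr g p.
Proof.
move=> fi gi; rewrite /costr -RintegralB//; try exact: rintegrable_cosM.
by apply: eq_Rintegral => x _; rewrite mulrBr.
Qed.

Lemma sintrB f g p : rintegrable leb f -> rintegrable leb g ->
  sintr (fun x => f x - g x) p = sintr f p - sintr g p.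
Proof.
move=> fi gi; rewrite /sintr -RintegralB//; try exact: rintegrable_sinM.
by apply: eq_Rintegral => x _; rewrite mulrBr.
Qed.

Lemma pairing_integrable m A a b g : 0 < m -> measurable_fun setT a ->
  measurable_fun setT b ->
  rintegrable leb (fun p => (energy m p)^-1 * (a p ^+ 2 + b p ^+ 2)) -> tame A g ->
  rintegrable leb (fun p => a p * costr g p - b p * sintr g p).
Proof.
move=> m0 ma mb abi tg; have [gi _ _] := tg.
have [Ei _] := rintegrable_energy_spec m0 tg.
have H := pairing_le ma mb gi (rho := fun p => (energy m p)^-1) _ abi _.
apply: (H _ _).1.
- by move=> p; rewrite invr_gt0 energy_gt0.
- by apply: eq_rintegrable Ei => p; rewrite invrK mulrC.
Qed.

Lemma pairingB m A A' a b f g : 0 < m -> measurable_fun setT a ->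
  measurable_fun setT b ->
  rintegrable leb (fun p => (energy m p)^-1 * (a p ^+ 2 + b p ^+ 2)) ->
  rintegrable leb f -> tame A (fun x => f x - g x) -> tame A' g ->
  pairing a b f = pairing a b (fun x => f x - g x) + pairing a b g.
Proof.
move=> m0 ma mb abi fi th tg; have [gi _ _] := tg.
rewrite /pairing -RintegralD//; last 2 first.
- exact: (pairing_integrable m0 ma mb abi th).
- exact: (pairing_integrable m0 ma mb abi tg).
by apply: eq_Rintegral => p _; rewrite costrB// sintrB//; ring.
Qed.

Lemma tail_small (w h : V -> R) e : measurable_fun setT w -> rintegrable leb h ->
  (forall p, 0 <= h p) -> 0 < e ->
  exists N : nat, rintegrable leb (fun p => \1_[set p | N%:R < w p] p * h p) /\
    \int[leb]_p (\1_[set p | N%:R < w p] p * h p) <= e.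
Proof.
move=> mw hi h0 e0; have mh := rintegrable_measurable _ hi.
have mA (N : nat) : measurable [set p | N%:R < w p].
  have := mw measurableT _ (measurable_itv `]N%:R, +oo[%R); rewrite setTI.
  by rewrite /preimage/= (_ : [set x | _] = [set p | N%:R < w p])//;
    apply/seteqP; split => x /=; rewrite in_itv/= andbT.
have m1 (N : nat) : measurable_fun setT (fun p => \1_[set p | N%:R < w p] p * h p).
  by apply: measurable_funM => //; exact: measurable_indic.
have le1 (N : nat) p : `|\1_[set p | N%:R < w p] p * h p| <= h p.
  by rewrite normrM (ger0_norm (h0 p)) ler_piMl// ger0_norm// indicE; case: (_ \in _).
have ptw p : (\1_[set p | N%:R < w p] p * h p : R) @[N --> \oo] --> (0 : R).
  apply: cvg_near_cst; exists (Num.bound `|w p|) => // N /= NN.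
  rewrite indicE memNset ?mul0r//= => /lt_geF; rewrite ltW//.
  rewrite (le_lt_trans (ler_norm _))// (lt_le_trans (archi_boundP (normr_ge0 _)))//.
  by rewrite ler_nat.
have := Rintegral_dominated m1 (@measurable_cst _ _ _ _ setT (0 : R)) hi (aeW _ ptw) le1.
rewrite Rintegral_cst// mul0r => /cvgr_lt /(_ _ e0) [N _ /(_ N (leqnn N)) /= Ne].
by exists N; split; [exact: rintegrable_dom (m1 N) hi (le1 N)|exact: ltW].
Qed.

(** Weak continuity: an L^2-convergent sequence with bounded energy may be
    passed to the limit, although it need not converge in energy. High
    frequencies are controlled by the energy and low ones by the L^2 norm. *)
Lemma pairing_limit m A a b f : 0 < m -> measurable_fun setT a ->
  measurable_fun setT b ->
  rintegrable leb (fun p => (energy m p)^-1 * (a p ^+ 2 + b p ^+ 2)) ->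
  rintegrable leb f ->
  (forall d : R, 0 < d -> exists A' g, [/\ tame A' g, tame A (fun x => f x - g x),
     \int[leb]_x (f x - g x) ^+ 2 <= d & pairing a b g = 0]) ->
  pairing a b f = 0.
Proof.
move=> m0 ma mb abi fi H.
pose X := \int[leb]_p ((energy m p)^-1 * (a p ^+ 2 + b p ^+ 2)).
pose B := m * mass + A / 2.
have E0 p : 0 < (energy m p : R) by exact: energy_gt0.
have pos p : 0 <= (energy m p)^-1 * (a p ^+ 2 + b p ^+ 2).
  by rewrite mulr_ge0 ?invr_ge0 ?(ltW (E0 p))// addr_ge0 ?sqr_ge0.
have X0 : 0 <= X by exact: Rintegral_ge0.
apply: (@eq0_small _ _ ((X + 1 + `|B| + 1) / 2)) => e e0.
(* [N] is chosen such that [a + i b] carries at most [e ^+ 2] beyond energy [N] *)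
have [N [Ti TE]] := tail_small (@measurable_energy R n m) abi pos (mulr_gt0 e0 e0).
pose hi p : R := \1_[set p | N%:R < energy m p] p.
have mhi : measurable_fun setT hi.
  apply: measurable_indic.
  have := @measurable_energy R n m measurableT _ (measurable_itv `]N%:R, +oo[%R); rewrite setTI.
  by rewrite /preimage/= (_ : [set x | _] = [set p | N%:R < energy m p])//;
    apply/seteqP; split => x /=; rewrite in_itv/= andbT.
pose d := Num.min 1 (e ^+ 2 / (N.+1%:R * mass)).
have M0 : 0 < mass by exact: mass_gt0.
have d0 : 0 < d by rewrite lt_min ltr01/= divr_gt0 ?exprn_gt0 ?mulr_gt0.
have [A' [g [tg th hd Pg]]] := H d d0.
rewrite (pairingB m0 ma mb abi fi th tg) Pg addr0.
have [hi' h2i hA] := th; have [si sE] := bessel hi' h2i.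
have [esi esE] := rintegrable_energy_spec m0 th.
set h := fun x => f x - g x in th hi' h2i hA si sE esi esE *.
(* relative to 1/E, weight about [e] on low frequencies and [e^-1] on high ones *)
pose rho p := (e + e^-1 * hi p) * (energy m p)^-1.
have r0 p : 0 < rho p.
  by rewrite mulr_gt0 ?invr_gt0// ltr_pwDl// mulr_ge0 ?invr_ge0 ?(ltW e0).
have i1 : rintegrable leb (fun p => e * ((energy m p)^-1 * (a p ^+ 2 + b p ^+ 2)) +
    e^-1 * (hi p * ((energy m p)^-1 * (a p ^+ 2 + b p ^+ 2)))).
  by apply: rintegrableD; exact: rintegrableZl.
have i1' : rintegrable leb (fun p => rho p * (a p ^+ 2 + b p ^+ 2)).
  by apply: eq_rintegrable i1 => p; rewrite /rho; ring.
have i2 : rintegrable leb (fun p => N%:R / e * spec h p + e * (energy m p * spec h p)).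
  by apply: rintegrableD; exact: rintegrableZl.
have rhoV p : (rho p)^-1 = energy m p * (e^-1 + ((e + e^-1)^-1 - e^-1) * hi p).
  rewrite /rho invfM invrK mulrC; congr (_ * _); rewrite /hi indicE.
  by case: (p \in _); rewrite !(mulr1, mulr0, addr0)// [RHS]addrC subrK.
have le2 p : `|spec h p / rho p| <= N%:R / e * spec h p + e * (energy m p * spec h p).
  have sr : 0 <= spec h p / rho p by rewrite divr_ge0 ?spec_ge0// ltW.
  rewrite (ger0_norm sr) rhoV.
  rewrite [leRHS](_ : _ = spec h p * (N%:R / e + e * energy m p)); last by ring.
  rewrite ler_wpM2l ?spec_ge0// /hi.
  have [pN|pN] := pselect (N%:R < energy m p).
    rewrite indicE mem_set//= mulr1 [X in _ * X <= _]addrC subrK ler_wpDl ?divr_ge0 ?(ltW e0)//.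
    rewrite mulrC ler_pM2r// -[leRHS]invrK lef_pV2 ?posrE ?addr_gt0 ?invr_gt0//.
    by rewrite lerDr ltW.
  rewrite indicE memNset// mulr0 addr0 ler_wpDr ?mulr_ge0 ?(ltW e0) ?(ltW (E0 p))//.
  by rewrite ler_pM2r ?invr_gt0// leNgt; exact/negP.
have i2' : rintegrable leb (fun p => spec h p / rho p).
  apply: (rintegrable_dom _ i2 le2); apply: measurable_funM; first exact: measurable_spec.
  under eq_fun do rewrite rhoV; apply: measurable_funM; first exact: measurable_energy.
  by apply: measurable_funD => //; exact: measurable_funM.
have [_ P] := pairing_le ma mb hi' r0 i1' i2'.
apply: (le_trans P); rewrite mulrA ler_pM2r//.
have b1 : \int[leb]_p (rho p * (a p ^+ 2 + b p ^+ 2)) <= e * (X + 1).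
  rewrite [leLHS](_ : _ = \int[leb]_p (e * ((energy m p)^-1 * (a p ^+ 2 + b p ^+ 2)) +
    e^-1 * (hi p * ((energy m p)^-1 * (a p ^+ 2 + b p ^+ 2))))); last first.
    by apply: eq_Rintegral => p _; rewrite /rho; ring.
  rewrite RintegralD//; [|exact: rintegrableZl|exact: rintegrableZl].
  by rewrite !RintegralZl// mulrDr lerD2l mulr1 ler_pdivrMl.
have b2 : \int[leb]_p (spec h p / rho p) <= e * (`|B| + 1).
  apply: (@le_trans _ _ (\int[leb]_p (N%:R / e * spec h p + e * (energy m p * spec h p)))).
    by apply: le_Rintegral => // p _; exact: le_trans (ler_norm _) (le2 p).
  rewrite RintegralD//; [|exact: rintegrableZl|exact: rintegrableZl].
  rewrite !RintegralZl// addrC mulrDr lerD//.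
    rewrite ler_pM2l// (le_trans _ (ler_norm _))// (le_trans esE)// lerD2r ler_pM2l//.
    by rewrite ler_piMr ?(ltW M0)// (le_trans hd)// ge_min lexx.
  rewrite mulr1 mulrAC ler_pdivrMr// -expr2.
  rewrite (@le_trans _ _ (N.+1%:R * (mass * d)))//.
    apply: ler_pM => //; first by apply: Rintegral_ge0 => p _; exact: spec_ge0.
      by rewrite ler_nat.
    by rewrite (le_trans sE)// ler_pM2l.
  rewrite mulrA mulrC -ler_pdivlMr ?mulr_gt0//.
  by rewrite /d ge_min lexx orbT.
by rewrite (le_trans (lerD b1 b2))// -mulrDr ler_pM2l// !addrA.
Qed.

End pairing_limit.

(** * Volume near a hyperplane *)

Section hyperplane_strips.
Context {R : realType}.
Local Notation leb n := (lebesgue_rV R n).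

Definition box n (r : R) : set 'rV[R]_n := [set x | forall i, `|x ord0 i| <= r].

Definition strip n (c : 'rV[R]_n) (d e : R) : set 'rV[R]_n :=
  [set x | `|dot c x - d| < e].

Lemma measurable_box n r : measurable (@box n r).
Proof.
rewrite (_ : box _ = \bigcap_i [set x : 'rV[R]_n | `|x ord0 i| <= r]); last first.
  by apply/seteqP; split => [x xr i _|x xr i]; [exact: xr|exact: (xr i)].
apply: fin_bigcap_measurable => // i _.
have := @measurable_coord R n i measurableT _ (measurable_itv `[- r, r]%R); rewrite setTI.
by rewrite /preimage/= (_ : [set x | _] = [set x : 'rV[R]_n | `|x ord0 i| <= r])//;
  apply/seteqP; split => x /=; rewrite in_itv/= ler_norml.
Qed.

Lemma measurable_strip n c d e : measurable (@strip n c d e).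
Proof.
have md : measurable_fun setT (fun x : 'rV[R]_n => dot c x).
  by apply: eq_measurable_fun (measurable_dot c) => x _; rewrite dotC.
have := md measurableT _ (measurable_itv `](d - e), (d + e)[%R); rewrite setTI.
by rewrite /preimage/= (_ : [set x | _] = strip c d e)//;
  apply/seteqP; split => x /=; rewrite in_itv/= /strip/= ltr_norml => /andP[h1 h2];
  apply/andP; split; lra.
Qed.

Lemma lebesgue_itvNr (r : R) : 0 <= r ->
  @lebesgue_measure R `[- r, r]%classic = (2 * r)%:E.
Proof.
move=> r0; rewrite lebesgue_measure_itv/= lte_fin; have [r1|] := ltP (- r) r.
  by rewrite -EFinB opprK mulr_natl mulr2n.
rewrite lerNr -subr_le0 opprK => r1; have -> : r = 0 by lra.
by rewrite mulr0.
Qed.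

Lemma lebesgue_box n r : 0 <= r -> leb n (@box n r) = ((2 * r) ^+ n)%:E.
Proof.
move=> r0; rewrite (_ : box _ = [set x : 'rV[R]_n | forall i, `[- r, r]%classic (x ord0 i)]).
  rewrite (@lebesgue_rV_box R n (fun=> `[- r, r]%classic))//.
  rewrite (eq_bigr (fun=> (2 * r)%:E)); last by move=> i _; exact: lebesgue_itvNr.
  by rewrite prodEFin prodr_const card_ord.
by apply/seteqP; split => x xr i; have := xr i; rewrite /= in_itv/= ler_norml.
Qed.

Lemma lebesgue_rVS n (A : set 'rV[R]_n.+1) :
  leb n.+1 A = (@lebesgue_measure R \x leb n)%E (cons_rV @^-1` A).
Proof. by []. Qed.

Lemma strip1_le (a s e : R) : a != 0 -> 0 < e ->
  lebesgue_measure [set t : measurableTypeR R | `|a * t + s| < e] = (2 * e / `|a|)%:E.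
Proof.
move=> a0 e0; have na : 0 < `|a| by rewrite normr_gt0.
rewrite (_ : [set t | _] = `](- (s / a) - e / `|a|), (- (s / a) + e / `|a|)[%classic).
  rewrite lebesgue_measure_itv/= lte_fin ltrD2l gtrN ?divr_gt0// -EFinB; congr EFin.
  by field; rewrite gt_eqF.
have aE (t : R) : (`|a * t + s| < e) = (`|t + s / a| < e / `|a|).
  rewrite (_ : a * t + s = a * (t + s / a)); last by field.
  by rewrite normrM mulrC -ltr_pdivlMr.
apply/seteqP; split => t /=; rewrite in_itv/= aE ltr_norml => /andP[h1 h2];
  by apply/andP; split; lra.
Qed.

(** Bounded pieces of the strip of width e around a hyperplane have volume
    O(e): slice along the first coordinate, unless the hyperplane is a product
    in that direction. *)
Lemma lebesgue_strip n (c : 'rV[R]_n) d r : c != 0 -> 0 <= r ->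
  exists2 C, 0 <= C & forall e, 0 < e ->
    (leb n (strip c d e `&` box r) <= (C * e)%:E)%E.
Proof.
elim: n c => [|n IHn] c; first by move=> /negP[]; apply/eqP/rowP => -[].
move=> c0 r0; pose c1 := (uncons_rV c).1; pose c2 := (uncons_rV c).2.
have cE (z : measurableTypeR R * 'rV[R]_n) : dot c (cons_rV z) = c1 * z.1 + dot c2 z.2.
  by rewrite dot_uncons cons_rVK.
have bE (z : measurableTypeR R * 'rV[R]_n) : box r (cons_rV z) <-> `|z.1| <= r /\ box r z.2.
  split=> [zr|[z1 z2] i].
    split; first by have := zr ord0; rewrite cons_rV0.
    by move=> i; have := zr (lift ord0 i); rewrite cons_rVS.
  by case: (unliftP ord0 i) => [j|] ->; rewrite ?cons_rV0 ?cons_rVS//; exact: z2.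
have [c1E|c1N] := eqVneq c1 0.
- have c20 : c2 != 0.
    apply: contra_neq c0 => c2E; apply/rowP => i; rewrite mxE.
    case: (unliftP ord0 i) => [j|] ->; last exact: c1E.
    by have /rowP/(_ j) := c2E; rewrite !mxE.
  have [C C0 CE] := IHn c2 c20 r0.
  exists (2 * r * C); first by rewrite !mulr_ge0.
  move=> e e0; rewrite lebesgue_rVS.
  rewrite (_ : _ @^-1` _ = `[- r, r]%classic `*` (strip c2 d e `&` box r)); last first.
    apply/seteqP; split => z /=.
      by move=> [sz /bE[z1 z2]]; rewrite in_itv/= -ler_norml; move: sz;
        rewrite /strip/= cE c1E mul0r add0r.
    rewrite in_itv/= -ler_norml => -[z1 [sz z2]]; split; last exact/bE.
    by rewrite /strip/= cE c1E mul0r add0r.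
  rewrite product_measure1E//; last by apply: measurableI; [exact: measurable_strip|exact: measurable_box].
  rewrite [X in (X * _)%E](lebesgue_itvNr r0).
  rewrite (_ : 2 * r * C * e = (2 * r) * (C * e)); last by rewrite mulrA.
  by rewrite [leRHS]EFinM lee_wpmul2l ?lee_fin ?mulr_ge0//; exact: CE.
- exists ((2 * r) ^+ n * (2 / `|c1|)).
    by rewrite mulr_ge0 ?exprn_ge0 ?mulr_ge0// invr_ge0.
  move=> e e0; rewrite lebesgue_rVS.
  set B := _ @^-1` _.
  have mB : measurable B.
    rewrite -[B]setTI; apply: (@measurable_cons_rV R n) => //.
    by apply: measurableI; [exact: measurable_strip|exact: measurable_box].
  have -> : (@lebesgue_measure R \x leb n)%E B =
      (\int[@lebesgue_measure R \x leb n]_z (\1_B z)%:E)%E.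
    by rewrite integral_indic// setIT.
  have -> := @fubini_tonelli2 _ _ _ _ R (@lebesgue_measure R) (leb n) (EFin \o \1_B)
    ltac:(by apply/measurable_EFinP; exact: measurable_indic) ltac:(by move=> z; rewrite lee_fin).
  apply: (@le_trans _ _ (\int[leb n]_y ((2 * e / `|c1|)%:E * (\1_(box r) y)%:E))%E); last first.
    rewrite ge0_integralZl_EFin//.
    - rewrite integral_indic ?setIT//; last exact: measurable_box.
      rewrite [X in (_ * X)%E](lebesgue_box n r0) -EFinM lee_fin le_eqVlt; apply/orP; left; apply/eqP.
      by ring.
    - by apply/measurable_EFinP; apply: measurable_indic; exact: measurable_box.
    - by rewrite divr_ge0 ?mulr_ge0 ?(ltW e0).
  apply: ge0_le_integral => //.
  - by move=> y _; apply: integral_ge0 => x _; rewrite lee_fin.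
  - apply: (@measurable_fun_fubini_tonelli_G _ _ _ _ R (@lebesgue_measure R) (EFin \o \1_B)).
      by apply/measurable_EFinP; exact: measurable_indic.
    by move=> z; rewrite /= lee_fin.
  - apply/measurable_EFinP; apply: measurable_funM => //.
    by apply: measurable_indic; exact: measurable_box.
  - move=> y _; rewrite /fubini_G /=.
    have [yr|yr] := pselect (box r y); last first.
      rewrite [in leRHS]indicE memNset// mule0 integral0_eq// => x _.
      by rewrite indicE memNset// => -[_ /bE[]].
    rewrite [in leRHS]indicE mem_set// mule1.
    pose I := [set t : measurableTypeR R | `|c1 * t + (dot c2 y - d)| < e].
    have mI : measurable I.
      have mm : measurable_fun setT (fun t : measurableTypeR R => c1 * t + (dot c2 y - d)).
        by apply: measurable_funD => //; exact: measurable_funM.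
      have := mm measurableT _ (measurable_itv `](- e), e[%R); rewrite setTI.
      by rewrite /preimage/= (_ : [set x | _] = I)//;
        apply/seteqP; split => x /=; rewrite /I in_itv/= ltr_norml.
    have <- : (\int[@lebesgue_measure R]_x (\1_I x)%:E = (2 * e / `|c1|)%:E)%E.
      by rewrite integral_indic// setIT; exact: strip1_le.
    apply: ge0_le_integral => //.
    + apply/measurable_EFinP; apply: (measurable_sectionr (f := \1_B)).
      exact: measurable_indic.
    + by apply/measurable_EFinP; exact: measurable_indic.
    + move=> x _; rewrite lee_fin !indicE ler_nat.
      have [Bxy|Bxy] := pselect (B (x, y)); last by rewrite (memNset Bxy).
      have Ix : I x by case: Bxy; rewrite /I /strip/= cE/= addrA.
      by rewrite (mem_set Ix) leq_b1.
Qed.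

End hyperplane_strips.

(** * Cutting along the boundary *)

Section cutoff.
Context {R : realType} {n : nat}.
Hypothesis n0 : (0 < n)%N.
Local Notation V := 'rV[R]_n.
Local Notation leb := (lebesgue_rV R n).
Local Notation mass := (mass R n).
Local Notation Re := (@complex.Re R).
Local Notation Im := (@complex.Im R).
Implicit Types (a b f g k : V -> R) (p x y z c : V) (A L M m r e d : R).
Implicit Types (S T : set V).

Lemma lip_le L L' f : lip L f -> L <= L' -> lip L' f.
Proof. by move=> fL LL x y; rewrite (le_trans (fL x y))// ler_wpM2r ?l1_ge0. Qed.

Lemma lip_cst (s : R) : lip 0 (fun _ : V => s).
Proof. by move=> x y; rewrite subrr normr0 mul0r. Qed.

Lemma lip_min L f g : lip L f -> lip L g -> lip L (fun x => Num.min (f x) (g x)).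
Proof.
move=> fL gL x y; have := fL x y; have := gL x y; rewrite !ler_norml.
move: (L * l1 (x - y)) => s /andP[g1 g2] /andP[f1 f2].
by case: (leP (f x) (g x)); case: (leP (f y) (g y)) => *; apply/andP; split; lra.
Qed.

Lemma dot_le c z : `|dot c z| <= l1 c * l1 z.
Proof.
rewrite /dot (le_trans (ler_norm_sum _ _ _))// /l1 mulr_suml.
by apply: ler_sum => i _; rewrite normrM ler_wpM2l// le_coord_l1.
Qed.

Lemma lip_dist_hyperplane c d e : 0 < e -> lip (l1 c / e) (fun x => `|dot c x - d| / e).
Proof.
move=> e0 x y; rewrite -mulrBl normrM (gtr0_norm (x := e^-1)) ?invr_gt0//.
rewrite mulrAC ler_pM2r ?invr_gt0//.
rewrite (le_trans (ler_dist_dist _ _))// opprB addrA subrK -dotBr.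
exact: dot_le.
Qed.

(** The minimum of 1 and of the distances to the hyperplanes in units of [e]. The
    slope is O(1/e) on a set of volume O(e), with a constant independent of
    [e], so that their product stays bounded. *)
Lemma cutoff_exists (hs : seq (V * R)) r : 0 <= r -> (forall h, h \in hs -> h.1 != 0) ->
  exists2 C, 0 < C & forall e, 0 < e -> e <= 1 -> exists chi (N : set V),
    [/\ lip (C / e) chi, forall x, 0 <= chi x <= 1,
        measurable N /\ (leb (N `&` box r) <= (C * e)%:E)%E,
        forall x, ~ N x -> chi x = 1 &
        forall h x, h \in hs -> dot h.1 x = h.2 -> chi x = 0].
Proof.
move=> r0; elim: hs => [|[c d] hs IHhs] hs0.
  exists 1 => // e e0 e1; exists (fun=> 1), set0; split => //.
  - by apply: (lip_le (lip_cst 1)); rewrite divr_ge0// ltW.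
  - by move=> x; rewrite ler01 lexx.
  - by split => //; rewrite set0I measure0 lee_fin mul1r ltW.
have [|C C0 IH] := IHhs; first by move=> h hh; apply: hs0; rewrite inE hh orbT.
have c0 : c != 0 by apply: (hs0 (c, d)); rewrite inE eqxx.
have [C' C'0 CE] := lebesgue_strip d c0 r0.
exists (C + C' + l1 c).
  by rewrite ltr_wpDr ?l1_ge0// ltr_wpDr.
move=> e e0 e1; have [chi [N [chiL chi01 [mN leN] chi1 chi0]]] := IH e e0 e1.
exists (fun x => Num.min (chi x) (Num.min 1 (`|dot c x - d| / e))), (N `|` strip c d e).
have ie0 : 0 <= e^-1 by rewrite invr_ge0 ltW.
have CC0 : 0 <= C + C' + l1 c by rewrite !addr_ge0 ?l1_ge0// ltW.
split.
- apply: lip_min; first by apply: (lip_le chiL); rewrite ler_wpM2r// -addrA lerDl addr_ge0 ?l1_ge0.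
  apply: lip_min; first by apply: (lip_le (lip_cst 1)); rewrite mulr_ge0.
  apply: (lip_le (lip_dist_hyperplane _ _ e0)); by rewrite ler_wpM2r// lerDr addr_ge0// ltW.
- move=> x; have /andP[h1 h2] := chi01 x.
  apply/andP; split; last by rewrite ge_min h2.
  by rewrite !le_min h1 ler01/= mulr_ge0.
- split; first by apply: measurableU => //; exact: measurable_strip.
  rewrite setIUl (le_trans (measureU2 _ _ _))//.
  + by apply: measurableI => //; exact: measurable_box.
  + by apply: measurableI; [exact: measurable_strip|exact: measurable_box].
  rewrite (le_trans (leeD leN (CE e e0)))// -EFinD lee_fin -mulrDl ler_pM2r//.
  by rewrite lerDl l1_ge0.
- move=> x /not_orP[/chi1 -> /negP]; rewrite /strip/= -leNgt => h.
  have -> : Num.min 1 (`|dot c x - d| / e) = 1 by apply/min_idPl; rewrite ler_pdivlMr// mul1r.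
  exact: minxx.
- move=> h x; rewrite inE => /orP[/eqP -> /= ->|hh hx].
    rewrite subrr normr0 mul0r; have /andP[h1 h2] := chi01 x.
    by rewrite (min_idPr ler01) (min_idPr h1).
  rewrite (chi0 _ _ hh hx); apply/min_idPl.
  by rewrite le_min ler01 mulr_ge0.
Qed.

Lemma compact_box r : compact (@box R n r).
Proof.
rewrite (_ : box r = [set x : V | forall i, `[- r, r]%classic (x ord0 i)]).
  by apply: (@rV_compact _ _ (fun=> `[- r, r]%classic)) => i; exact: segment_compact.
by apply/seteqP; split => x xr i; have := xr i; rewrite /= in_itv/= ler_norml.
Qed.

(** Only finitely many of the locally finite polyhedra meet a compact box; each
    of them is replaced by a hyperplane containing it. *)
Lemma hyperplane_cover S r : piecewise_linear (boundary S) ->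
  exists hs : seq (V * R), (forall h, h \in hs -> h.1 != 0) /\
    forall x, boundary S x -> box r x -> exists2 h, h \in hs & dot h.1 x = h.2.
Proof.
move=> [F [lF Fh SE]].
have H (P : set V) : exists h : V * R, F P -> h.1 != 0 /\ P `<=` [set x | dot h.1 x = h.2].
  have [FP|FP] := pselect (F P); last by exists (0, 0).
  by have [_ [c [d [c0 cP]]]] := Fh P FP; exists (c, d).
have [hp hpE] := choice H.
have H2 x : exists U : set V, nbhs x U /\ finite_set [set P | F P /\ P `&` U !=set0].
  by have [U xU fU] := lF x; exists U.
have [U UE] := choice H2.
have := @compact_box r; rewrite compact_cover.
move=> /(_ V (box r) (fun x => (U x)°)) []; first by move=> x _; exact: open_interior.
  by move=> x xr; exists x => //; have [+ _] := UE x.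
move=> D _ cD.
have fG : finite_set (\bigcup_(x in [set` D]) [set P | F P /\ P `&` U x !=set0]).
  by apply: bigcup_finite => // x _; have [_] := UE x.
have /finite_seqP[s sE] := fG.
have inF P : P \in s -> F P.
  move=> Ps; have : [set` s] P by [].
  by rewrite -sE => -[x _ []].
exists (map hp s); split.
  by move=> h /mapP[P Ps ->]; have [] := hpE P (inF P Ps).
move=> x; rewrite SE => -[P FP Px] xr.
have [y yD /interior_subset Uyx] := cD x xr.
have Ps : [set` s] P by rewrite -sE; exists y => //; split => //; exists x.
exists (hp P); first exact: map_f.
by have [_ /(_ x Px)] := hpE P FP.
Qed.

(** Connectedness: otherwise the traces of the interior and of the closure of
    [S] on the segment agree and form a proper nonempty clopen subset. *)
Lemma segment_boundary S x y : S x -> ~ S y ->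
  exists t : R, 0 <= t <= 1 /\ boundary S (x + t *: (y - x)).
Proof.
move=> Sx Sy; apply: contrapT => /forallNP H.
pose gam (t : R) : V := x + t *: (y - x).
have cgam : continuous gam.
  move=> t; apply: cvgD; first exact: cvg_cst.
  by apply: cvgZr_tmp.
have nb t : `[0, 1]%classic t -> closure S (gam t) -> S° (gam t).
  rewrite /= in_itv/= => t01 cSt; apply: contrapT => iSt.
  by apply: (H t); split.
have H1 := @segment_connected R 0 1.
have B : `[0, 1] `&` gam @^-1` S° = `[0, 1]%classic.
  apply: H1.
  - exists 0; split; first by rewrite /= in_itv/= lexx ler01.
    apply: nb; first by rewrite /= in_itv/= lexx ler01.
    by rewrite /gam scale0r addr0; exact: subset_closure.
  - by exists (gam @^-1` S°) => //; move/continuousP : (cgam); apply; exact: open_interior.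
  - exists (gam @^-1` closure S).
      by move/continuous_closedP : (cgam); apply; exact: closed_closure.
    apply/seteqP; split => t [t01 tS]; split => //.
      by apply: subset_closure; exact: interior_subset.
    exact: nb.
have : (`[0, 1] `&` gam @^-1` S°) 1 by rewrite B /= in_itv/= ler01 lexx.
move=> [_]; rewrite /preimage/= /gam scale1r addrCA subrr addr0.
by move=> /interior_subset.
Qed.

Lemma l1Z (t : R) z : l1 (t *: z) = `|t| * l1 z.
Proof. by rewrite /l1 mulr_sumr; apply: eq_bigr => i _; rewrite mxE normrM. Qed.

Lemma crossing_le S L k r x y : lip L k -> 0 <= L ->
  (forall z, box r z -> boundary S z -> k z = 0) ->
  box r x -> box r y -> S x -> ~ S y ->
  `|k x| <= L * l1 (x - y) /\ `|k y| <= L * l1 (x - y).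
Proof.
move=> kL L0 k0 xr yr Sx Sy; have [t [/andP[t0 t1] bz]] := segment_boundary Sx Sy.
set z := x + _ in bz.
have zr : box r z.
  move=> i; rewrite /z !mxE (_ : _ + _ = (1 - t) * x ord0 i + t * y ord0 i); last by ring.
  rewrite (le_trans (ler_normD _ _))// !normrM (ger0_norm t0) ger0_norm ?subr_ge0//.
  rewrite (_ : r = (1 - t) * r + t * r); last by ring.
  by rewrite lerD// ler_wpM2l ?subr_ge0// ?xr ?yr.
have kz := k0 z zr bz.
have xz : l1 (x - z) <= l1 (x - y).
  rewrite /z opprD addNKr -scaleNr l1Z normrN (ger0_norm t0) l1B.
  by rewrite ler_piMl ?l1_ge0// l1B.
have yz : l1 (y - z) <= l1 (x - y).
  rewrite (_ : y - z = (1 - t) *: (y - x)); last first.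
    by apply/rowP => i; rewrite !mxE; ring.
  rewrite l1Z ger0_norm ?subr_ge0// l1B.
  by rewrite ler_piMl ?l1_ge0// gerBl.
split.
- by have := kL x z; rewrite kz subr0 => /le_trans; apply; rewrite ler_wpM2l.
- by have := kL y z; rewrite kz subr0 => /le_trans; apply; rewrite ler_wpM2l.
Qed.

(** Cutting by the indicator of [S] preserves the Lipschitz constant of a function
    that vanishes on the boundary: between a point of [S] and a point off [S]
    the function passes through zero. *)
Lemma lip_restrict S L k r : lip L k -> 0 <= L ->
  (forall z, box r z -> boundary S z -> k z = 0) ->
  (forall x, ~ box r x -> k x = 0) ->
  lip L (fun x => k x * \1_S x) /\ lip L (fun x => k x - k x * \1_S x).
Proof.
move=> kL L0 k0 kr.
have cross x y : S x -> ~ S y -> `|k x| <= L * l1 (x - y) /\ `|k y| <= L * l1 (x - y).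
  move=> Sx Sy; have [xr|xr] := pselect (box r x); last first.
    rewrite (kr x xr) normr0; split; first by rewrite mulr_ge0 ?l1_ge0.
    by have := kL x y; rewrite (kr x xr) sub0r normrN.
  have [yr|yr] := pselect (box r y); first exact: (crossing_le kL L0 k0).
  rewrite (kr y yr) normr0; split; last by rewrite mulr_ge0 ?l1_ge0.
  by have := kL x y; rewrite (kr y yr) subr0.
split => x y; have [Sx|Sx] := pselect (S x); have [Sy|Sy] := pselect (S y);
  rewrite !indicE ?(mem_set Sx) ?(memNset Sx) ?(mem_set Sy) ?(memNset Sy)
    ?(mulr1, mulr0, subrr, subr0, sub0r, normrN, normr0)//.
- by have [] := cross x y Sx Sy.
- by have [] := cross y x Sy Sx; rewrite l1B.
- by rewrite mulr_ge0 ?l1_ge0.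
- by rewrite mulr_ge0 ?l1_ge0.
- by have [] := cross x y Sx Sy.
- by have [] := cross y x Sy Sx; rewrite l1B.
Qed.

Lemma tame_le A A' g : tame A g -> A <= A' -> tame A' g.
Proof.
move=> [gi g2i gA] AA; split => // e e0; rewrite (le_trans (gA e e0))//.
by rewrite ler_pM2l.
Qed.

Lemma box_lty r : 0 <= r -> (leb (box r) < +oo)%E.
Proof. by move=> r0; rewrite lebesgue_box// ltry. Qed.

(** The heart of the matter: H^(1/2) does not see hyperplanes. Multiplied by a
    cutoff vanishing on the boundary of [S], the test function [f] splits into a
    part vanishing on [T] and a part vanishing on [S], both tame and hence
    orthogonal to [phi]; the cutoffs tend to 1 in L^2 with bounded energy. *)
Lemma pairing_compact0 m S T (phi : V -> R[i]) f L M r : 0 < m -> 0 <= r ->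
  S `&` T = set0 -> piecewise_linear (boundary S) ->
  Hspace m S phi -> Hspace m T phi ->
  0 < L -> 0 < M -> lip L f -> (forall x, `|f x| <= M) ->
  (forall x, ~ box r x -> f x = 0) ->
  pairing (Re \o phi) (Im \o phi) f = 0 /\
  pairing (Im \o phi) (fun p => - Re (phi p)) f = 0.
Proof.
move=> m0 r0 ST plS HS HT L0 M0 fL fM fr.
have [hs [hs0 hsE]] := hyperplane_cover r plS.
have [C C0 cut] := cutoff_exists r0 hs0.
have phi2 : L2r m phi by have [] := HS.
have [mR mI] := phi2.1.
have n1 : 0 < n%:R :> R by rewrite ltr0n.
have phi2i := L2r_msq m0 phi2.
have mbox := @measurable_box R n r; have bfin := box_lty r0.
(* energy of the transition layers: slope (L + M C) / e, volume C e *)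
pose A := 4 * n%:R * (2 * M) * (n%:R * (L + M * C)) * mass * C.
have [[fi f2i _] _] := lip_tame n0 L0 M0 fL fM mbox bfin fr.
have main d : 0 < d -> exists A' g, [/\ tame A' g, tame A (fun x => f x - g x),
     \int[leb]_x (f x - g x) ^+ 2 <= d, pairing (Re \o phi) (Im \o phi) g = 0 &
     pairing (Im \o phi) (fun p => - Re (phi p)) g = 0].
  move=> d0; pose e := Num.min 1 (d / (M ^+ 2 * C)).
  have e0 : 0 < e by rewrite lt_min ltr01 divr_gt0// mulr_gt0// exprn_gt0.
  have e1 : e <= 1 by rewrite ge_min lexx.
  have [chi [N [chiL chi01 [mN leN] chi1 chi0]]] := cut e e0 e1.
  have chin x : `|chi x| <= 1 by have /andP[h1 h2] := chi01 x; rewrite ger0_norm.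
  have chin' x : `|1 - chi x| <= 1.
    by have /andP[h1 h2] := chi01 x; rewrite ger0_norm ?subr_ge0// gerBl.
  have chiL' : lip (C / e) (fun x => 1 - chi x).
    by move=> x y; rewrite [X in `|X|](_ : _ = chi y - chi x); [rewrite l1B; exact: chiL|ring].
  pose L1 := (L + M * C) / e.
  have LM0 : 0 < L + M * C by rewrite addr_gt0// mulr_gt0.
  have L10 : 0 < L1 by rewrite divr_gt0.
  have leL1 : L * 1 + M * (C / e) <= L1.
    rewrite /L1 mulrDl mulrA lerD2r mulr1 ler_pdivlMr// ler_piMr// ltW//.
  have gL : lip L1 (fun x => f x * chi x) by exact: lip_le (lipM fL chiL fM chin) leL1.
  have hL : lip L1 (fun x => f x * (1 - chi x)) by exact: lip_le (lipM fL chiL' fM chin') leL1.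
  have gM x : `|f x * chi x| <= M by rewrite normrM -[leRHS]mulr1 ler_pM.
  have hM x : `|f x * (1 - chi x)| <= M by rewrite normrM -[leRHS]mulr1 ler_pM.
  have gr x : ~ box r x -> f x * chi x = 0 by move=> /fr ->; rewrite mul0r.
  have g0 z : box r z -> boundary S z -> f z * chi z = 0.
    by move=> zr /hsE /(_ zr) [h hh hz]; rewrite (chi0 _ _ hh hz) mulr0.
  have [g1L g2L] := lip_restrict gL (ltW L10) g0 gr.
  have [tg _] := lip_tame n0 L10 M0 gL gM mbox bfin gr.
  have [tg1 _] := @lip_tame _ _ L1 M (box r) (fun x => f x * chi x * \1_S x) n0 L10 M0 g1L
    ltac:(by move=> x; rewrite normrM (le_trans _ (gM x))// ler_piMr// indicE ger0_norm// lern1 leq_b1)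
    mbox bfin ltac:(by move=> x /gr ->; rewrite mul0r).
  have [tg2 _] := @lip_tame _ _ L1 M (box r) (fun x => f x * chi x - f x * chi x * \1_S x) n0 L10 M0 g2L
    ltac:(by move=> x; cbv beta; rewrite indicE; case: (x \in S); rewrite ?mulr1 ?mulr0 ?subrr ?subr0 ?normr0 ?(ltW M0))
    mbox bfin ltac:(by move=> x /gr ->; rewrite mul0r subr0).
  have mNb : measurable (N `&` box r) by exact: measurableI.
  have Nfin : (leb (N `&` box r) < +oo)%E by rewrite (le_lt_trans leN)// ltry.
  have [th h2] := @lip_tame _ _ L1 M (N `&` box r) _ n0 L10 M0 hL hM mNb Nfin
    ltac:(by move=> x Nx; have [/chi1 -> | /fr ->] := (not_andP _ _).1 Nx;
      rewrite ?subrr ?mulr0 ?mul0r).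
  have fNb : fine (leb (N `&` box r)) <= C * e.
    by rewrite -lee_fin fineK// ge0_fin_numE.
  have hE : (fun x => f x - f x * chi x) = (fun x => f x * (1 - chi x)).
    by apply/funext => x; rewrite mulrBr mulr1.
  (* f chi 1_S vanishes on T and f chi (1 - 1_S) vanishes on S *)
  have z1 x : T x -> f x * chi x * \1_S x = 0.
    move=> Tx; rewrite indicE memNset ?mulr0// => Sx.
    by have : (S `&` T) x by []; rewrite ST.
  have z2 x : S x -> f x * chi x - f x * chi x * \1_S x = 0.
    by move=> Sx; rewrite indicE mem_set// mulr1 subrr.
  have [gi _ _] := tg.
  have [P1 P1'] := Hspace_pairing0 m0 HT tg1 z1.
  have [P2 P2'] := Hspace_pairing0 m0 HS tg2 z2.
  exists (4 * n%:R * (2 * M) * (n%:R * L1) * mass * fine (leb (box r))).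
  exists (fun x => f x * chi x); split; first exact: tg.
  - rewrite hE; apply: (tame_le th).
    rewrite [leLHS](_ : _ = 4 * n%:R * (2 * M) * (n%:R * (L + M * C)) * mass * (fine (leb (N `&` box r)) / e)); last by rewrite /L1; ring.
    by rewrite /A ler_pM2l ?ler_pdivrMr// !mulr_gt0// mass_gt0.
  - rewrite [leLHS](_ : _ = \int[leb]_x (f x * (1 - chi x)) ^+ 2); last first.
      by apply: eq_Rintegral => x _; rewrite mulrBr mulr1.
    rewrite (le_trans h2)// (@le_trans _ _ (M ^+ 2 * (C * e)))//.
      by rewrite ler_wpM2l ?sqr_ge0.
    rewrite mulrA mulrC -ler_pdivlMr ?mulr_gt0 ?exprn_gt0//.
    by rewrite /e ge_min lexx orbT.
  - rewrite (pairingB m0 mR mI phi2i gi tg2 tg1) P1 P2 addr0//.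
  - rewrite (pairingB m0 mI (measurableT_comp _ mR) _ gi tg2 tg1) ?P1' ?P2' ?addr0//.
    by apply: eq_rintegrable phi2i => p; rewrite sqrrN [in RHS]addrC.
split.
- apply: (pairing_limit (A := A) m0 mR mI phi2i fi) => d /main[A' [g [? ? ? ? ?]]].
  by exists A', g.
- apply: (pairing_limit (A := A) m0 mI _ _ fi) => [||d /main[A' [g [? ? ? ? ?]]]].
  + exact: measurableT_comp.
  + by apply: eq_rintegrable phi2i => p; rewrite sqrrN [in RHS]addrC.
  + by exists A', g.
Qed.

End cutoff.

(** * Damped waves *)

Section damped_waves.
Context {R : realType} {n : nat}.
Hypothesis n0 : (0 < n)%N.
Local Notation V := 'rV[R]_n.
Local Notation leb := (lebesgue_rV R n).
Local Notation mass := (mass R n).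
Local Notation Re := (@complex.Re R).
Local Notation Im := (@complex.Im R).
Implicit Types (a b f g k : V -> R) (p q x y z : V) (A L M m r e d : R).
Implicit Types (S T : set V).

Lemma MVT_lip (f f' : R -> R) : (forall t : R, is_derive t 1 f (f' t)) ->
  (forall t, `|f' t| <= 1) -> forall s t, `|f s - f t| <= `|s - t|.
Proof.
move=> df f1; suff H s t : s < t -> `|f s - f t| <= `|s - t|.
  move=> s t; have [st|ts|->] := ltgtP s t; first exact: H.
  - by rewrite distrC [leRHS]distrC; exact: H.
  - by rewrite subrr normr0.
move=> st; have cf : {within `[s, t], continuous f}.
  apply: continuous_subspaceT => u; apply: differentiable_continuous.
  by apply/derivable1_diffP; exact: ex_derive.
have [c _ E] := MVT st (fun u _ => df u) cf.
by rewrite distrC E normrM [leRHS]distrC ler_piMl.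
Qed.

Lemma cos_lip (s t : R) : `|cos s - cos t| <= `|s - t|.
Proof.
by apply: (@MVT_lip cos (fun t => - sin t)) => u; rewrite normrN normr_sin_le1.
Qed.

Lemma sin_lip (s t : R) : `|sin s - sin t| <= `|s - t|.
Proof.
by apply: (@MVT_lip sin cos) => u; exact: normr_cos_le1.
Qed.

Lemma lip_wave (w : R -> R) q : (forall s t, `|w s - w t| <= `|s - t|) ->
  lip (l1 q) (fun x => w (dot q x)).
Proof. by move=> wl x y; rewrite (le_trans (wl _ _))// -dotBr dot_le. Qed.

Lemma weight_sub_le e x y : 0 < e -> weight e y <= weight e x ->
  0 <= weight e x - weight e y /\
  weight e x - weight e y <= weight e x * (e * l1 (x - y)).
Proof.
move=> e0 yx; rewrite subr_ge0; split => //.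
have -> : weight e y = weight e x * expR (- (e * (l1 y - l1 x))).
  by rewrite /weight -expRD; congr expR; ring.
rewrite -[X in X - _]mulr1 -mulrBr ler_pM2l ?weight_gt0//.
have := expR_ge1Dx (- (e * (l1 y - l1 x))).
have : e * (l1 y - l1 x) <= e * l1 (x - y).
  by rewrite ler_pM2l// lerBlDr; have := l1_triangle y x 0; rewrite !subr0 l1B.
by lra.
Qed.

Lemma lip_weight e : 0 < e -> lip e (@weight R n e).
Proof.
move=> e0 x y; wlog yx : x y / weight e y <= weight e x.
  move=> H; have [yx|/ltW xy] := leP (weight e y) (weight e x); first exact: H.
  by rewrite distrC l1B; exact: H.
have [h1 h2] := weight_sub_le e0 yx.
rewrite ger0_norm// (le_trans h2)// ler_piMl ?weight_le1 ?(ltW e0)//.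
by rewrite mulr_ge0 ?l1_ge0// ltW.
Qed.

(** A damped bounded Lipschitz function has finite energy although its support
    is unbounded: the damping itself plays the role of the volume. *)
Lemma weighted_tame e L k : 0 < e -> 0 <= L -> lip L k -> (forall x, `|k x| <= 1) ->
  tame (4 * n%:R * 3 * (n%:R * (L + e)) * mass * \int[leb]_x weight e x)
    (fun x => weight e x * k x).
Proof.
move=> e0 L0 kL k1; have [wi _] := Rintegral_weight n e0.
have mk := lip_measurable n0 L0 kL.
have mw := @measurable_weight R n e.
have gw x : `|weight e x * k x| <= weight e x.
  by rewrite normrM gtr0_norm ?weight_gt0// ler_piMr ?(ltW (weight_gt0 _ _)).
have g2w x : `|(weight e x * k x) ^+ 2| <= weight e x.
  rewrite normrX (le_trans _ (gw x))// expr2 ler_piMl// (le_trans (gw x))//.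
  by rewrite weight_le1// ltW.
have mg : measurable_fun setT (fun x => weight e x * k x) by exact: measurable_funM.
have gi := rintegrable_dom mg wi gw.
have g2i := rintegrable_dom (measurable_funX 2 mg) wi g2w.
have Le0 : 0 < L + e by rewrite ltr_wpDl.
split => //; apply: gagliardo_le => //.
- by rewrite mulr_gt0// ltr0n.
- by move=> x; rewrite ltW// weight_gt0.
have key x y : weight e y <= weight e x ->
    (weight e x * k x - weight e y * k y) ^+ 2 <= (weight e x + weight e y) *
    \sum_(i < n) Num.min (3 ^+ 2) ((n%:R * (L + e)) ^+ 2 * (x ord0 i - y ord0 i) ^+ 2).
  move=> yx; have [h1 h2] := weight_sub_le e0 yx.
  have wx := weight_gt0 e x; have wy := weight_gt0 e y.
  pose D := Num.min 3 ((L + e) * l1 (x - y)).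
  have D0 : 0 <= D by rewrite le_min ler0n/= mulr_ge0 ?l1_ge0// ltW.
  have gD : `|weight e x * k x - weight e y * k y| <= weight e x * D.
    rewrite (_ : _ - _ = weight e x * (k x - k y) + (weight e x - weight e y) * k y);
      last by ring.
    rewrite (le_trans (ler_normD _ _))// !normrM (gtr0_norm wx) (ger0_norm h1).
    have b2 : (weight e x - weight e y) * `|k y| <= weight e x - weight e y by rewrite ler_piMr.
    rewrite /D minr_pMr ?(ltW wx)// le_min; apply/andP; split.
      have : weight e x * `|k x - k y| <= weight e x * 2.
        rewrite ler_pM2l// (le_trans (ler_normB _ _))// (_ : 2 = 1 + 1)//.
        by rewrite lerD.
      by move: b2 wx wy; move: (_ * `|k y|) (_ * `|k x - k y|) => s t; lra.
    have : weight e x * `|k x - k y| <= weight e x * (L * l1 (x - y)).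
      by rewrite ler_pM2l.
    move=> b1; rewrite [in leRHS]mulrDl [in leRHS]mulrDr; exact: lerD b1 (le_trans b2 h2).
  have DS : D ^+ 2 <= \sum_(i < n) Num.min (3 ^+ 2) ((n%:R * (L + e)) ^+ 2 * (x ord0 i - y ord0 i) ^+ 2).
    have := @sqr_le_sum_min _ _ D 3 (L + e) (x - y) n0 (ltW Le0) D0.
    under eq_bigr do rewrite !mxE; apply; first by rewrite /D ge_min lexx.
    by rewrite /D ge_min lexx orbT.
  rewrite -(real_normK (num_real _)).
  apply: (@le_trans _ _ ((weight e x * D) ^+ 2)).
    by rewrite lerXn2r ?nnegrE// mulr_ge0// ltW.
  rewrite exprMn; apply: ler_pM => //; rewrite ?sqr_ge0//.
  rewrite (@le_trans _ _ (weight e x))//; last by rewrite lerDl ltW.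
  by rewrite expr2 ler_piMr ?(ltW wx)// weight_le1// ltW.
move=> x y; have [yx|/ltW xy] := leP (weight e y) (weight e x); first exact: key.
rewrite [leLHS](_ : _ = (weight e y * k y - weight e x * k x) ^+ 2); last by ring.
rewrite [weight e x + _]addrC (le_trans (key _ _ xy))//.
rewrite le_eqVlt; apply/orP; left; apply/eqP; congr (_ * _).
by apply: eq_bigr => i _; congr (Num.min _ (_ * _)); ring.
Qed.

Definition ramp r x : R := Num.max 0 (1 - l1 x / r).

Lemma ramp01 r x : 0 < r -> 0 <= ramp r x <= 1.
Proof.
move=> r0; rewrite le_max lexx/= ge_max ler01/= gerBl divr_ge0 ?l1_ge0//.
exact: ltW.
Qed.

Lemma lip_ramp r : 0 < r -> lip r^-1 (ramp r).
Proof.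
move=> r0 x y.
have H : `|l1 x / r - l1 y / r| <= r^-1 * l1 (x - y).
  rewrite -mulrBl normrM (gtr0_norm (x := r^-1)) ?invr_gt0// mulrC ler_pM2l ?invr_gt0//.
  rewrite ler_norml lerBrDr lerBlDr addrC -lerBrDr opprK; apply/andP; split.
    have := l1_triangle y x 0; rewrite !subr0 l1B; lra.
  have := l1_triangle x y 0; rewrite !subr0; lra.
rewrite /ramp; move: H; rewrite !ler_norml.
move: (l1 x / r) (l1 y / r) (r^-1 * _) => s t u /andP[h1 h2].
by case: (leP 0 (1 - s)); case: (leP 0 (1 - t)) => *; apply/andP; split; lra.
Qed.

Lemma ramp_out r x : 0 < r -> ~ box r x -> ramp r x = 0.
Proof.
move=> r0 xr; apply/max_idPl; rewrite subr_le0 ler_pdivlMr// mul1r.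
move: xr => /existsNP[i /negP]; rewrite -ltNge => /ltW ri.
by rewrite (le_trans ri)// le_coord_l1.
Qed.

(** One half of the damping absorbs the linear growth of [1 - ramp r]. *)
Lemma ramp_tail e r x : 0 < e -> 0 < r ->
  weight e x * (1 - ramp r x) <= 2 / e / r * weight (e / 2) x.
Proof.
move=> e0 r0; have rr : 1 - ramp r x <= l1 x / r.
  by rewrite lerBlDr -lerBlDl le_max lexx orbT.
rewrite (le_trans (ler_wpM2l (ltW (weight_gt0 _ _)) rr))//.
have -> : weight e x = weight (e / 2) x * weight (e / 2) x.
  by rewrite /weight -expRD; congr expR; field.
rewrite (_ : _ * _ * _ = weight (e / 2) x * (weight (e / 2) x * l1 x / r)); last by ring.
rewrite mulrC ler_pM2r ?weight_gt0// ler_pM2r ?invr_gt0//.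
rewrite /weight -ler_pdivlMl ?expR_gt0// -expRN opprK.
rewrite (_ : l1 x = (e / 2 * l1 x) * (2 / e)); last by field; rewrite gt_eqF.
rewrite ler_pM2r ?divr_gt0//.
have := expR_ge1Dx (e / 2 * l1 x).
rewrite (_ : e / 2 * (e / 2 * l1 x * (2 / e)) = e / 2 * l1 x); last by field; rewrite gt_eqF.
by lra.
Qed.

(** Truncating the damped wave by [ramp r] gives functions as in
    [pairing_compact0], which tend to it in L^2 with bounded energy as [r]
    grows. *)
Lemma pairing_wave0 m S T (phi : V -> R[i]) (w : R -> R) e q : 0 < m -> 0 < e ->
  S `&` T = set0 -> piecewise_linear (boundary S) ->
  Hspace m S phi -> Hspace m T phi ->
  (forall s t, `|w s - w t| <= `|s - t|) -> (forall s, `|w s| <= 1) ->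
  pairing (Re \o phi) (Im \o phi) (fun x => weight e x * w (dot q x)) = 0 /\
  pairing (Im \o phi) (fun p => - Re (phi p)) (fun x => weight e x * w (dot q x)) = 0.
Proof.
move=> m0 e0 ST plS HS HT wl w1.
have phi2 : L2r m phi by have [] := HS.
have [mR mI] := phi2.1.
have phi2i := L2r_msq m0 phi2.
have wq := lip_wave q wl.
have [fi f2i _] := weighted_tame e0 (l1_ge0 q) wq (fun x => w1 (dot q x)).
pose f x := weight e x * w (dot q x).
have fL : lip (e * 1 + 1 * l1 q) f.
  apply: lipM (lip_weight e0) wq _ (fun x => w1 _) => x.
  by rewrite gtr0_norm ?weight_gt0// weight_le1// ltW.
have f1 x : `|f x| <= 1.
  by rewrite normrM -[leRHS]mulr1 ler_pM// gtr0_norm ?weight_gt0// weight_le1// ltW.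
have [Wi _] := Rintegral_weight n (divr_gt0 e0 (ltr0n R 2)).
pose c := 2 / e * \int[leb]_x weight (e / 2) x.
have c0 : 0 <= c.
  rewrite mulr_ge0 ?divr_ge0 ?(ltW e0)//.
  by apply: Rintegral_ge0 => x _; rewrite ltW// weight_gt0.
pose A := 4 * n%:R * 3 * (n%:R * ((l1 q + 1) + e)) * mass * \int[leb]_x weight e x.
have main d : 0 < d -> exists A' g, [/\ tame A' g, tame A (fun x => f x - g x),
     \int[leb]_x (f x - g x) ^+ 2 <= d, pairing (Re \o phi) (Im \o phi) g = 0 &
     pairing (Im \o phi) (fun p => - Re (phi p)) g = 0].
  move=> d0; pose r := 1 + c / d.
  have r1 : 1 <= r by rewrite lerDl divr_ge0// ltW.
  have r0 : 0 < r by rewrite (lt_le_trans ltr01).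
  have ir1 : r^-1 <= 1 by rewrite invf_le1.
  have rn x : `|ramp r x| <= 1 by have /andP[h1 h2] := ramp01 x r0; rewrite ger0_norm.
  have gL := lipM fL (lip_ramp r0) f1 rn.
  have gr x : ~ box r x -> f x * ramp r x = 0 by move=> /(ramp_out r0) ->; rewrite mulr0.
  have g1 x : `|f x * ramp r x| <= 1 by rewrite normrM -[leRHS]mulr1 ler_pM.
  have L0 : 0 < (e * 1 + 1 * l1 q) * 1 + 1 * r^-1.
    by rewrite ltr_pwDr ?mul1r ?invr_gt0// mulr1 addr_ge0 ?l1_ge0// mulr1 ltW.
  have [tg _] := lip_tame n0 L0 ltr01 gL g1 (@measurable_box R n r) (box_lty (ltW r0)) gr.
  have [P1 P2] := pairing_compact0 n0 m0 (ltW r0) ST plS HS HT L0 ltr01 gL g1 gr.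
  have kL : lip (l1 q * 1 + 1 * r^-1) (fun x => w (dot q x) * (1 - ramp r x)).
    apply: lipM wq _ (fun x => w1 _) _.
      move=> x y; rewrite [X in `|X|](_ : _ = ramp r y - ramp r x); last by ring.
      by rewrite l1B; exact: lip_ramp.
    by move=> x; have /andP[h1 h2] := ramp01 x r0; rewrite ger0_norm ?subr_ge0// gerBl.
  have kL' : lip (l1 q + 1) (fun x => w (dot q x) * (1 - ramp r x)).
    by apply: lip_le kL _; rewrite mulr1 mul1r lerD2l.
  have k1 x : `|w (dot q x) * (1 - ramp r x)| <= 1.
    have /andP[h1 h2] := ramp01 x r0.
    by rewrite normrM -[leRHS]mulr1 ler_pM// ger0_norm ?subr_ge0// gerBl.
  have lq : 0 <= l1 q + 1 by rewrite addr_ge0 ?l1_ge0.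
  have th := weighted_tame e0 lq kL' k1.
  have hE : (fun x => weight e x * (w (dot q x) * (1 - ramp r x))) = (fun x => f x - f x * ramp r x).
    by apply/funext => x; rewrite /f; ring.
  rewrite hE in th.
  have [_ h2i _] := th.
  exists (4 * n%:R * (2 * 1) * (n%:R * ((e * 1 + 1 * l1 q) * 1 + 1 * r^-1)) * mass * fine (leb (box r))).
  exists (fun x => f x * ramp r x); split => //.
  have Wri := rintegrableZl (2 / e / r) Wi.
  apply: (@le_trans _ _ (\int[leb]_x (2 / e / r * weight (e / 2) x))).
    apply: le_Rintegral => // x _; apply: le_trans (ramp_tail x e0 r0).
    have /andP[h1 h2] := ramp01 x r0.
    rewrite (_ : f x - f x * ramp r x = weight e x * (w (dot q x) * (1 - ramp r x))); last by rewrite /f; ring.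
    rewrite -(real_normK (num_real _)) normrM (gtr0_norm (weight_gt0 _ _)) exprMn.
    rewrite expr2 -mulrA ler_pM2l ?weight_gt0//.
    rewrite -[leRHS]mul1r ler_pM ?(ltW (weight_gt0 _ _))// ?sqr_ge0//.
      by rewrite weight_le1// ltW.
    rewrite normrM exprMn -[leRHS]mul1r ler_pM ?sqr_ge0//.
      by rewrite expr_le1.
    by rewrite ger0_norm ?subr_ge0// expr2 ler_piMl ?subr_ge0// gerBl.
  rewrite RintegralZl// mulrAC -/c ler_pdivrMr// /r mulrDr mulr1 mulrCA divff ?mulr1 ?gt_eqF//.
  by rewrite lerDr ltW.
split.
- apply: (pairing_limit (A := A) m0 mR mI phi2i fi) => d /main[A' [g [? ? ? ? ?]]].
  by exists A', g.
- apply: (pairing_limit (A := A) m0 mI _ _ fi) => [||d /main[A' [g [? ? ? ? ?]]]].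
  + exact: measurableT_comp.
  + by apply: eq_rintegrable phi2i => p; rewrite sqrrN [in RHS]addrC.
  + by exists A', g.
Qed.

End damped_waves.

(** * Transforms of damped waves *)

Section wave_transforms.
Context {R : realType} {n : nat}.
Hypothesis n0 : (0 < n)%N.
Local Notation V := 'rV[R]_n.
Local Notation leb := (lebesgue_rV R n).
Implicit Types (a b f g k : V -> R) (p q x y z : V) (A L M m r e d : R).

Lemma waveE e p q : 0 < e ->
  [/\ costr (fun x => weight e x * cos (dot q x)) p =
        (pker (fun=> e) p q + pker (fun=> e) p (- q)) / 2,
      sintr (fun x => weight e x * cos (dot q x)) p = 0,
      costr (fun x => weight e x * sin (dot q x)) p = 0 &
      sintr (fun x => weight e x * sin (dot q x)) p =
        (pker (fun=> e) p q - pker (fun=> e) p (- q)) / 2].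
Proof.
move=> e0.
have [c1 s1] := Rintegral_weight_cos_sin (p - q) e0.
have [c2 s2] := Rintegral_weight_cos_sin (p - - q) e0.
have ci1 := rintegrable_weight_cos (p - q) e0.
have ci2 := rintegrable_weight_cos (p - - q) e0.
have si1 := rintegrable_weight_sin (p - q) e0.
have si2 := rintegrable_weight_sin (p - - q) e0.
have dq x : dot x (- q) = - dot q x.
  by rewrite /dot -sumrN; apply: eq_bigr => i _; rewrite mxE mulrN mulrC.
have d1 x : dot x (p - q) = dot p x - dot q x by rewrite dotBr dotC [dot x q]dotC.
have d2 x : dot x (p - - q) = dot p x + dot q x by rewrite dotBr dq opprK dotC.
rewrite -pker_sub in c1; rewrite -pker_sub in c2.
split.
- rewrite -c1 -c2 -RintegralD// -RintegralZr//; last exact: rintegrableD.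
  by apply: eq_Rintegral => x _; rewrite d1 d2 cosB cosD; field.
- transitivity (\int[leb]_x ((weight e x * sin (dot x (p - q)) +
      weight e x * sin (dot x (p - - q))) / 2)).
    by apply: eq_Rintegral => x _; rewrite d1 d2 sinB sinD; field.
  rewrite RintegralZr//; last exact: rintegrableD.
  by rewrite RintegralD// s1 s2 addr0 mul0r.
- transitivity (\int[leb]_x ((weight e x * sin (dot x (p - - q)) -
      weight e x * sin (dot x (p - q))) / 2)).
    by apply: eq_Rintegral => x _; rewrite d1 d2 sinB sinD; field.
  rewrite RintegralZr//; last exact: rintegrableB.
  by rewrite RintegralB// s1 s2 subr0 mul0r.
- rewrite -c1 -c2 -RintegralB// -RintegralZr//; last exact: rintegrableB.
  by apply: eq_Rintegral => x _; rewrite d1 d2 cosB cosD; field.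
Qed.

(** Combining the cosine wave of the real pairing with the sine wave of the
    imaginary one isolates a single translate of the kernel. *)
Lemma pker_orthogonal m e a b q : 0 < m -> 0 < e ->
  measurable_fun setT a -> measurable_fun setT b ->
  rintegrable leb (fun p => (energy m p)^-1 * (a p ^+ 2 + b p ^+ 2)) ->
  pairing a b (fun x => weight e x * cos (dot q x)) = 0 ->
  pairing b (fun p => - a p) (fun x => weight e x * sin (dot q x)) = 0 ->
  rintegrable leb (fun p => a p * pker (fun=> e) p q) /\
  \int[leb]_p (a p * pker (fun=> e) p q) = 0.
Proof.
move=> m0 e0 ma mb abi P1 P2.
have tc := weighted_tame n0 e0 (l1_ge0 q) (lip_wave q (@cos_lip R))
  (fun x => normr_cos_le1 _).
have ts := weighted_tame n0 e0 (l1_ge0 q) (lip_wave q (@sin_lip R))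
  (fun x => normr_sin_le1 _).
have bai : rintegrable leb (fun p => (energy m p)^-1 * (b p ^+ 2 + (- a p) ^+ 2)).
  by apply: eq_rintegrable abi => p; rewrite sqrrN addrC.
have i1 := pairing_integrable m0 ma mb abi tc.
have mNa : measurable_fun setT (fun p => - a p) by exact: measurableT_comp.
have i2 := pairing_integrable m0 mb mNa bai ts.
have E p : a p * costr (fun x => weight e x * cos (dot q x)) p -
      b p * sintr (fun x => weight e x * cos (dot q x)) p +
    (b p * costr (fun x => weight e x * sin (dot q x)) p -
      - a p * sintr (fun x => weight e x * sin (dot q x)) p) =
    a p * pker (fun=> e) p q.
  by have [-> -> -> ->] := waveE p q e0; field.
split; first by apply: eq_rintegrable (rintegrableD i1 i2) => p; exact: E.
under eq_Rintegral do rewrite -E.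
by rewrite RintegralD// -[X in X + _]/(pairing _ _ _) P1 add0r; exact: P2.
Qed.

End wave_transforms.

(** * Averages of the Poisson kernel over an interval *)

Section box_averages.
Context {R : realType}.
Local Notation leb1 := (@lebesgue_measure R).
Implicit Types (e r s t A B : R).

Definition interval_average e A B t : R := \int[leb1]_s (\1_`[A, B]%classic s * poisson e (t - s)).

Lemma poisson_shift e t : (fun s => poisson e (t - s)) = (fun s => poisson e (s - t)).
Proof. by apply/funext => s; rewrite -poissonN opprB. Qed.

Lemma measurable_itvcc A B : measurable (`[A, B]%classic : set (measurableTypeR R)).
Proof. exact: measurable_itv. Qed.

Lemma indic01 T (D : set T) x : 0 <= (\1_D x : R) <= 1.
Proof. by rewrite indicE; case: (x \in D); rewrite /= ?lexx ?ler01. Qed.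

Lemma rintegrable_interval_average e A B t : 0 < e ->
  rintegrable leb1 (fun s => \1_`[A, B]%classic s * poisson e (t - s)).
Proof.
move=> e0; have [pi_ _] := Rintegral_poisson t e0; rewrite -poisson_shift in pi_.
apply: (rintegrable_bddM (B := 1) _ _ pi_).
  by apply: measurable_indic; exact: measurable_itvcc.
by move=> s; rewrite ger0_norm//; have /andP[] := indic01 `[A, B]%classic s.
Qed.

Lemma interval_average_ge0 e A B t : 0 < e -> 0 <= interval_average e A B t.
Proof.
by move=> e0; apply: Rintegral_ge0 => s _; rewrite mulr_ge0// ltW// poisson_gt0.
Qed.

Lemma measurable_interval_average e A B : 0 < e -> measurable_fun setT (interval_average e A B).
Proof.
move=> e0; apply: (@measurable_Rintegral _ _ _ _ R leb1
  (fun z : measurableTypeR R * measurableTypeR R => \1_`[A, B]%classic z.2 * poisson e (z.1 - z.2))).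
- apply: measurable_funM.
    have mi : measurable_fun setT (\1_`[A, B]%classic : measurableTypeR R -> R).
      by apply: measurable_indic; exact: measurable_itvcc.
    exact: (measurableT_comp mi measurable_snd).
  apply: (measurableT_comp (measurable_poisson e0)).
  by apply: measurable_funB; [exact: measurable_fst|exact: measurable_snd].
- by move=> t; exact: rintegrable_interval_average.
Qed.

(** A bound with separated variables on bounded sets of [s]; it is not uniform
    in [e]. *)
Lemma poisson_compare e r s t : 0 < e -> e <= 1 -> `|s| <= r ->
  poisson e (t - s) <= (2 + 2 * r ^+ 2) / e * poisson 1 t.
Proof.
move=> e0 e1 sr; rewrite /poisson expr1n mulr1.
have D1 := poisson_den_gt0 (t - s) e0; have D2 := poisson_den_gt0 t (@ltr01 R).
rewrite expr1n in D2.
have s2 : s ^+ 2 <= r ^+ 2.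
  by rewrite -(real_normK (num_real s)) lerXn2r ?nnegrE// (le_trans _ sr).
have e2 : e ^+ 2 <= 1 by rewrite expr_le1// ltW.
rewrite ler_pdivrMr// [leRHS](_ : _ = 2 * (2 + 2 * r ^+ 2) * (e ^+ 2 + (t - s) ^+ 2) / (1 + t ^+ 2) / e);
  last by field; rewrite !gt_eqF.
rewrite ler_pdivlMr// ler_pdivlMr//.
have E : e ^+ 2 * (1 + t ^+ 2) <= (2 + 2 * r ^+ 2) * (e ^+ 2 + (t - s) ^+ 2).
  have t2 : t ^+ 2 <= 2 * (t - s) ^+ 2 + 2 * r ^+ 2.
    rewrite (le_trans (y := 2 * (t - s) ^+ 2 + 2 * s ^+ 2))//; last by rewrite lerD2l ler_pM2l.
    rewrite -subr_ge0 [leRHS](_ : _ = (t - 2 * s) ^+ 2); last by ring.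
    exact: sqr_ge0.
  have u2 := sqr_ge0 (t - s); have r2 := sqr_ge0 r; have ee := sqr_ge0 e.
  move: (e ^+ 2) (t ^+ 2) ((t - s) ^+ 2) (r ^+ 2) e2 t2 u2 r2 ee => a b c d *; nra.
rewrite (_ : 2 * e * e * (1 + t ^+ 2) = 2 * (e ^+ 2 * (1 + t ^+ 2))); last by ring.
by rewrite -mulrA ler_pM2l.
Qed.

Lemma Rintegral_indic_itv_le A B r : 0 <= r -> `|A| <= r -> `|B| <= r ->
  rintegrable leb1 (\1_`[A, B]%classic : R -> R) /\
  \int[leb1]_s (\1_`[A, B]%classic s : R) <= 2 * r.
Proof.
move=> r0 /ler_normlP[A1 A2] /ler_normlP[B1 B2].
have I1 : rintegrable leb1 (\1_`[A, B]%classic : R -> R) by exact: integrable_indic_itv.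
have I2 : rintegrable leb1 (\1_`[- r, r]%classic : R -> R) by exact: integrable_indic_itv.
split => //; apply: (@le_trans _ _ (\int[leb1]_s (\1_`[- r, r]%classic s : R))).
  apply: le_Rintegral => // s _; rewrite !indicE ler_nat.
  have [sAB|sAB] := pselect (`[A, B]%classic s); last by rewrite (memNset sAB).
  rewrite (mem_set (A := `[- r, r]%classic)) ?leq_b1//.
  by move: sAB; rewrite /= !in_itv/= => /andP[h1 h2]; apply/andP; split; lra.
by rewrite -lee_fin EFin_Rintegral// integral_indic// setIT [X in (X <= _)%E](lebesgue_itvNr r0).
Qed.

(** Averages of the kernel over a bounded interval decay like the kernel,
    uniformly in its width: multiply by 1 + t^2 and use t^2 <= 2 (t - s)^2 + 2 s^2,
    where (t - s)^2 poisson e (t - s) <= 2 e. *)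
Lemma interval_average_le e A B r t : 0 < e -> e <= 1 -> 0 <= r -> `|A| <= r -> `|B| <= r ->
  interval_average e A B t <= ((1 + 2 * r ^+ 2) * pi + 4 * r) * poisson 1 t.
Proof.
move=> e0 e1 r0 Ar Br.
have ti := rintegrable_interval_average A B t e0.
have [Ii IE] := Rintegral_indic_itv_le r0 Ar Br.
have [pi_ piE] := Rintegral_poisson t e0; rewrite -poisson_shift in pi_ piE.
have D2 := poisson_den_gt0 t (@ltr01 R); rewrite expr1n in D2.
have bi := rintegrableD (rintegrableZl (1 + 2 * r ^+ 2) pi_) (rintegrableZl 4 Ii).
suff : (1 + t ^+ 2) * interval_average e A B t <= (1 + 2 * r ^+ 2) * (2 * pi) + 4 * (2 * r).
  rewrite -ler_pdivlMl// => /le_trans; apply; rewrite le_eqVlt /poisson expr1n mulr1.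
  by apply/orP; left; apply/eqP; field; rewrite gt_eqF.
rewrite /interval_average -RintegralZl//.
apply: (@le_trans _ _ (\int[leb1]_s ((1 + 2 * r ^+ 2) * poisson e (t - s) + 4 * \1_`[A, B]%classic s))).
  apply: le_Rintegral => //; first exact: rintegrableZl.
  move=> s _; have k0 := poisson_gt0 (t - s) e0.
  have r2 := sqr_ge0 r.
  have [sAB|sAB] := pselect (`[A, B]%classic s); last first.
    by rewrite indicE (memNset sAB) mul0r !mulr0 addr0 mulr_ge0 ?(ltW k0)// addr_ge0// mulr_ge0.
  rewrite indicE (mem_set sAB) mul1r mulr1.
  have sr : s ^+ 2 <= r ^+ 2.
    rewrite -(real_normK (num_real s)) lerXn2r ?nnegrE//.
    move: sAB Ar Br; rewrite /= in_itv/= !ler_norml => /andP[h1 h2] /andP[h3 h4] /andP[h5 h6].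
    by apply/andP; split; lra.
  have k2 : (t - s) ^+ 2 * poisson e (t - s) <= 2.
    rewrite /poisson mulrA ler_pdivrMr ?poisson_den_gt0//.
    have u2 := sqr_ge0 (t - s); have ee := sqr_ge0 e.
    rewrite (@le_trans _ _ (2 * (t - s) ^+ 2))//; last by rewrite ler_pM2l// lerDr.
    by rewrite mulrC -mulrA ler_pM2l// ler_piMl.
  rewrite (@le_trans _ _ ((1 + 2 * r ^+ 2 + 2 * (t - s) ^+ 2) * poisson e (t - s)))//.
    rewrite ler_pM2r// -addrA lerD2l.
    have : 0 <= (t - 2 * s) ^+ 2 by exact: sqr_ge0.
    rewrite (_ : (t - 2 * s) ^+ 2 = 2 * (t - s) ^+ 2 + 2 * s ^+ 2 - t ^+ 2); last by ring.
    by move: sr; move: (s ^+ 2) (r ^+ 2) (t ^+ 2) ((t - s) ^+ 2) => a b c d; lra.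
  rewrite mulrDl lerD2l -mulrA (_ : 4 = 2 * 2 :> R); last by ring.
  by rewrite ler_pM2l.
rewrite RintegralD//; [|exact: rintegrableZl|exact: rintegrableZl].
by rewrite RintegralZl// piE RintegralZl// lerD2l ler_pM2l.
Qed.

(** At distance [d] from the endpoints, the average differs from its limit by
    values of the kernel at arguments at least [d], which are O(e). *)
Lemma interval_average_cvg A B t : t != A -> t != B ->
  interval_average (k.+1%:R^-1) A B t @[k --> \oo] --> (2 * pi * \1_`[A, B]%classic t : R).
Proof.
move=> tA tB; pose d := Num.min `|t - A| `|t - B|.
have d0 : 0 < d by rewrite lt_min !normr_gt0 !subr_eq0 tA tB.
pose C := (1 + d ^- 2) * (2 * pi).
have [pi1 pi1E] := Rintegral_poisson t (@ltr01 R); rewrite -poisson_shift in pi1 pi1E.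
have bound e : 0 < e -> `|interval_average e A B t - 2 * pi * \1_`[A, B]%classic t| <= e * C.
  move=> e0; have [pi_ piE] := Rintegral_poisson t e0; rewrite -poisson_shift in pi_ piE.
  have ti := rintegrable_interval_average A B t e0.
  have -> : interval_average e A B t - 2 * pi * \1_`[A, B]%classic t =
      \int[leb1]_s (\1_`[A, B]%classic s * poisson e (t - s) -
        poisson e (t - s) * \1_`[A, B]%classic t).
    rewrite RintegralB//; last exact: rintegrableZr.
    by rewrite RintegralZr// piE.
  rewrite /C mulrA -pi1E -RintegralZl//.
  apply: le_Rintegral_dom.
  - exact: rintegrable_measurable (rintegrableB ti (rintegrableZr _ pi_)).
  - exact: rintegrableZl.
  move=> s; have k0 := poisson_gt0 (t - s) e0; have k1 := poisson_gt0 (t - s) (@ltr01 R).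
  have pos : 0 <= e * (1 + d ^- 2) * poisson 1 (t - s).
    have dd0 : 0 <= 1 + d ^- 2 by rewrite addr_ge0// invr_ge0 exprn_ge0// ltW.
    by rewrite mulr_ge0 ?(ltW k1)// mulr_ge0// ltW.
  have far : d <= `|t - s| -> poisson e (t - s) <= e * (1 + d ^- 2) * poisson 1 (t - s).
    move=> ds; have u0 : 0 < (t - s) ^+ 2.
      by rewrite -(real_normK (num_real (t - s))) exprn_gt0// (lt_le_trans d0).
    have du : d ^+ 2 <= (t - s) ^+ 2.
      by rewrite -(real_normK (num_real (t - s))) lerXn2r ?nnegrE ?(ltW d0).
    have dd : 0 < d ^+ 2 by rewrite exprn_gt0.
    rewrite /poisson expr1n mulr1 [leRHS](_ : _ = 2 * e * ((1 + d ^- 2) / (1 + (t - s) ^+ 2))); last by ring.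
    rewrite ler_pM2l ?mulr_gt0// -[leLHS]mul1r.
    rewrite ler_pdivrMr ?poisson_den_gt0// mulrAC ler_pdivlMr ?mul1r; last by rewrite addr_gt0.
    rewrite (@le_trans _ _ ((1 + d ^- 2) * (t - s) ^+ 2))//.
      rewrite mulrDl mul1r addrC lerD2l mulrC ler_pdivlMr// mul1r.
      exact: du.
    rewrite ler_pM2l; last by rewrite addr_gt0// invr_gt0.
    by rewrite lerDr sqr_ge0.
  (* the two indicators differ only across an endpoint, hence far from t *)
  have away : (A <= s <= B) != (A <= t <= B) -> d <= `|t - s|.
    have n1 := ler_norm (t - s); have n2 := ler_norm (s - t); rewrite distrC in n2.
    have n3 := normr_ge0 (t - s); rewrite /d ge_min => H; apply/orP.
    have [h1|h1] := ltP t A; [|have [h2|h2] := ltP B t].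
    - left; rewrite ler_norml; apply/andP; split; last by lra.
      move: H; rewrite [A <= t]leNgt h1/= eqbF_neg negbK => /andP[? ?]; lra.
    - right; rewrite ler_norml; apply/andP; split; first by lra.
      move: H; rewrite [t <= B]leNgt h2/= andbF eqbF_neg negbK => /andP[? ?]; lra.
    - move: H; rewrite h1 h2/= eqb_id negb_and -!ltNge => /orP[h3|h3].
        by left; rewrite ler_norml; apply/andP; split; lra.
      by right; rewrite ler_norml; apply/andP; split; lra.
  have indE u : (\1_`[A, B]%classic u : R) = (A <= u <= B)%R%:R.
    by rewrite indicE mem_setE.
  rewrite !indE; move: away; have [->|_] := eqVneq (A <= s <= B) (A <= t <= B).
    by move=> _; rewrite mulrC subrr normr0.
  move=> /(_ isT)/far fark; case: (A <= s <= B); case: (A <= t <= B);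
    rewrite ?(mul1r, mulr1, mul0r, mulr0, subr0, sub0r, normrN, subrr, normr0)// gtr0_norm//.
have : (k.+1%:R^-1 * C : R) @[k --> \oo] --> (0 : R).
  by rewrite -[X in _ --> X](mul0r C); apply: cvgMr_tmp; exact: cvg_harmonic.
move=> /cvgrPdist_le H; apply/cvgrPdist_le => /= eps eps0.
move: (H eps eps0); apply: filterS => k; rewrite sub0r normrN => /(le_trans (ler_norm _)).
by apply: le_trans; rewrite distrC bound// invr_gt0.
Qed.

End box_averages.

(** * From kernels to bricks to functions *)

Section kernel_test.
Context {R : realType} {n : nat}.
Local Notation V := 'rV[R]_n.
Local Notation leb := (lebesgue_rV R n).
Implicit Types (a : V -> R) (al be : 'I_n -> R).

Definition brick al be : set V := [set x | forall i, al i <= x ord0 i <= be i].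

Lemma indic_brick al be x :
  (\1_(brick al be) x : R) = \prod_(i < n) \1_`[al i, be i]%classic (x ord0 i).
Proof.
rewrite indicE; have [xb|xb] := pselect (brick al be x).
  rewrite mem_set// big1// => i _; rewrite indicE mem_set//= in_itv/=.
  exact: xb.
rewrite memNset//; move/existsNP: xb => [i xi].
by rewrite (bigD1 i)//= indicE memNset ?mul0r//= in_itv.
Qed.

Lemma measurable_brick al be : measurable (brick al be).
Proof.
rewrite (_ : brick _ _ = \bigcap_i [set x : V | al i <= x ord0 i <= be i]); last first.
  by apply/seteqP; split => [x xr i _|x xr i]; [exact: xr|exact: (xr i)].
apply: fin_bigcap_measurable => // i _.
have := @measurable_coord R n i measurableT _ (measurable_itv `[al i, be i]%R); rewrite setTI.
by rewrite /preimage/= (_ : [set x | _] = [set x : V | al i <= x ord0 i <= be i])//;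
  apply/seteqP; split => x /=; rewrite in_itv.
Qed.

Lemma negligible_coord i (t : R) : leb.-negligible [set x : V | x ord0 i = t].
Proof.
pose A j : set (measurableTypeR R) := if j == i then [set t] else setT.
have mA j : measurable (A j) by rewrite /A; case: ifP => // _; exact: measurable_set1.
exists [set x : V | forall j, A j (x ord0 j)]; split.
- rewrite (_ : [set x | _] = \bigcap_j [set x : V | A j (x ord0 j)]); last first.
    by apply/seteqP; split => [x xr j _|x xr j]; [exact: xr|exact: (xr j)].
  apply: fin_bigcap_measurable; first exact: finite_finset.
  move=> j _; rewrite -[X in measurable X]setTI.
  exact: (measurable_coord j measurableT (mA j)).
- rewrite lebesgue_rV_box// (bigD1 i)//= /A eqxx.
  by rewrite lebesgue_measure_set1 mul0e.
- by move=> x /= xt j; rewrite /A; case: eqP => // ->.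
Qed.

Lemma ae_coord_neq al : {ae leb, forall x : V, forall i, x ord0 i != al i}.
Proof.
apply: filter_forall => i; apply: negligibleS (negligible_coord i (al i)).
by move=> x /= /negP; rewrite negbK => /eqP.
Qed.

Lemma Rintegral_brick_pker e al be p : 0 < e ->
  rintegrable leb (fun q => \1_(brick al be) q * pker (fun=> e) p q) /\
  \int[leb]_q (\1_(brick al be) q * pker (fun=> e) p q) =
    \prod_(i < n) interval_average e (al i) (be i) (p ord0 i).
Proof.
move=> e0.
have [I1 I2] := @Rintegral_rV_prod R n
  (fun i s => \1_`[al i, be i]%classic s * poisson e (p ord0 i - s))
  (fun i => rintegrable_interval_average (al i) (be i) (p ord0 i) e0).
have E : (fun q : V => \prod_(i < n) (\1_`[al i, be i]%classic (q ord0 i) *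
    poisson e (p ord0 i - q ord0 i))) = (fun q => \1_(brick al be) q * pker (fun=> e) p q).
  by apply/funext => q; rewrite indic_brick /pker big_split.
by rewrite -E; split => //; exact: I2.
Qed.

Lemma brick_bounded al be :
  exists2 r : R, 0 <= r & forall i, `|al i| <= r /\ `|be i| <= r.
Proof.
exists (\sum_i (`|al i| + `|be i|)); first by apply: sumr_ge0 => i _; rewrite addr_ge0.
move=> i; have H : `|al i| + `|be i| <= \sum_i (`|al i| + `|be i|).
  by rewrite (bigD1 i)//= lerDl; apply: sumr_ge0 => j _; rewrite addr_ge0.
by split; apply: le_trans H; rewrite ?lerDl ?lerDr.
Qed.

Lemma rintegrable_brick al be : rintegrable leb (\1_(brick al be) : V -> R).
Proof.
have [r r0 Hr] := brick_bounded al be.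
have [I1 _] := @Rintegral_rV_prod R n (fun i s => \1_`[al i, be i]%classic s)
  (fun i => (Rintegral_indic_itv_le r0 (Hr i).1 (Hr i).2).1).
by apply: eq_rintegrable I1 => x; rewrite indic_brick.
Qed.

(** Integrate over [q] in a brick the orthogonality to the kernel centred
    at [q]. *)
Lemma Rintegral_interval_average0 a e al be : 0 < e -> e <= 1 ->
  measurable_fun setT a ->
  rintegrable leb (fun p => a p * pker (fun=> 1) p 0) ->
  (forall q, \int[leb]_p (a p * pker (fun=> e) p q) = 0) ->
  \int[leb]_p (a p * \prod_(i < n) interval_average e (al i) (be i) (p ord0 i)) = 0.
Proof.
move=> e0 e1 ma a1 a0; have [r r0 Hr] := brick_bounded al be.
pose K := \prod_(i < n) ((2 + 2 * r ^+ 2) / e).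
have Kle p q : brick al be q -> pker (fun=> e) p q <= K * pker (fun=> 1) p 0.
  move=> qb; rewrite /pker /K -big_split; apply: ler_prod => i _.
  rewrite (ltW (poisson_gt0 _ e0))/= [X in poisson 1 (_ - X)]mxE subr0 poisson_compare//.
  have /andP[q1 q2] := qb i; have [] := Hr i; rewrite !ler_norml => /andP[h1 h2] /andP[h3 h4].
  by apply/andP; split; lra.
pose f (z : V * V) := a z.1 * (\1_(brick al be) z.2 * pker (fun=> e) z.1 z.2).
have mf : measurable_fun setT f.
  apply: measurable_funM; first exact: (measurableT_comp ma measurable_fst).
  apply: measurable_funM; last by apply: measurable_pker.
  have mi : measurable_fun setT (\1_(brick al be) : V -> R).
    by apply: measurable_indic; exact: measurable_brick.
  exact: (measurableT_comp mi measurable_snd).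
have gi : rintegrable leb (fun p => K * `|a p * pker (fun=> 1) p 0|).
  by apply: rintegrableZl; exact: rintegrable_norm.
have [|_ _ E _] := rfubini_dom mf gi (rintegrable_brick al be).
  move=> p q; rewrite /f/= !normrM.
  rewrite (gtr0_norm (pker_gt0 (e := fun=> e) p q (fun=> e0))).
  rewrite (gtr0_norm (pker_gt0 (e := fun=> 1) p 0 (fun=> ltr01))).
  have [qb|qb] := pselect (brick al be q); last first.
    by rewrite indicE memNset// normr0 mul0r !mulr0.
  rewrite indicE mem_set// normr1 mul1r mulr1 mulrCA.
  by rewrite ler_wpM2l// Kle.
transitivity (\int[leb]_p \int[leb]_q f (p, q)).
  apply: eq_Rintegral => p _; rewrite /f/= RintegralZl//; last first.
    exact: (Rintegral_brick_pker al be p e0).1.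
  by rewrite (Rintegral_brick_pker al be p e0).2.
rewrite E.
have z : \int[leb]_(_ in setT) (0 : R) = 0 by rewrite /Rintegral integral0.
rewrite -[RHS]z; apply: eq_Rintegral => q _; rewrite /f/=.
transitivity (\int[leb]_p (\1_(brick al be) q * (a p * pker (fun=> e) p q))).
  by apply: eq_Rintegral => p _; rewrite mulrCA.
have [qb|qb] := pselect (brick al be q).
  by rewrite indicE mem_set//; under eq_Rintegral do rewrite mul1r.
rewrite indicE memNset//; under eq_Rintegral do rewrite mul0r.
exact: z.
Qed.

Lemma rintegrable_brickM a al be : measurable_fun setT a ->
  rintegrable leb (fun p => a p * pker (fun=> 1) p 0) ->
  rintegrable leb (fun p => a p * \1_(brick al be) p).
Proof.
move=> ma a1; have [r r0 Hr] := brick_bounded al be.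
pose K := \prod_(i < n) ((1 + r ^+ 2) / 2).
have K1 p : brick al be p -> 1 <= K * pker (fun=> 1) p 0.
  move=> pb; rewrite /K /pker -big_split/= -[leLHS](@big1 R 1 *%R _ (index_enum 'I_n) xpredT (fun=> 1))//.
  apply: ler_prod => i _; rewrite ler01/= [X in poisson 1 (_ - X)]mxE subr0.
  rewrite /poisson mulr1 expr1n mulrA divfK// ler_pdivlMr; last by rewrite ltr_pwDl ?sqr_ge0.
  rewrite mul1r lerD2l -(real_normK (num_real (p ord0 i))) lerXn2r ?nnegrE//.
  have /andP[q1 q2] := pb i; have [] := Hr i; rewrite !ler_norml => /andP[h1 h2] /andP[h3 h4].
  by apply/andP; split; lra.
apply: (@rintegrable_dom _ _ _ _ _ (fun p => K * `|a p * pker (fun=> 1) p 0|)).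
- apply: measurable_funM => //.
  by apply: measurable_indic; exact: measurable_brick.
- by apply: rintegrableZl; exact: rintegrable_norm.
move=> p; rewrite !normrM mulrCA ler_wpM2l//.
rewrite (gtr0_norm (pker_gt0 (e := fun=> 1) p 0 (fun=> ltr01))).
have [pb|pb] := pselect (brick al be p).
  by rewrite indicE mem_set// normr1 K1.
rewrite indicE memNset// normr0 mulr_ge0 ?(ltW (pker_gt0 _ _ _))//.
by apply: prodr_ge0 => i _; rewrite divr_ge0// addr_ge0// sqr_ge0.
Qed.

(** As [e] tends to 0 the averaged kernels tend to a multiple of the indicator of
    the brick off finitely many hyperplanes, dominated by [interval_average_le]. *)
Lemma Rintegral_brick0 a al be : measurable_fun setT a ->
  rintegrable leb (fun p => a p * pker (fun=> 1) p 0) ->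
  (forall e q, 0 < e -> \int[leb]_p (a p * pker (fun=> e) p q) = 0) ->
  \int[leb]_p (a p * \1_(brick al be) p) = 0.
Proof.
move=> ma a1 a0; have [r r0 Hr] := brick_bounded al be.
pose C := (1 + 2 * r ^+ 2) * pi + 4 * r.
have C0 : 0 <= C.
  by rewrite addr_ge0 ?mulr_ge0 ?pi_ge0// addr_ge0// mulr_ge0// sqr_ge0.
pose F k p := a p * \prod_(i < n) interval_average k.+1%:R^-1 (al i) (be i) (p ord0 i).
have mtheta k : measurable_fun setT (fun p : V =>
    \prod_(i < n) interval_average k.+1%:R^-1 (al i) (be i) (p ord0 i)).
  apply: (@measurable_prod _ _ _ _ _ (index_enum 'I_n)
    (fun i (p : V) => interval_average k.+1%:R^-1 (al i) (be i) (p ord0 i))) => i _.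
  have mt := measurable_interval_average (al i) (be i) (@invSn_gt0 R k).
  exact: (measurableT_comp mt (measurable_coord i)).
have : \int[leb]_p F k p @[k --> \oo] -->
    \int[leb]_p (mass R n * (a p * \1_(brick al be) p)).
  apply: (@Rintegral_dominated _ _ _ _ _ _ (fun p => C ^+ n * `|a p * pker (fun=> 1) p 0|)).
  - by move=> k; exact: measurable_funM.
  - apply: measurable_funM => //; apply: measurable_funM => //.
    by apply: measurable_indic; exact: measurable_brick.
  - by apply: rintegrableZl; exact: rintegrable_norm.
  - apply: filterS2 (ae_coord_neq al) (ae_coord_neq be) => p pa pb.
    rewrite mulrCA; apply: cvgMl_tmp; rewrite indic_brick /mass.
    rewrite -[n in _ ^+ n]card_ord -prodr_const -big_split/=.
    apply: cvg_big; first exact: mul_continuous.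
    by move=> i _; exact: interval_average_cvg.
  - move=> k p; rewrite /F !normrM mulrCA ler_wpM2l//.
    rewrite (gtr0_norm (pker_gt0 (e := fun=> 1) p 0 (fun=> ltr01))).
    rewrite -[n in _ ^+ n]card_ord -prodr_const normr_prod -big_split/=.
    apply: ler_prod => i _; rewrite normr_ge0/= ger0_norm ?interval_average_ge0 ?invSn_gt0//.
    rewrite mxE subr0 /C interval_average_le ?invSn_gt0//; [|exact: (Hr i).1|exact: (Hr i).2].
    by rewrite invf_le1// ler1n.
rewrite (_ : (fun k => _) = fun=> 0); last first.
  apply/funext => k; apply: Rintegral_interval_average0 => //.
    by rewrite invf_le1// ler1n.
  by move=> q; rewrite a0// invSn_gt0.
move=> L; have L' : (0 : R) @[k --> \oo] --> (0 : R) by exact: cvg_cst.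
have : \int[leb]_p (mass R n * (a p * \1_(brick al be) p)) = 0 by exact: (cvg_unique _ L L').
rewrite RintegralZl//; last exact: rintegrable_brickM.
by move=> /eqP; rewrite mulf_eq0 gt_eqF ?mass_gt0//= => /eqP.
Qed.

Lemma brickI al be al' be' : brick al be `&` brick al' be' =
  brick (fun i => Num.max (al i) (al' i)) (fun i => Num.min (be i) (be' i)).
Proof.
apply/seteqP; split => x /=.
  by move=> [h h'] i; rewrite ge_max le_min; have /andP[-> ->] := h i; have /andP[-> ->] := h' i.
move=> h; split => i; have := h i; rewrite ge_max le_min => /andP[/andP[h1 h2] /andP[h3 h4]];
  by apply/andP; split.
Qed.

Lemma brick_exhaust x : exists k : nat, brick (fun=> - k%:R) (fun=> k%:R) x.
Proof.
exists (Num.truncn (l1 x)).+1 => j; rewrite -ler_norml.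
by rewrite (le_trans (le_coord_l1 x j))// ltW// truncnS_gt.
Qed.

Definition bricks : set (set V) := [set B | exists al be, B = brick al be].

(** A half-space bounded by a coordinate hyperplane is a countable union of
    bricks. *)
Lemma measurable_bricks : (measurable : set (set V)) = <<s bricks >>.
Proof.
apply/seteqP; split; last first.
  apply: smallest_sub; first exact: sigma_algebra_measurable.
  by move=> _ [al [be ->]]; exact: measurable_brick.
have mid : measurable_fun setT (id : g_sigma_algebraType bricks -> V).
  apply: measurable_fun_rV => i.
  apply: (measurability _ (RGenCInfty.measurableE R)).
  move=> _ [_ [c ->] <-]; rewrite setTI.
  rewrite (_ : _ @^-1` _ = \bigcup_(k in @setT nat)
      brick (fun j => if j == i then c else - k%:R) (fun=> k%:R)).
    apply: bigcupT_measurable => k; apply: sub_sigma_algebra.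
    by eexists; eexists.
  apply/seteqP; split => x /=; last first.
    by move=> [k _ /(_ i)]; rewrite eqxx in_itv/= andbT => /andP[].
  rewrite in_itv/= andbT => cx.
  have [k xk] := brick_exhaust x; exists k => // j; have /andP[h1 h2] := xk j.
  by apply/andP; split => //; case: eqP => // ->.
by move=> A mA; have := mid measurableT A mA; rewrite setTI.
Qed.

Lemma bricks_setI : setI_closed bricks.
Proof. by move=> _ _ [al [be ->]] [al' [be' ->]]; rewrite brickI; eexists; eexists. Qed.

(** Bricks form a pi-system generating the Borel sets, and the sets over which
    an integrable function has zero integral form a lambda-system. *)
Lemma ae_eq0_bricks a : rintegrable leb a -> \int[leb]_p a p = 0 ->
  (forall al be, \int[leb]_p (a p * \1_(brick al be) p) = 0) ->
  {ae leb, forall p, a p = 0}.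
Proof.
move=> ai aT aB.
have aE A : measurable A -> (\int[leb]_(p in A) (a p)%:E = 0)%E.
  move=> mA; have := mA; rewrite measurable_bricks; move: A {mA}.
  apply: (dynkin_induction measurable_bricks bricks_setI).
  - by rewrite -EFin_Rintegral// aT.
  - move=> _ [al [be ->]]; rewrite integral_mkcond.
    rewrite -(_ : (\int[leb]_p (a p * \1_(brick al be) p))%:E = 0%E); last by rewrite aB.
    rewrite EFin_Rintegral; last first.
      apply: rintegrable_dom (rintegrable_norm ai) _.
        apply: measurable_funM; first exact: rintegrable_measurable ai.
        by apply: measurable_indic; exact: measurable_brick.
      move=> p; rewrite normrM ler_piMr// ger0_norm;
        by have := @indic01 R _ (brick al be) p; move=> /andP[].
    apply: eq_integral => p _; rewrite patchE indicE.
    by case: ifP => /= _; rewrite ?mulr1 ?mulr0.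
  - move=> A mA A0.
    have := integral_setU leb mA (measurableC mA) (f := EFin \o a).
    rewrite setUv A0 add0e -EFin_Rintegral// aT => <- //.
      by apply/measurable_EFinP; exact: rintegrable_measurable ai.
    by apply/disj_set2P; rewrite setICr.
  - move=> F mF tF F0; rewrite integral_bigcup//.
    + by apply: eseries0 => i _ _; exact: F0.
    + apply: integrableS ai => //; exact: bigcupT_measurable.
have := @integral_ae_eq _ _ _ leb setT measurableT (cst 0%E) (EFin \o a) ai.
move=> /(_ (measurable_cst _)) H; have {H} := H _.
move=> H; have {H} : ae_eq leb setT (EFin \o a) (cst 0%E).
  by apply: H => A _ mA; rewrite aE// integral0.
by apply: filterS => p /= /(_ I) [].
Qed.

End kernel_test.

(** * The intersection *)

Section intersection.
Context {R : realType} {n : nat}.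
Local Notation V := 'rV[R]_n.
Local Notation leb := (lebesgue_rV R n).
Local Notation Re := (@complex.Re R).
Local Notation Im := (@complex.Im R).
Implicit Types (a b : V -> R) (phi : V -> R[i]) (m : R) (S T : set V).

(** The kernel integrals determine the integrals over bricks, and these
    determine the function on every brick of an exhausting sequence. *)
Lemma pker_orthogonal_eq0 a : measurable_fun setT a ->
  (forall e q, 0 < e -> rintegrable leb (fun p => a p * pker (fun=> e) p q) /\
    \int[leb]_p (a p * pker (fun=> e) p q) = 0) ->
  {ae leb, forall p, a p = 0}.
Proof.
move=> ma H; have a1 := (H 1 0 ltr01).1.
have aB al be := Rintegral_brick0 al be ma a1 (fun e q e0 => (H e q e0).2).
pose N k := brick (fun=> - k%:R) (fun=> k%:R) : set V.
have aN k : {ae leb, forall p, a p * \1_(N k) p = 0}.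
  apply: ae_eq0_bricks; first exact: rintegrable_brickM.
    exact: aB.
  move=> al be; rewrite -(aB (fun i => Num.max (- k%:R) (al i)) (fun i => Num.min k%:R (be i))).
  by apply: eq_Rintegral => p _; rewrite -brickI indicI/= mulrA.
have := ae_foralln aN; apply: filterS => p ap.
have [k pN] := brick_exhaust p.
by have := ap k; rewrite indicE mem_set// mulr1.
Qed.

Lemma Hspace_disjoint m S T phi : (0 < n)%N -> 0 < m ->
  S `&` T = set0 -> piecewise_linear (boundary S) ->
  Hspace m S phi -> Hspace m T phi -> {ae leb, forall p, phi p = 0}.
Proof.
move=> n0 m0 ST plS HS HT; have phi2 : L2r m phi by have [] := HS.
have [mR mI] := phi2.1; have phii := L2r_msq m0 phi2.
have P w e q (e0 : 0 < e) := @pairing_wave0 R n n0 m S T phi w e q m0 e0 ST plS HS HT.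
have aR : {ae leb, forall p, Re (phi p) = 0}.
  apply: pker_orthogonal_eq0 => // e q e0.
  have [P1 _] := P _ _ q e0 (@cos_lip R) (@normr_cos_le1 R).
  have [_ P2] := P _ _ q e0 (@sin_lip R) (@normr_sin_le1 R).
  exact: (@pker_orthogonal R n n0 m e (Re \o phi) (Im \o phi) q m0 e0 mR mI phii P1 P2).
have aI : {ae leb, forall p, Im (phi p) = 0}.
  apply: pker_orthogonal_eq0 => // e q e0.
  have [_ P1] := P _ _ q e0 (@cos_lip R) (@normr_cos_le1 R).
  have [P2 _] := P _ _ q e0 (@sin_lip R) (@normr_sin_le1 R).
  apply: (@pker_orthogonal R n n0 m e (Im \o phi) (fun p => - Re (phi p)) q m0 e0 mI _ _ P1).
  - exact: measurableT_comp.
  - by apply: eq_rintegrable phii => p; rewrite /msq sqrrN addrC.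
  - have ts := weighted_tame n0 e0 (l1_ge0 q) (lip_wave q (@sin_lip R))
      (fun x => normr_sin_le1 _).
    rewrite -[RHS]oppr0 -P2 /pairing -RintegralN; last exact: pairing_integrable m0 mR mI phii ts.
    by apply: eq_Rintegral => p _ /=; ring.
by apply: filterS2 aR aI => p; case: (phi p) => /= s t -> ->.
Qed.

Lemma L2_0 : L2 (fun _ : V => 0 : R[i]).
Proof.
have m0 : cmeasurable (fun _ : V => 0 : R[i]) by split; exact: measurable_cst.
split => //; rewrite L2normE /msq/= expr0n/= addr0 integral0.
by rewrite poweR0r// invr_neq0.
Qed.

Lemma rnorm_null m phi : 0 < m -> null_space phi -> rnorm m phi = 0%E.
Proof.
move=> m0 [mphi phi0]; rewrite rnormE (@ae_eq_integral _ _ _ leb setT (cst 0%E))//.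
- by rewrite integral0 poweR0r// invr_neq0.
- apply/measurable_EFinP; apply: measurable_funM; last exact: measurable_msq.
  exact: measurable_energyV.
- by apply: filterS phi0 => p phip _; rewrite /= /msq phip/= expr0n/= addr0 mulr0.
Qed.

Lemma fourier_0 : fourier (fun _ : V => 0 : R[i]) (fun _ => 0).
Proof.
split; [exact: L2_0|exact: L2_0|exists (fun _ _ => 0)].
have L0 : L2norm (fun _ : V => 0 : R[i]) = 0%E.
  rewrite L2normE /msq/= expr0n/= addr0 integral0 poweR0r// invr_neq0//.
have F0 : fourier_L1 (fun _ : V => 0 : R[i]) = fun _ => 0.
  apply/funext => p; rewrite /fourier_L1; under eq_fun do rewrite mulr0.
  by rewrite /cintegral/= /Rintegral integral0 mulr0.
have E : (fun _ : V => 0 : R[i]) \- (fun _ => 0) = fun _ => 0 by apply/funext => x /=; rewrite subr0.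
split.
- move=> _; split; first exact: L2_0.
  by split; exact: integrable0.
- by rewrite E L0; exact: cvg_cst.
- by rewrite F0 E L0; exact: cvg_cst.
Qed.

(** The function 0 is its own approximant. *)
Lemma null_space_Hspace m S phi : 0 < m -> null_space phi -> Hspace m S phi.
Proof.
move=> m0 phi0; have r0 := rnorm_null m0 phi0; split.
  by split; [exact: phi0.1|rewrite r0].
move=> e e0; exists (fun _ => 0), (fun _ => 0); split; last 1 first.
- rewrite (_ : phi \- _ = phi) ?r0 ?lte_fin//.
  by apply/funext => x /=; rewrite subr0.
- by split; [exact: L2_0|apply: aeW].
- exact: fourier_0.
Qed.

End intersection.

Theorem proposition7 (R : realType) (n : nat) (m : R) (S T : set 'rV[R]_n) :
  (1 <= n)%N -> 0 < m ->
  lebesgue_measurable S -> lebesgue_measurable T ->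
  S `&` T = set0 ->
  piecewise_linear (boundary S) ->
  Hspace m S `&` Hspace m T = null_space.
Proof.
move=> n0 m0 _ _ ST plS; apply/seteqP; split => phi.
- move=> [HS HT]; split; first by have [[]] := HS.
  exact: Hspace_disjoint n0 m0 ST plS HS HT.
- by move=> phi0; split; exact: null_space_Hspace.
Qed.
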